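(* Let $p\in\mathbb N$, $p\ge1$, and let $(u_0,\rho_0,\mu_0)\in\mathcal D$. Assume that $(u_0,\rho_0,\mu_0)$ is $p$-regular on a given interval $(x_0,x_1)$ and that there is a constant $c>0$ such that $\rho_0(x)^2\ge c>0$ for $x\in(x_0,x_1)$. Let $(u,\rho,\mu)(t,\cdot)=T_t(u_0,\rho_0,\mu_0)$ and let $y(t,\cdot)$ be the first component of $S_t(L(u_0,\rho_0,\mu_0))$. Then, for any $t\in[0,\infty)$, $(u,\rho,\mu)(t,\cdot)$ is $p$-regular on the interval $(y(t,\xi_0),y(t,\xi_1))$, where $\xi_0$ and $\xi_1$ satisfy $y(0,\xi_0)=x_0$ and $y(0,\xi_1)=x_1$ and are defined as $$\xi_0=\sup\{\xi\in\mathbb R: y(0,\xi)\le x_0\},\qquad \xi_1=\inf\{\xi\in\mathbb R: y(0,\xi)\ge x_1\}.$$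
   Context: **$p$-regularity.** $(u,\rho,\mu)\in\mathcal D$ is $p$-regular on an open set $I$ if $u\in W^{p,\infty}(I)$, $\rho\in W^{p-1,\infty}(I)$ (with $W^{0,\infty}(I)=L^\infty(I)$) and $\mu=\mu_{\rm ac}$ on $I$ ($\mu_{\rm ac}$ being the absolutely continuous part of $\mu$). **Function spaces.** Fix a smooth function $\chi:\mathbb R\to\mathbb R$ with support in $[0,\infty)$, $\chi(x)=1$ for $x\ge1$, $\chi'\ge0$. $H_{0,\infty}(\mathbb R)$ is the space of functions $v=\bar v+c\,\chi$ with $\bar v\in H^1(\mathbb R)$, $c\in\mathbb R$, normed by $\|\bar v\|_{H^1}+|c|$. $L^2_{\rm const}(\mathbb R)$ is the space of functions $\rho=\bar\rho+k$ with $\bar\rho\in L^2(\mathbb R)$, $k\in\mathbb R$, normed by $\|\bar\rho\|_{L^2}+|k|$; for $\rho\in L^2_{\rm const}$, $\bar\rho$ denotes this $L^2$ part. $V=\{f\in C(\mathbb R)\cap L^\infty(\mathbb R): f_\xi\in L^2(\mathbb R)\}$ with norm $\|f\|_{L^\infty}+\|f_\xi\|_{L^2}$. $E=V\times H_{0,\infty}(\mathbb R)\times L^2(\mathbb R)\times L^2_{\rm const}(\mathbb R)$ with the sum of the norms. **Lagrangian notation.** For $X=(\zeta,U,h,r)\in E$ put $y(\xi)=\xi+\zeta(\xi)$ (one also writes $X=(y,U,h,r)$), let $c$ and $k$ be the constants attached to $U\in H_{0,\infty}$ and $r\in L^2_{\rm const}$, and set $\bar U=U-c\,\chi\circ y\in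 H^1$, $\bar r=r-k\,y_\xi\in L^2$. $X$ is identified with $(\zeta,\bar U,c,h,\bar r,k)$. **Lagrangian system** (for the two-component Camassa--Holm system $u_t+uu_x+P_x=0$, $\rho_t+(u\rho)_x=0$, $P-P_{xx}=u^2+\frac12u_x^2+\frac12\rho^2$): $$\zeta_t=U,\quad \bar U_t=-Q-c(\chi'\circ y)U,\quad h_t=2(U^2+\tfrac12k^2-P)U_\xi,\quad \bar r_t=-kU_\xi,\quad c_t=0,\quad k_t=0,$$ where $$P(\xi)=\tfrac14\int_{\mathbb R}e^{-|y(\xi)-y(\eta)|}\big((2\bar U^2+4c\bar U\chi\circ y)y_\xi+2k\bar r+h\big)(\eta)\,d\eta+c^2g\circ y(\xi)+\tfrac12k^2,$$ $$Q(\xi)=-\tfrac14\int_{\mathbb R}\operatorname{sign}(\xi-\eta)e^{-|y(\xi)-y(\eta)|}\big((2\bar U^2+4c\bar U\chi\circ y)y_\xi+2k\bar r+h\big)(\eta)\,d\eta+c^2g'\circ y(\xi),$$ $$g(x)=\chi^2(x)+\tfrac12\int_{\mathbb R}e^{-|x-z|}(2\chi'^2+2\chi\chi'')(z)\,dz.$$ $\mathcal G$ is the set of $X=(\zeta,U,h,r)\in E$ with $\zeta,U\in W^{1,\infty}(\mathbb R)$, $h,r\in L^\infty(\mathbb R)$, and, almost everywhere, $y_\xi\ge0$, $h\ge0$, $y_\xi+h>0$, $y_\xi h=U_\xi^2+\bar r^2$. For $X_0\in\mathcal G$ the system has a unique global solution $X(t)\in\mathcal G$ in $C^1([0,\infty),E)$,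 and $S_t(X_0)=X(t)$. **Subsets of $\mathcal G$.** $G$ is the group of homeomorphisms $f$ of $\mathbb R$ with $f-\mathrm{Id},f^{-1}-\mathrm{Id}\in W^{1,\infty}(\mathbb R)$ and $f_\xi-1\in L^2(\mathbb R)$. With $H(\xi)=\int_{-\infty}^\xi h\,d\tau$, $\mathcal F=\{X\in\mathcal G: y+H\in G\}$ and $\mathcal F_0=\{X\in\mathcal G: y+H=\mathrm{Id}\}$. $S_t$ maps $\mathcal F$ into $\mathcal F$. **Eulerian set.** $\mathcal D$ is the set of triples $(u,\rho,\mu)$ with $u\in H_{0,\infty}(\mathbb R)$, $\rho\in L^2_{\rm const}(\mathbb R)$ and $\mu$ a positive finite Radon measure on $\mathbb R$ whose absolutely continuous part is $\mu_{\rm ac}=(u_x^2+\bar\rho^2)\,dx$. **Maps.** $L:\mathcal D\to\mathcal F_0$, $L(u,\rho,\mu)=(y,U,h,r)$ with $y(\xi)=\sup\{y:\mu((-\infty,y))+y<\xi\}$, $h=1-y_\xi$, $U=u\circ y$, $r=(\rho\circ y)\,y_\xi$. $M:\mathcal F\to\mathcal D$, $M(y,U,h,r)=(u,\rho,\mu)$ with $u(x)=U(\xi)$ for any $\xi$ with $y(\xi)=x$, $\mu=y_\#(h\,d\xi)$, $\bar\rho\,dx=y_\#(\bar r\,d\xi)$, $\rho=k+\bar\rho$ ($y_\#$ is push-forward of measures). $T_t=M\circ S_t\circ L$. *)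

(* Defs.v *)
From HB Require Import structures.
From mathcomp Require Import all_boot all_order all_algebra.
From mathcomp Require Import all_classical all_reals all_analysis.

Set Implicit Arguments.
Unset Strict Implicit.
Unset Printing Implicit Defensive.
Import Order.TTheory GRing.Theory Num.Theory.
Import numFieldNormedType.Exports.
Local Open Scope classical_set_scope.
Local Open Scope ring_scope.

(* Conventions.  Elements of L^2, L^oo, ... are represented by Borel
   functions R -> R, and every condition on them is insensitive to changes on
   Lebesgue-null sets.  Elements of H^1, V and H_{0,oo} are represented by
   their continuous representatives. *)

Local Notation leb := (@lebesgue_measure _).

Section FunctionSpaces.
Context {R : realType}.
Implicit Types (I : set R) (f g phi : R -> R).

Definition smooth phi := forall (n : nat) (x : R), derivable (derive1n n phi) x 1.

Definition test_function I phi :=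
  smooth phi /\
  exists K : set R, [/\ compact K, K `<=` I & forall x, ~ K x -> phi x = 0].

Definition is_weak_derivative I f g :=
  [/\ locally_integrable I f, locally_integrable I g &
      forall phi, test_function I phi ->
        \int[leb]_(x in I) (f x * derive1 phi x)
        = - \int[leb]_(x in I) (g x * phi x)].

(* The weak derivative on the whole line (unique almost everywhere); it is the
   junk value 0 if there is none. *)
Definition wderiv f : R -> R :=
  xget (fun=> 0) [set g | is_weak_derivative setT f g].

Definition L2 : set (R -> R) :=
  [set f | f \in @Lfun _ (measurableTypeR R) R leb 2%:E].

Definition Linfty I : set (R -> R) :=
  [set f | f \_ I \in @Lfun _ (measurableTypeR R) R leb +oo%E].

(* W^{n,oo}(I) for I open. *)
Fixpoint Winfty (n : nat) I : set (R -> R) :=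
  if n is m.+1 then
    [set f | Linfty I f /\ exists2 g, is_weak_derivative I f g & Winfty m I g]
  else Linfty I.

Definition has_L2_derivative f :=
  exists2 g, is_weak_derivative setT f g & L2 g.

Definition H1 : set (R -> R) :=
  [set f | [/\ continuous f, L2 f & has_L2_derivative f]].

Definition V : set (R -> R) :=
  [set f | [/\ continuous f, Linfty setT f & has_L2_derivative f]].

Definition L2_norm f : \bar R := 'N[leb]_2%:E[EFin \o f].
Definition H1_norm f : \bar R := (L2_norm f + L2_norm (wderiv f))%E.
Definition V_norm f : \bar R :=
  ('N[leb]_+oo[EFin \o f] + L2_norm (wderiv f))%E.

Definition cutoff (chi : R -> R) :=
  [/\ smooth chi, forall x, x < 0 -> chi x = 0, forall x, 1 <= x -> chi x = 1
    & forall x, 0 <= derive1 chi x].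

Definition H0infty (chi : R -> R) : set (R -> R) :=
  [set v | exists c : R, H1 (fun x => v x - c * chi x)].

Definition H0infty_cst (chi v : R -> R) : R :=
  xget 0 [set c | H1 (fun x => v x - c * chi x)].

Definition L2const : set (R -> R) :=
  [set rho | exists k : R, L2 (fun x => rho x - k)].

Definition L2const_cst (rho : R -> R) : R :=
  xget 0 [set k | L2 (fun x => rho x - k)].

(* The group G of homeomorphisms of R. *)
Definition relabeling f :=
  exists g, [/\ cancel f g, cancel g f, continuous f & continuous g] /\
    [/\ Winfty 1 setT (fun x => f x - x), Winfty 1 setT (fun x => g x - x)
      & L2 (fun x => wderiv f x - 1)].

End FunctionSpaces.

(* f is a C^1 curve [0,oo) -> (D, N) with derivative v, where D is a subspace
   of W on which N is a norm. *)
Definition C1_curve {R : realType} (W : lmodType R) (D : set W)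
    (N : W -> \bar R) (f v : R -> W) :=
  forall t : R, 0 <= t ->
    [/\ D (f t), D (v t),
        N ((s - t)^-1 *: (f s - f t) - v t)
          @[s --> within [set s | 0 <= s] t^'] --> 0%E
      & N (v s - v t) @[s --> within [set s | 0 <= s] (nbhs t)] --> 0%E].

Section Eulerian.
Context {R : realType}.
Implicit Types (chi : R -> R) (I : set R).

Record eulerian := Eulerian {
  eu : R -> R ;
  erho : R -> R ;
  emu : {finite_measure set (measurableTypeR R) -> \bar R} }.

Definition erhobar (D : eulerian) (x : R) : R :=
  erho D x - L2const_cst (erho D).

(* nu is the absolutely continuous part of mu (Lebesgue decomposition). *)
Definition is_ac_part (mu nu : set (measurableTypeR R) -> \bar R) :=
  nu `<< leb /\
  exists mu_s : {measure set (measurableTypeR R) -> \bar R},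
    (exists N : set (measurableTypeR R),
        [/\ measurable N, leb N = 0%E & mu_s (~` N) = 0%E]) /\
    (forall A, measurable A -> mu A = (nu A + mu_s A)%E).

(* The set of Eulerian coordinates. *)
Definition calD chi (D : eulerian) :=
  [/\ H0infty chi (eu D), L2const (erho D) &
      is_ac_part (emu D) (fun A =>
        \int[leb]_(x in A) ((wderiv (eu D) x ^+ 2 + erhobar D x ^+ 2)%:E))%E].

Definition p_regular (p : nat) I (D : eulerian) :=
  [/\ Winfty p I (eu D), Winfty p.-1 I (erho D) &
      exists2 nu, is_ac_part (emu D) nu &
        forall A : set (measurableTypeR R),
          measurable A -> A `<=` I -> emu D A = nu A].

End Eulerian.
Arguments eulerian R : clear implicits.

Section Lagrangian.
Context {R : realType} (chi : R -> R).

Record lagrangian := Lagrangian {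
  zeta : R -> R ;
  lU : R -> R ;
  lh : R -> R ;
  lr : R -> R }.

Implicit Types X : lagrangian.

Definition ly X (xi : R) : R := xi + zeta X xi.
Definition y_xi X : R -> R := wderiv (ly X).
Definition U_xi X : R -> R := wderiv (lU X).
Definition lc X : R := H0infty_cst chi (lU X).
Definition lk X : R := L2const_cst (lr X).
Definition Ubar X (xi : R) : R := lU X xi - lc X * chi (ly X xi).
Definition rbar X (xi : R) : R := lr X xi - lk X * y_xi X xi.

Definition spaceE X :=
  [/\ V (zeta X), H0infty chi (lU X), L2 (lh X) & L2const (lr X)].

(* Equality in E. *)
Definition eqE X Y :=
  [/\ zeta X = zeta Y, lU X = lU Y,
      {ae leb, forall xi, lh X xi = lh Y xi} &
      {ae leb, forall xi, lr X xi = lr Y xi}].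

Definition calG X :=
  [/\ spaceE X,
      Winfty 1 setT (zeta X) /\ Winfty 1 setT (lU X),
      Linfty setT (lh X) /\ Linfty setT (lr X) &
      {ae leb, forall xi,
        [/\ 0 <= y_xi X xi, 0 <= lh X xi, 0 < y_xi X xi + lh X xi &
            y_xi X xi * lh X xi = U_xi X xi ^+ 2 + rbar X xi ^+ 2]}].

(* Integrability of h makes H real-valued. *)
Definition calF X :=
  [/\ calG X, leb.-integrable setT (EFin \o lh X) &
      relabeling (fun xi =>
        ly X xi + \int[leb]_(tau in `]-oo, xi]) lh X tau)].

Definition gfun (x : R) : R :=
  chi x ^+ 2 + 2^-1 * \int[leb]_z
    (expR (- `|x - z|) *
     (2 * derive1 chi z ^+ 2 + 2 * chi z * derive1n 2 chi z)).

Definition PQ_density X (eta : R) : R :=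
  (2 * Ubar X eta ^+ 2 + 4 * lc X * Ubar X eta * chi (ly X eta)) * y_xi X eta
  + 2 * lk X * rbar X eta + lh X eta.

Definition Pfun X (xi : R) : R :=
  4^-1 * \int[leb]_eta
    (expR (- `|ly X xi - ly X eta|) * PQ_density X eta)
  + lc X ^+ 2 * gfun (ly X xi) + 2^-1 * lk X ^+ 2.

Definition Qfun X (xi : R) : R :=
  - 4^-1 * \int[leb]_eta
    (Num.sg (xi - eta) * expR (- `|ly X xi - ly X eta|) * PQ_density X eta)
  + lc X ^+ 2 * derive1 gfun (ly X xi).

(* Global solutions in C^1([0,oo), E) of the Lagrangian system, with values in
   calG; E is identified with V x H^1 x R x L^2 x L^2 x R through the
   coordinates (zeta, Ubar, c, h, rbar, k). *)
Definition lagrangian_solution (X : R -> lagrangian) :=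
  [/\ forall t, 0 <= t -> calG (X t),
      C1_curve V (@V_norm R) (fun t => zeta (X t)) (fun t => lU (X t)),
      C1_curve H1 (@H1_norm R) (fun t => Ubar (X t))
        (fun t xi => - Qfun (X t) xi
           - lc (X t) * derive1 chi (ly (X t) xi) * lU (X t) xi) &
   [/\ C1_curve L2 (@L2_norm R) (fun t => lh (X t))
        (fun t xi => 2 * (lU (X t) xi ^+ 2 + 2^-1 * lk (X t) ^+ 2
                          - Pfun (X t) xi) * U_xi (X t) xi),
      C1_curve L2 (@L2_norm R) (fun t => rbar (X t))
        (fun t xi => - lk (X t) * U_xi (X t) xi),
      C1_curve (setT : set R^o) (fun x => `|x|%:E) (fun t => lc (X t))
        (fun=> 0) &
      C1_curve (setT : set R^o) (fun x => `|x|%:E) (fun t => lk (X t))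
        (fun=> 0)]].

(* t |-> X t is the trajectory t |-> S_t X0. *)
Definition S_trajectory (X0 : lagrangian) (X : R -> lagrangian) :=
  lagrangian_solution X /\ eqE (X 0) X0.

(* The map L from Eulerian to Lagrangian coordinates. *)
Definition Lmap (D : eulerian R) : lagrangian :=
  let y xi := sup [set x | (emu D `]-oo, x[%classic + x%:E < xi%:E)%E] in
  Lagrangian (fun xi => y xi - xi) (fun xi => eu D (y xi))
    (fun xi => 1 - wderiv y xi) (fun xi => erho D (y xi) * wderiv y xi).

(* The graph of the map M from calF to calD.  As rbar need not be integrable,
   the push-forward identity for rbar is tested on bounded Borel sets. *)
Definition Mgraph X (D : eulerian R) :=
  [/\ calF X, calD chi D,
      forall xi, eu D (ly X xi) = lU X xi,
      forall A : set (measurableTypeR R), measurable A ->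
        emu D A =
        (\int[leb]_(xi in ly X @^-1` A) (lh X xi)%:E)%E &
      L2 (fun x => erho D x - lk X) /\
      forall A : set (measurableTypeR R), measurable A -> bounded_set A ->
        (\int[leb]_(x in A) (erho D x - lk X)%:E =
         \int[leb]_(xi in ly X @^-1` A) (rbar X xi)%:E)%E].

End Lagrangian.
Arguments lagrangian R : clear implicits.

(* Main.v *)
(* Along a trajectory the vector Z = (y_xi, U_xi, h, rbar) solves, for each fixed xi,
   the linear system
     q' = v,  v' = h/2 + k r + A q,  h' = 2 A v,  r' = - k v,  A = U^2 + k^2/2 - P,
   whose coefficient A is one space derivative smoother than Z, since
   P_xi = Q y_xi and Q_xi = - h/2 - k rbar - A y_xi.  Hence W^{n,oo} regularity of Z(0)
   on an interval propagates in time, by induction on n.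

   Moreover rbar + k y_xi is constant in time, while rbar^2 <= y_xi h with h bounded.
   If rho_0 is bounded away from 0, this keeps y_xi bounded away from 0, so y(t, .)
   has a W^{p,oo} inverse z on (y(t, xi_0), y(t, xi_1)); there u = U o z,
   rho = k + (rbar o z) z_x, and mu = y_# (h dxi) is absolutely continuous.

   Initially y(0, .) is the inverse of x + mu_0((-oo, x)), which is W^{p,oo} with
   derivative 1 + u_x^2 + rhobar^2 where mu_0 is absolutely continuous. *)
Require Import Defs.
From HB Require Import structures.
From mathcomp Require Import all_boot all_order all_algebra.
From mathcomp Require Import all_classical all_reals all_analysis.
From mathcomp Require Import measurable_realfun ess_sup_inf ring lra.
Set Implicit Arguments.
Unset Strict Implicit.
Unset Printing Implicit Defensive.
Import Order.TTheory GRing.Theory Num.Theory.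
Import numFieldNormedType.Exports.
Local Open Scope classical_set_scope.
Local Open Scope ring_scope.

(** The norms of the time evolution control y_xi, U_xi, h and rbar only in L^2. Hence the linear
    system is not given pointwise in xi, and the sup bounds that [calG] supplies at each single time
    are not uniform in time. The equations are therefore tested on space intervals. Gronwall
    estimates for these interval integrals first bound y_xi + h uniformly on [0, T], and later give
    the regularity. The first of these estimates needs the nonlocal P to be bounded on compact sets,
    uniformly in time, before any uniform sup bound on h is known. It is available because the
    exponential kernel has mass at most 2 against y_xi dxi, while h enters only through its L^2
    norm. W^{n,oo} is handled as n-fold iterated primitives of a bounded Borel function on a closed
    interval. Product, chain and inverse rules then rest on one principle: a Lipschitz function is
    the primitive of its a.e. derivative. A chain rule whose outer function is merely Lipschitz also
    needs preimages of null sets to be null, which is a second use of lower bounds on slopes. *)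

Local Notation leb := (@lebesgue_measure _).

(** * Integrals, primitives and Lipschitz functions on a segment *)

Section AlmostEverywhere.
Context {R : realType}.
Implicit Types P Q S : R -> Prop.
Local Notation ae P := {ae @lebesgue_measure R, forall x, P x}.

Lemma ae_S P Q : (forall x, P x -> Q x) -> ae P -> ae Q.
Proof. by move=> h; apply: filterS; [exact: (ae_filter_ringOfSetsType lebesgue_measure)|exact: h]. Qed.

Lemma ae_S2 P Q S : (forall x, P x -> Q x -> S x) -> ae P -> ae Q -> ae S.
Proof. by move=> h; apply: filterS2; [exact: (ae_filter_ringOfSetsType lebesgue_measure)|exact: h]. Qed.

Lemma ae_S3 P Q S V : (forall x, P x -> Q x -> S x -> V x) -> ae P -> ae Q -> ae S -> ae V.
Proof. by move=> h; apply: filterS3; [exact: (ae_filter_ringOfSetsType lebesgue_measure)|exact: h]. Qed.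

Lemma ae_T P : (forall x, P x) -> ae P.
Proof. by move=> h; apply: aeW. Qed.

Lemma ae_neq (a : R) : ae (fun x => x != a).
Proof.
exists [set a]; split; [exact: measurable_set1|exact: lebesgue_measure_set1|].
by move=> x /= /negP; rewrite negbK => /eqP.
Qed.

End AlmostEverywhere.

Section IntervalIntegrals.
Context {R : realType}.
Implicit Types (a b x y z : R) (f g : R -> R).

Definition itg x y g : R := \int[leb]_(t in `[x, y]) g t.

Definition intg a b g := (@lebesgue_measure R).-integrable `[a, b] (EFin \o g).

Definition bmf a b g :=
  measurable_fun (`[a, b] : set R) g /\ exists C : R, forall x, a <= x <= b -> `|g x| <= C.

(** Absolute continuity with density [g], in integrated form. Space derivatives are handled this way
    because the identity survives a change of [g] on a null set and asks for no differentiability of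
    [f] at a given point. *)
Definition prim a b f g :=
  forall x y, a <= x -> x <= y -> y <= b -> f y - f x = itg x y g.

Definition lip a b f (K : R) :=
  forall x y, a <= x -> x <= y -> y <= b -> `|f y - f x| <= K * (y - x).

Lemma subset_itvcc a b x y : a <= x -> y <= b -> (`[x, y] : set R) `<=` `[a, b].
Proof.
move=> ax yb z /=; rewrite !in_itv /= => /andP[xz zy].
by rewrite (le_trans ax xz) (le_trans zy yb).
Qed.

Lemma intgS a b x y g : a <= x -> y <= b -> intg a b g -> intg x y g.
Proof.
move=> ax yb; apply: integrableS => //; exact: subset_itvcc.
Qed.

Lemma bmfS a b x y g : a <= x -> y <= b -> bmf a b g -> bmf x y g.
Proof.
move=> ax yb [mg [C gC]]; split.
  by apply: measurable_funS mg => //; exact: subset_itvcc.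
exists C => z /andP[xz zy]; apply: gC.
by rewrite (le_trans ax xz) (le_trans zy yb).
Qed.

Lemma leb_itvcc x y : x <= y -> @lebesgue_measure R `[x, y]%classic = (y - x)%:E.
Proof.
rewrite le_eqVlt => /predU1P[->|xy]; rewrite lebesgue_measure_itv/= lte_fin ?ltxx ?subrr//.
by rewrite xy.
Qed.

Lemma leb_itvcc_fin x y : (@lebesgue_measure R `[x, y]%classic < +oo)%E.
Proof. by rewrite lebesgue_measure_itv/=; case: ifP => // _; rewrite ltry. Qed.

Lemma bmf_intg {a b g} : bmf a b g -> intg a b g.
Proof.
move=> [mg [C gC]]; apply: measurable_bounded_integrable => //.
  exact: leb_itvcc_fin.
exists C; split; first exact: num_real.
move=> M CM x /=; rewrite in_itv /= => xab.
by apply: le_trans (ltW CM); exact: gC.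
Qed.

Lemma itgxx x g : itg x x g = 0.
Proof. by rewrite /itg set_itv1 Rintegral_set1. Qed.

Lemma itg_cat x y z g : x <= y -> y <= z -> intg x z g ->
  itg x z g = itg x y g + itg y z g.
Proof.
move=> xy yz ig; rewrite /itg.
have := @Rintegral_itvB R g (BLeft x) (BRight z) y ig.
rewrite !bnd_simp => /(_ xy yz).
rewrite Rintegral_itv_obnd_cbnd; last first.
  apply: integrableS ig => //=; move=> t /=; rewrite !in_itv /= => /andP[yt ->].
  by rewrite (le_trans xy (ltW yt)).
by move=> <-; rewrite addrC subrK.
Qed.

Lemma itgD x y f g : intg x y f -> intg x y g ->
  itg x y (fun t => f t + g t) = itg x y f + itg x y g.
Proof. by move=> fi gi; rewrite /itg RintegralD. Qed.

Lemma itgB x y f g : intg x y f -> intg x y g ->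
  itg x y (fun t => f t - g t) = itg x y f - itg x y g.
Proof. by move=> fi gi; rewrite /itg RintegralB. Qed.

Lemma itgZ x y c f : intg x y f -> itg x y (fun t => c * f t) = c * itg x y f.
Proof. by move=> fi; rewrite /itg RintegralZl. Qed.

Lemma itg_cst x y c : x <= y -> itg x y (fun=> c) = c * (y - x).
Proof. by move=> xy; rewrite /itg Rintegral_cst//; have /= -> := leb_itvcc xy. Qed.

Lemma intg_cst a b c : intg a b (fun=> c).
Proof.
apply: bmf_intg; split; first exact: measurable_cst.
by exists `|c|.
Qed.

Lemma intgD a b f g : intg a b f -> intg a b g -> intg a b (fun t => f t + g t).
Proof.
move=> fi gi; rewrite /intg.
rewrite (_ : _ \o _ = ((EFin \o f) \+ (EFin \o g))%E); first exact: integrableD.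
by apply/funext => t /=; rewrite EFinD.
Qed.

Lemma intgZ a b c f : intg a b f -> intg a b (fun t => c * f t).
Proof.
move=> fi; rewrite /intg.
rewrite (_ : _ \o _ = (fun t => c%:E * (EFin \o f) t)%E); first exact: integrableZl.
by apply/funext => t /=; rewrite EFinM.
Qed.

Lemma intgB a b f g : intg a b f -> intg a b g -> intg a b (fun t => f t - g t).
Proof.
move=> fi gi; rewrite (_ : (fun t => _) = fun t => f t + -1 * g t).
  by apply: intgD => //; exact: intgZ.
by apply/funext => t; rewrite mulN1r.
Qed.

Lemma intg_norm a b f : intg a b f -> intg a b (fun t => `|f t|).
Proof. by move=> fi; exact: (integrable_norm fi). Qed.

Lemma itg_le x y f g : intg x y f -> intg x y g ->
  (forall t, x <= t <= y -> f t <= g t) -> itg x y f <= itg x y g.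
Proof.
move=> fi gi fg; apply: le_Rintegral => // t /=; rewrite in_itv /=; exact: fg.
Qed.

Lemma itg_ge0 x y f : (forall t, x <= t <= y -> 0 <= f t) -> 0 <= itg x y f.
Proof. by move=> f0; apply: Rintegral_ge0 => t /=; rewrite in_itv /=; exact: f0. Qed.

Lemma itg_norm x y f : intg x y f -> `|itg x y f| <= itg x y (fun t => `|f t|).
Proof. by move=> fi; apply: le_normr_Rintegral. Qed.

Lemma itg_bound x y f C : x <= y -> intg x y f ->
  (forall t, x <= t <= y -> `|f t| <= C) -> `|itg x y f| <= C * (y - x).
Proof.
move=> xy fi fC; apply: (le_trans (itg_norm fi)).
by rewrite -itg_cst//; apply: itg_le => //; [exact: intg_norm|exact: intg_cst].
Qed.

Lemma eq_itg x y f g : (forall t, x <= t <= y -> f t = g t) -> itg x y f = itg x y g.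
Proof.
by move=> fg; apply: eq_Rintegral => t; rewrite inE /= in_itv /=; exact: fg.
Qed.

Lemma eq_intg a b f g : (forall t, a <= t <= b -> f t = g t) -> intg a b f -> intg a b g.
Proof.
by move=> fg; apply: eq_integrable => // t; rewrite inE /= in_itv /= => tab; rewrite /= fg.
Qed.

Lemma intg_measurable a b f : intg a b f -> measurable_fun (`[a, b] : set R) f.
Proof. by move=> /measurable_int/measurable_EFinP. Qed.

Definition aeq a b f g := {ae @lebesgue_measure R, forall t, a <= t <= b -> f t = g t}.

Lemma aeq_itg x y f g : measurable_fun (`[x, y] : set R) f ->
  measurable_fun (`[x, y] : set R) g -> aeq x y f g -> itg x y f = itg x y g.
Proof.
move=> mf mg fg; rewrite /itg /Rintegral; congr fine.
apply: ae_eq_integral => //; [exact/measurable_EFinP..|].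
by apply: ae_S fg => t /= h; rewrite in_itv/= => /h ->.
Qed.

Lemma prim_lip a b f g C : intg a b g -> (forall t, a <= t <= b -> `|g t| <= C) ->
  prim a b f g -> lip a b f C.
Proof.
move=> gi gC fg x y ax xy yb; rewrite fg//; apply: itg_bound => //.
  exact: intgS gi.
by move=> t /andP[xt ty]; apply: gC; rewrite (le_trans ax xt) (le_trans ty yb).
Qed.

Lemma prim_from a b f g : intg a b g ->
  (forall x, a <= x <= b -> f x = f a + itg a x g) -> prim a b f g.
Proof.
move=> gi fg x y ax xy yb.
rewrite fg ?(le_trans ax xy)//= (fg x) ?ax ?(le_trans xy yb)//.
by rewrite (itg_cat ax xy); [ring|exact: intgS gi].
Qed.

Lemma primitive_prim a b g c : intg a b g -> prim a b (fun x => c + itg a x g) g.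
Proof.
by move=> gi; apply: prim_from => // x _; rewrite itgxx addr0.
Qed.

Lemma ae_oo_cc a b (P : R -> Prop) :
  {ae @lebesgue_measure R, forall t, a < t < b -> P t} ->
  {ae @lebesgue_measure R, forall t, a <= t <= b -> P t}.
Proof.
apply: ae_S3 (ae_neq a) (ae_neq b) => t ta tb h /andP[a't tb'].
by apply: h; rewrite !lt_neqAle eq_sym ta tb a't tb'.
Qed.

Lemma aeq_sym a b f g : aeq a b f g -> aeq a b g f.
Proof. by apply: ae_S => t h /h. Qed.

Lemma aeq_trans a b f g h : aeq a b f g -> aeq a b g h -> aeq a b f h.
Proof. by apply: ae_S2 => t fg gh /[dup]/fg -> /gh. Qed.

Lemma prim_aeq a b f g g' : intg a b g -> measurable_fun (`[a, b] : set R) g' ->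
  aeq a b g g' -> prim a b f g -> prim a b f g'.
Proof.
move=> gi mg' gg' fg x y ax xy yb; rewrite fg//; apply: aeq_itg.
- exact: intg_measurable (intgS ax yb gi).
- by apply: measurable_funS mg' => //; exact: subset_itvcc.
- apply: ae_S gg' => t h /andP[xt ty]; apply: h.
  by rewrite (le_trans ax xt) (le_trans ty yb).
Qed.

(** The bound in [bmf] is required at every point, whereas densities come with a.e. bounds. The
    offending values become 0, and the maximum with 0 covers a negative [C]. *)
Lemma bmf_trunc a b g C : measurable_fun (`[a, b] : set R) g ->
  {ae @lebesgue_measure R, forall t, a <= t <= b -> `|g t| <= C} ->
  exists g', [/\ measurable_fun (`[a, b] : set R) g', 
   (forall t, `|g' t| <= Num.max C 0) & aeq a b g g'].
Proof.
move=> mg gC; exists (fun t => if `|g t| <= C then g t else 0); split.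
- apply: measurable_fun_if => //.
  + by apply: measurable_fun_ler => //; apply: measurableT_comp.
  + by apply: measurable_funS mg => //; exact: subIsetl.
- by move=> t; case: ifPn => h; rewrite le_max ?h// normr0 lexx orbT.
- by apply: ae_S gC => t h tab; rewrite h.
Qed.

End IntervalIntegrals.

(** * Lipschitz functions as primitives of bounded functions *)

Section LipschitzPrimitive.
Context {R : realType}.
Implicit Types (a b x y z K : R) (f g : R -> R).

(** By the definition of Lebesgue outer measure, a null set has countable covers by half-open
    intervals of arbitrarily small total length, and [nu] of such a cover is at most [K] times that
    length. *)
Lemma lip_dominated (nu : {measure set (measurableTypeR R) -> \bar R}) K : 0 <= K ->
  (forall x y, x <= y -> (nu `]x, y]%classic <= (K * (y - x))%:E)%E) ->
  nu `<< @lebesgue_measure R.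
Proof.
move=> K0 nuK; apply/null_content_dominatesP => A mA A0.
apply/eqP; rewrite eq_le measure_ge0 andbT.
apply/lee_addgt0Pr => e e0; rewrite add0e.
have eK : 0 < e / (K + 1) by rewrite divr_gt0// ltr_wpDl.
have /ereal_inf_lt[z [/= F covF Fz] ze] :
    (@lebesgue_measure R A < (e / (K + 1))%:E)%E by rewrite A0 lte_fin.
case: covF => mF AF.
have mF' n : measurable (F n : set (measurableTypeR R)).
  by apply: sub_sigma_algebra; exact: mF.
apply: (@le_trans _ _ (\sum_(n <oo) nu (F n))%E).
  by apply: measure_sigma_subadditive => //.
apply: (@le_trans _ _ (\sum_(n <oo) (K%:E * wlength idfun (F n)))%E).
  apply: lee_nneseries => [//|n _].
  have /ocitvP[->|[[x y] /= xy ->]] := mF n.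
    by rewrite measure0 wlength0 mule0.
  by rewrite wlength_itv_bnd ?(ltW xy)//; exact/nuK/ltW.
rewrite nneseriesZl//.
rewrite Fz; apply: (@le_trans _ _ (K%:E * (e / (K + 1))%:E)%E).
  by apply: lee_wpmul2l; [rewrite lee_fin|exact: ltW].
rewrite -EFinM lee_fin mulrCA ler_piMr// ?(ltW e0)//.
by rewrite ler_pdivrMr ?ltr_wpDl// mul1r lerDl.
Qed.

Lemma near_itvoo a b t : a < t < b -> \forall y \near t, a < y < b.
Proof.
move=> tab; have := @near_in_itvoo R a b t; rewrite in_itv /= => /(_ tab).
by apply: filterS => y; rewrite in_itv.
Qed.

(** Lebesgue differentiation for the extension of [g] by 0 to the line, whose integral from [a]
    agrees with [f - f a] near every interior point. *)
Lemma prim_derive a b f g : intg a b g -> prim a b f g ->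
  {ae @lebesgue_measure R, forall t, a < t < b -> is_derive t 1 f (g t)}.
Proof.
move=> gi fg; pose g' := g \_ `[a, b].
have g'i : (@lebesgue_measure R).-integrable setT (EFin \o g').
  by rewrite -restrict_EFin; apply/integrable_restrict => //=; rewrite setTI.
have lg' : locally_integrable setT g'.
  by apply: open_integrable_locally => //; exact: openT.
have g'iy y : (@lebesgue_measure R).-integrable `[a, y] (EFin \o g').
  exact: integrableS g'i.
have := @FTC1 R g' (BLeft a) g'iy lg'.
apply: ae_S => t h /andP[at' tb].
have [|dF F't] := h; first by rewrite lte_fin.
have F't' : 'D_1 (fun y => \int[lebesgue_measure]_(s in `[a, y]) g' s) t = g t.
  rewrite -derive1E F't /g' patchE ifT// inE /= in_itv /=.
  by rewrite (ltW at') (ltW tb).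
have dF' := DeriveDef dF F't'.
have E : \forall y \near t, f a + \int[lebesgue_measure]_(s in `[a, y]) g' s = f y.
  near=> y.
  have /andP[/ltW ay /ltW yb] : a < y < b.
    by near: y; apply: near_itvoo; rewrite at' tb.
  rewrite (_ : Rintegral _ _ _ = itg a y g); first by rewrite -fg// addrC subrK.
  apply: eq_Rintegral => s; rewrite inE /= in_itv /= => /andP[as_ sy].
  by rewrite /g' patchE ifT// inE /= in_itv /= as_ (le_trans sy yb).
apply: near_eq_is_derive E _.
by rewrite -[X in is_derive _ _ _ X]add0r; apply: is_deriveD.
Unshelve. all: by end_near. Qed.

Lemma lip_derive_le a b f K t v : lip a b f K -> a < t < b -> is_derive t 1 f v -> `|v| <= K.
Proof.
move=> fK /andP[at' tb] [df <-].
have /cvg_ex[l hl] := df.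
have -> : 'D_1 f t = l by apply: cvg_lim.
have : (fun h => `|h^-1 *: (f (h *: 1 + t) - f t)|) h @[h --> 0^'] --> `|l|.
  exact: cvg_norm.
move=> /cvgr_to_le; apply; near=> h.
have h0 : h != 0 by near: h; exact: nbhs_dnbhs_neq.
have : `|h| <= Num.min (t - a) (b - t).
  by near: h; apply: dnbhs0_le; rewrite lt_min !subr_gt0 at' tb.
rewrite le_min => /andP[/ler_normlP[h1 _] /ler_normlP[_ h2]].
have ah : a <= h + t by lra.
have hb : h + t <= b by lra.
move=> {h1 h2}.
rewrite /= /GRing.scale/= mulr1 normrM normfV ler_pdivrMl ?normr_gt0// mulrC.
have [h1|h1] := leP 0 h.
  have := fK t (h + t) (ltW at') _ hb; rewrite (ger0_norm h1) addrK; apply.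
  by rewrite lerDr.
have := fK (h + t) t ah _ (ltW tb); rewrite (ltr0_norm h1) distrC opprD addrCA subrr addr0.
by apply; rewrite gerDr ltW.
Unshelve. all: by end_near. Qed.

(* The Stieltjes measure of f + K id is dominated by Lebesgue measure: take its
   Radon-Nikodym density. *)
Lemma lip_prim a b f K : a < b -> 0 <= K -> lip a b f K ->
  exists g, [/\ measurable_fun (`[a, b] : set R) g, forall t, `|g t| <= K & prim a b f g].
Proof.
move=> ab K0 fK.
(* [cl] projects the line onto [a, b]. Composed with it, [f + K id] extends to the line with slopes
   between 0 and 2 K, hence monotone and right continuous as a cumulative function must be. *)
pose cl x := Num.max a (Num.min b x).
have cl_in x : a <= cl x <= b.
  by rewrite /cl le_max lexx/= ge_max (ltW ab)/= ge_min lexx.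
have clE x : a <= x <= b -> cl x = x.
  by rewrite /cl => /andP[ax xb]; rewrite (min_idPr xb) (max_idPr ax).
have cl_nd x y : x <= y -> cl x <= cl y <= cl x + (y - x).
  rewrite /cl => xy; apply/andP; split.
    by rewrite ge_max le_max lexx/= le_max ge_min; apply/orP; right; rewrite le_min !ge_min lexx xy orbT.
  rewrite ge_max; apply/andP; split.
    by rewrite ler_wpDr ?subr_ge0// le_max lexx.
  rewrite -lerBlDr le_max; apply/orP; right.
  by rewrite le_min !lerBlDr !ge_min; apply/andP; split; apply/orP; [left|right]; lra.
pose F x := f (cl x) + K * cl x.
have FK x y : x <= y -> 0 <= F y - F x <= (2 * K) * (y - x).
  move=> xy; have /andP[c1 c2] := cl_nd _ _ xy.
  have /andP[ax xb] := cl_in x; have /andP[ay yb] := cl_in y.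
  have := fK _ _ ax c1 yb; rewrite ler_norml => /andP[h1 h2].
  rewrite /F; apply/andP; split; first by lra.
  have : K * (cl y - cl x) <= K * (y - x) by apply: ler_wpM2l => //; lra.
  lra.
have Fnd : nondecreasing F.
  by move=> x y xy; have /andP[] := FK _ _ xy; rewrite subr_ge0.
have Frc : right_continuous F.
  move=> x; apply/cvgrPdist_le => e e0; near=> y.
  have xy : x <= y by near: y; exact: nbhs_right_ge.
  have /andP[h1 h2] := FK _ _ xy.
  rewrite distrC ger0_norm//; apply: (le_trans h2).
  have : y - x <= e / (2 * K + 1).
    rewrite lerBlDl; near: y; apply: nbhs_right_le.
    by rewrite ltrDl divr_gt0// ltr_wpDl// mulr_ge0.
  have p : 0 < 2 * K + 1 by lra.
  rewrite ler_pdivlMr// => h3; have : 0 <= y - x by lra.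
  lra.
pose Fc : cumulative R R := HB.pack F (isCumulative.Build R _ R F Fnd Frc).
pose nu := lebesgue_stieltjes_measure Fc.
have nuE x y : x <= y -> nu `]x, y]%classic = (F y - F x)%:E.
  move=> xy; rewrite /nu /lebesgue_stieltjes_measure /measure_extension.
  apply: (eq_trans (@measurable_mu_extE _ _ _ (wlength Fc) _ (is_ocitv x y))).
  by rewrite /= wlength_itv_bnd.
have nudom : nu `<< @lebesgue_measure R.
  apply: (@lip_dominated _ (2 * K)); first by rewrite mulr_ge0.
  by move=> x y xy; rewrite [X in (X <= _)%E]nuE// lee_fin; have /andP[] := FK _ _ xy.
have mD : measurable (`]a, b] : set (measurableTypeR R)) by exact: measurable_itv.
have nuD : (nu `]a, b]%classic < +oo)%E by rewrite nuE ?(ltW ab)// ltry.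
(* The restriction to ]a, b] is a finite measure, the form in which the Radon-Nikodym theorem takes
   it. *)
pose nu' := mfrestr mD nuD.
have nu'dom : nu' `<< @lebesgue_measure R.
  apply/null_content_dominatesP => A mA A0; rewrite /nu' /mfrestr /mrestr.
  move/null_content_dominatesP : nudom; apply; first exact: measurableI.
  apply/eqP; rewrite -measure_le0 -A0.
  by apply: le_measure; rewrite ?inE//; exact: measurableI.
have [h [h0 hfin hi hE]] := radon_nikodym_sigma_finite nu'dom.
pose g t := fine (h t).
have hg : h = EFin \o g by apply/funext => t; rewrite /g /= fineK.
have gi : intg a b (fun t => g t).
  by rewrite /intg -hg; exact: integrableS hi.
pose f2 x := f x + K * x.
have f2g : prim a b f2 g.
  move=> x y ax xy yb; rewrite /itg.
  rewrite -Rintegral_itv_obnd_cbnd; last first.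
    by rewrite -hg; exact: integrableS hi.
  have : nu (`]x, y] `&` `]a, b])%classic =
      (\int[lebesgue_measure]_(s in `]x, y]) h s)%E := hE _ (measurable_itv _).
  rewrite setIidl; last first.
    move=> z /=; rewrite !in_itv /= => /andP[xz zy].
    by rewrite (le_lt_trans ax xz) (le_trans zy yb).
  rewrite nuE// hg /Rintegral /= => <- /=.
  by rewrite /F !clE// ?ax ?yb ?(le_trans ax xy) ?(le_trans xy yb).
have fgK : prim a b f (fun t => g t - K).
  move=> x y ax xy yb; rewrite itgB; [|exact: intgS gi|exact: intg_cst].
  by rewrite -f2g// itg_cst// /f2; ring.
have gKi : intg a b (fun t => g t - K) by apply: intgB => //; exact: intg_cst.
(* [g - K] is a.e. the derivative of the [K]-Lipschitz [f], so the bound on the density comes from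
   difference quotients. *)
have gKb : {ae @lebesgue_measure R, forall t, a <= t <= b -> `|g t - K| <= K}.
  apply: ae_oo_cc; have := prim_derive gKi fgK.
  apply: ae_S => t dt tab; exact: lip_derive_le fK tab (dt tab).
have [g' [mg' g'K gg']] := bmf_trunc (intg_measurable gKi) gKb.
exists g'; split => //; last exact: prim_aeq gg' fgK.
by move=> t; rewrite (le_trans (g'K t))// ge_max lexx.
Unshelve. all: by end_near. Qed.

End LipschitzPrimitive.

(** * Product and chain rules for primitives *)

Section Calculus.
Context {R : realType}.
Implicit Types (a b c d x y z K m M : R) (f g h F G phi : R -> R).

Lemma is_derive_uniq f (t u v : R) : is_derive t 1 f u -> is_derive t 1 f v -> u = v.
Proof. by move=> [_ <-] [_ <-]. Qed.

Lemma prim_unique a b f g1 g2 : intg a b g1 -> intg a b g2 ->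
  prim a b f g1 -> prim a b f g2 -> aeq a b g1 g2.
Proof.
move=> i1 i2 p1 p2; apply: ae_oo_cc.
apply: ae_S2 (prim_derive i1 p1) (prim_derive i2 p2) => t d1 d2 tab.
exact: is_derive_uniq (d1 tab) (d2 tab).
Qed.

(** [lip_prim] provides some density, and differentiating the primitive identifies it with [g]
    almost everywhere. Each rule below thus reduces to the pointwise rule at almost every point
    together with a Lipschitz bound. *)
Lemma lip_ae_prim a b f g K : a < b -> lip a b f K ->
  measurable_fun (`[a, b] : set R) g ->
  {ae @lebesgue_measure R, forall t, a < t < b -> is_derive t 1 f (g t)} ->
  prim a b f g.
Proof.
move=> ab fK mg fg.
have K0 : 0 <= K.
  have := fK a b (lexx a) (ltW ab) (lexx b).
  by move/(le_trans (normr_ge0 _)); rewrite pmulr_lge0// subr_gt0.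
have [g0 [mg0 g0K fg0]] := lip_prim ab K0 fK.
have ig0 : intg a b g0 by apply: bmf_intg; split => //; exists K => x _; exact: g0K.
apply: (prim_aeq ig0 mg _ fg0); apply: ae_oo_cc.
apply: ae_S2 (prim_derive ig0 fg0) fg => t d1 d2 tab.
exact: is_derive_uniq (d1 tab) (d2 tab).
Qed.

Lemma prim_bmf_lip a b f g : bmf a b g -> prim a b f g -> exists2 K : R, 0 <= K & lip a b f K.
Proof.
move=> gb fg; have [mg [C gC]] := gb.
exists `|C|; first exact: normr_ge0.
apply: prim_lip fg; first exact: bmf_intg.
by move=> t /gC /le_trans; apply; exact: ler_norm.
Qed.

Lemma lip_sym a b f K x y : lip a b f K -> a <= x <= b -> a <= y <= b ->
  `|f y - f x| <= K * `|y - x|.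
Proof.
move=> fK /andP[ax xb] /andP[ay yb]; have [xy|yx] := leP x y.
  by rewrite (ger0_norm (_ : 0 <= y - x)) ?subr_ge0//; exact: fK.
rewrite distrC (distrC y) (ger0_norm (_ : 0 <= x - y)) ?subr_ge0 ?(ltW yx)//.
by apply: fK => //; exact: ltW.
Qed.

Lemma lip_continuous a b f K : lip a b f K -> {within `[a, b], continuous f}.
Proof.
move=> fK; apply/subspace_continuousP => x; rewrite /= in_itv/= => xab.
apply/cvgrPdist_le => e e0; near=> y.
have yab : a <= y <= b.
  have : y \in `[a, b] by near: y; apply: withinT.
  by rewrite in_itv.
rewrite distrC; apply: (le_trans (lip_sym fK xab yab)).
have K1 : 0 < `|K| + 1 by rewrite ltr_wpDl.
have : `|y - x| <= e / (`|K| + 1).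
  near: y; apply: cvg_within; exists (e / (`|K| + 1)) => /=; first by rewrite divr_gt0.
  by move=> z /=; rewrite distrC => /ltW.
rewrite ler_pdivlMr// => h; apply: le_trans h; rewrite mulrC ler_wpM2l//.
by rewrite (le_trans (ler_norm K))// lerDl.
Unshelve. all: by end_near. Qed.

Lemma lip_measurable a b f K : lip a b f K -> measurable_fun (`[a, b] : set R) f.
Proof.
move=> fK; apply: subspace_continuous_measurable_fun => //; exact: lip_continuous fK.
Qed.

Lemma lip_bounded a b f K x : 0 <= K -> lip a b f K -> a <= x <= b ->
  `|f x| <= `|f a| + K * (b - a).
Proof.
move=> K0 fK /andP[ax xb].
rewrite -(subrK (f a) (f x)) addrC; apply: (le_trans (ler_normD _ _)).
rewrite lerD2l; apply: (le_trans (fK _ _ (lexx a) ax xb)).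
by rewrite ler_wpM2l// lerB.
Qed.

Lemma lip_bmf a b f K : 0 <= K -> lip a b f K -> bmf a b f.
Proof.
move=> K0 fK; split; first exact: lip_measurable fK.
by exists (`|f a| + K * (b - a)) => x; exact: lip_bounded.
Qed.

Lemma prim_bmf a b f g : bmf a b g -> prim a b f g -> bmf a b f.
Proof. by move=> gb /(prim_bmf_lip gb)[K K0]; exact: lip_bmf. Qed.

Lemma bmf_cst a b c : bmf a b (fun=> c).
Proof. by split; [exact: measurable_cst|exists `|c|]. Qed.

Lemma bmfD a b f g : bmf a b f -> bmf a b g -> bmf a b (fun x => f x + g x).
Proof.
move=> [mf [C fC]] [mg [D gD]]; split; first exact: measurable_funD.
exists (C + D) => x xab; apply: (le_trans (ler_normD _ _)).
by apply: lerD; [exact: fC|exact: gD].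
Qed.

Lemma bmfM a b f g : bmf a b f -> bmf a b g -> bmf a b (fun x => f x * g x).
Proof.
move=> [mf [C fC]] [mg [D gD]]; split; first exact: measurable_funM.
exists (C * D) => x xab; rewrite normrM.
by apply: ler_pM => //; [exact: fC|exact: gD].
Qed.

Lemma lipM a b f g Kf Kg Cf Cg : lip a b f Kf -> lip a b g Kg ->
  (forall x, a <= x <= b -> `|f x| <= Cf) -> (forall x, a <= x <= b -> `|g x| <= Cg) ->
  lip a b (fun x => f x * g x) (Cf * Kg + Cg * Kf).
Proof.
move=> fK gK fC gC x y ax xy yb.
have xab : a <= x <= b by rewrite ax (le_trans xy yb).
have yab : a <= y <= b by rewrite yb (le_trans ax xy).
rewrite (_ : _ - _ = f y * (g y - g x) + g x * (f y - f x)); last by ring.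
apply: (le_trans (ler_normD _ _)); rewrite !normrM mulrDl -!mulrA.
apply: lerD; apply: ler_pM => //; by [exact: fC|exact: gC|exact: fK|exact: gK].
Qed.

Lemma primM a b f g f' g' : a < b -> bmf a b f' -> bmf a b g' ->
  prim a b f f' -> prim a b g g' ->
  prim a b (fun x => f x * g x) (fun x => f' x * g x + f x * g' x).
Proof.
move=> ab f'b g'b ff' gg'.
have [mf [Cf fC]] := prim_bmf f'b ff'; have [mg [Cg gC]] := prim_bmf g'b gg'.
have [Kf _ fK] := prim_bmf_lip f'b ff'; have [Kg _ gK] := prim_bmf_lip g'b gg'.
apply: (lip_ae_prim ab (lipM fK gK fC gC)).
  by apply: measurable_funD; apply: measurable_funM => //; [case: f'b|case: g'b].
apply: ae_S2 (prim_derive (bmf_intg f'b) ff') (prim_derive (bmf_intg g'b) gg').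
move=> t df dg tab; have {}df := df tab; have {}dg := dg tab.
rewrite (_ : f' t * g t + f t * g' t = f t *: g' t + g t *: f' t).
  exact: is_deriveM.
by rewrite /GRing.scale/= addrC (mulrC (f' t)).
Qed.

Lemma primD a b f g f' g' : intg a b f' -> intg a b g' ->
  prim a b f f' -> prim a b g g' ->
  prim a b (fun x => f x + g x) (fun x => f' x + g' x).
Proof.
move=> fi gi pf pg x y ax xy yb.
rewrite itgD; [|exact: intgS fi|exact: intgS gi].
by rewrite -pf// -pg//; ring.
Qed.

Lemma prim_cst a b c : prim a b (fun=> c) (fun=> 0).
Proof. by move=> x y ax xy yb; rewrite itg_cst// mul0r subrr. Qed.

Lemma prim_id a b : prim a b id (fun=> 1).
Proof. by move=> x y ax xy yb; rewrite itg_cst// mul1r. Qed.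

Lemma derive_lip G G' m M C : (forall x, m <= x <= M -> is_derive x 1 G (G' x)) ->
  (forall x, m <= x <= M -> `|G' x| <= C) -> lip m M G C.
Proof.
move=> dG GC x y mx; rewrite le_eqVlt => /predU1P[-> _|xy yM].
  by rewrite !subrr normr0 mulr0.
have sub z : x <= z <= y -> m <= z <= M.
  by move=> /andP[xz zy]; rewrite (le_trans mx xz) (le_trans zy yM).
have [z|z|z zxy ->] := @MVT _ G G' _ _ xy.
- by rewrite in_itv /= => /andP[xz zy]; apply: dG; apply: sub; rewrite !ltW.
- apply: derivable_within_continuous => u; rewrite in_itv /= => uxy.
  by have [] := dG u (sub _ uxy).
rewrite normrM (ger0_norm (_ : 0 <= y - x)) ?subr_ge0 ?(ltW xy)//.
rewrite ler_wpM2r ?subr_ge0 ?(ltW xy)//; apply: GC; apply: sub.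
by move: zxy; rewrite in_itv /= => /andP[xz zy]; rewrite !ltW.
Qed.

Lemma prim_comp_derive a b f f' G G' m M C : a < b -> bmf a b f' -> prim a b f f' ->
  (forall x, a <= x <= b -> m <= f x <= M) ->
  (forall x, m <= x <= M -> is_derive x 1 G (G' x)) ->
  (forall x, m <= x <= M -> `|G' x| <= C) ->
  measurable_fun (`[a, b] : set R) (fun x => G' (f x)) ->
  prim a b (fun x => G (f x)) (fun x => G' (f x) * f' x).
Proof.
move=> ab f'b ff' fmM dG GC mG.
have [K K0 fK] := prim_bmf_lip f'b ff'.
have GK := derive_lip dG GC.
have C0 : 0 <= C.
  by rewrite (le_trans (normr_ge0 _) (GC _ (fmM a _)))// lexx ltW.
have lipGf : lip a b (fun x => G (f x)) (C * K).
  move=> x y ax xy yb.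
  apply: (le_trans (lip_sym GK (fmM x _) (fmM y _))).
  - by rewrite ax (le_trans xy).
  - by rewrite yb (le_trans ax).
  - by rewrite -mulrA ler_wpM2l//; exact: fK.
apply: (lip_ae_prim ab lipGf); first by apply: measurable_funM => //; case: f'b.
apply: ae_S (prim_derive (bmf_intg f'b) ff') => t df tab.
have {}df := df tab; have dGt := dG (f t).
have {}dGt : is_derive (f t) 1 G (G' (f t)).
  by apply: dGt; apply: fmM; move/andP: tab => [? ?]; rewrite !ltW.
exact: (@is_derive1_comp R).
Qed.


(** An expanding map pulls ]x, y] back into an interval of length (y - x) / e. The image under [phi]
    of Lebesgue measure on [a, b] is therefore dominated by Lebesgue measure, by [lip_dominated]. *)
Lemma preimage_null a b phi (e : R) (P : R -> Prop) : a < b -> 0 < e ->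
  measurable_fun (`[a, b] : set R) phi ->
  (forall x y, a <= x -> x <= y -> y <= b -> e * (y - x) <= phi y - phi x) ->
  {ae @lebesgue_measure R, forall x, P x} ->
  {ae @lebesgue_measure R, forall t, a <= t <= b -> P (phi t)}.
Proof.
move=> ab e0 mphi phie [N [mN N0 PN]].
pose phi' : measurableTypeR R -> measurableTypeR R := phi \_ `[a, b].
have mphi' : measurable_fun setT phi' by apply/(measurable_restrictT _ _).1.
have mpre A : measurable A -> measurable (phi' @^-1` A).
  by move=> mA; rewrite -[X in measurable X]setTI; exact: mphi'.
have mab : measurable (`[a, b] : set (measurableTypeR R)) by exact: measurable_itv.
pose nu : {measure set (measurableTypeR R) -> \bar R} :=
  measure_function_pushforward__canonical__measure_function_Measure
    (mrestr (@lebesgue_measure R) mab) mphi'.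
have nuE A : nu A = leb (phi' @^-1` A `&` `[a, b]) by [].
have nudom : nu `<< @lebesgue_measure R.
  apply: (@lip_dominated _ _ e^-1); first by rewrite invr_ge0 ltW.
  move=> x y xy; rewrite nuE.
  set S := (X in leb X).
  have SP z : S z -> a <= z <= b /\ x < phi z <= y.
    by move=> [h zab]; move: h; rewrite /phi' /= patchE ifT ?mem_set.
  have mS : measurable S.
    by apply: measurableI => //; apply: mpre; exact: measurable_itv.
  have [->|/set0P[z0 Sz0]] := eqVneq S set0.
    by rewrite measure0 lee_fin mulr_ge0 ?invr_ge0 ?subr_ge0// ltW.
  have Slb : has_lbound S by exists a => z /SP[/andP[]].
  have Ssub : S `<=` `[inf S, inf S + e^-1 * (y - x)].
    move=> z Sz /=; rewrite in_itv /= ge_inf//=.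
    rewrite -lerBlDr; apply: lb_le_inf; first by exists z0.
    move=> w Sw; rewrite lerBlDr -lerBlDl mulrC ler_pdivlMr// mulrC.
    have [/andP[aw wb] /andP[xw wy]] := SP _ Sw.
    have [/andP[az zb] /andP[xz zy]] := SP _ Sz.
    have [wz|zw] := leP w z.
      by apply: (le_trans (phie _ _ aw wz zb)); lra.
    have := mulr_ge0_le0 (ltW e0) (_ : z - w <= 0).
    by rewrite subr_le0 (ltW zw) => /(_ isT); lra.
  have xye : 0 <= e^-1 * (y - x) by rewrite mulr_ge0 ?invr_ge0 ?subr_ge0 ?(ltW e0).
  apply: (@le_trans _ _ (@lebesgue_measure R `[inf S, inf S + e^-1 * (y - x)]%classic)).
    by apply: le_measure; rewrite ?inE.
  by rewrite leb_itvcc ?lerDl// addrAC subrr add0r.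
move/null_content_dominatesP : nudom => /(_ N mN N0); rewrite nuE => nuN.
exists (phi' @^-1` N `&` `[a, b]); split => //.
  by apply: measurableI => //; exact: mpre.
move=> t /= /not_implyP[tab nP]; split; last by rewrite in_itv.
rewrite /= /phi' patchE mem_set ?in_itv//; exact: PN.
Qed.

(** The outer function [f] is differentiable only off a null set. Since [phi] is expanding, the
    points that it sends into this set form a null set as well, and the classical chain rule applies
    at almost all others. *)
Lemma prim_comp a b c d phi phi' f g (e : R) : a < b -> c < d -> 0 < e ->
  bmf a b phi' -> prim a b phi phi' ->
  (forall x y, a <= x -> x <= y -> y <= b -> e * (y - x) <= phi y - phi x) ->
  (forall x, a <= x <= b -> c <= phi x <= d) ->
  bmf c d g -> prim c d f g ->
  bmf a b (fun x => g (phi x)) /\ prim a b (fun x => f (phi x)) (fun x => g (phi x) * phi' x).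
Proof.
move=> ab cd e0 phi'b pphi phie phicd gb fg.
have [mphi _] := prim_bmf phi'b pphi.
have gphib : bmf a b (fun x => g (phi x)).
  have [mg [C gC]] := gb; split.
    apply: (measurable_comp _ _ mg mphi); first exact: measurable_itv.
    by move=> _ [x /= xab <-]; rewrite /= in_itv/= phicd//; move: xab; rewrite in_itv.
  by exists C => x xab; apply/gC/phicd.
split => //.
have [K K0 phiK] := prim_bmf_lip phi'b pphi.
have [L L0 fL] := prim_bmf_lip gb fg.
have fphiL : lip a b (fun x => f (phi x)) (L * K).
  move=> x y ax xy yb.
  apply: (le_trans (lip_sym fL (phicd x _) (phicd y _))).
  - by rewrite ax (le_trans xy).
  - by rewrite yb (le_trans ax).
  - by rewrite -mulrA ler_wpM2l//; exact: phiK.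
apply: (lip_ae_prim ab fphiL); first by apply: measurable_funM; [case: gphib|case: phi'b].
have df := preimage_null ab e0 mphi phie (prim_derive (bmf_intg gb) fg).
apply: ae_S2 (prim_derive (bmf_intg phi'b) pphi) df => t dphi df /[dup] tab /andP[at' tb].
have {}dphi := dphi tab.
have /df{}df : a <= t <= b by rewrite !ltW.
have {}df : is_derive (phi t) 1 f (g (phi t)).
  apply: df; have h u v : a <= u -> u < v -> v <= b -> phi u < phi v.
    move=> au uv vb; rewrite -subr_gt0; apply: lt_le_trans (phie _ _ au (ltW uv) vb).
    by rewrite mulr_gt0// subr_gt0.
  have /phicd/andP[ca _] : a <= a <= b by rewrite lexx ltW.
  have /phicd/andP[_ bd] : a <= b <= b by rewrite lexx ltW.
  rewrite (le_lt_trans ca (h _ _ _ at' _)) ?lexx ?(ltW tb)//=.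
  by rewrite (lt_le_trans (h _ _ _ tb _) bd) ?lexx ?(ltW at').
exact: (@is_derive1_comp R).
Qed.

Lemma bmfN f a b : bmf a b f -> bmf a b (fun x => - f x).
Proof. by move=> bf; have := bmfM (bmf_cst a b (-1)) bf; under eq_fun do rewrite mulN1r. Qed.

Lemma continuous_bmf f a b : continuous f -> bmf a b f.
Proof.
move=> cf; split; first by apply: measurable_funS (_ : measurable_fun setT _) => //; exact: continuous_measurable_fun.
have [C [_ CP]] : bounded_set (f @` `[a, b]).
  apply: compact_bounded; apply: continuous_compact; last exact: segment_compact.
  by apply: continuous_subspaceT.
exists (`|C| + 1) => x xab.
apply: (CP (`|C| + 1)); first by rewrite (le_lt_trans (ler_norm _))// ltrDl.
by exists x => //=; rewrite in_itv/=.
Qed.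

Lemma derive_prim f f' a b : (forall x : R, is_derive x 1 f (f' x)) -> continuous f' ->
  prim a b f f'.
Proof.
move=> df cf' x y ax xy yb; move: xy; rewrite le_eqVlt => /predU1P[->|xy].
  by rewrite subrr itgxx.
have [mf' [C f'C]] := continuous_bmf x y cf'.
have lf : lip x y f C by apply: derive_lip f'C => z _; exact: df.
by apply: (lip_ae_prim xy lf) => //; last exact: ltW; apply: ae_T => z _; exact: df.
Qed.

End Calculus.

(** * Classes of iterated primitives: algebra, composition and inversion *)

Section Regularity.
Context {R : realType}.
Implicit Types (a b c d x y z K m M e : R) (f g h phi psi : R -> R).

Lemma ae_ex a b (P : R -> Prop) : a < b ->
  {ae @lebesgue_measure R, forall t, a <= t <= b -> P t} -> exists2 t, a <= t <= b & P t.
Proof.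
move=> ab [N [mN N0 PN]]; apply: contrapT => /forall2NP nP.
have : (@lebesgue_measure R `[a, b]%classic <= @lebesgue_measure R N)%E.
  apply: le_measure; [by rewrite inE; exact: measurable_itv|by rewrite inE|].
  move=> t /=; rewrite in_itv /= => tab; apply: PN => /= h.
  by have [//|] := nP t; apply; exact: h.
by rewrite N0 leb_itvcc ?(ltW ab)// lee_fin leNgt subr_gt0 ab.
Qed.

(** Arbitrarily close to [t] inside [a, b] there are points where the a.e. bound holds, and within
    distance h / (|K| + 1) of [t] the function moves by at most [h]. *)
Lemma ae_lip_ge a b f K e : a < b -> lip a b f K ->
  {ae @lebesgue_measure R, forall t, a <= t <= b -> e <= f t} ->
  forall t, a <= t <= b -> e <= f t.
Proof.
move=> ab fK fe t tab; have /andP[at' tb] := tab.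
apply/ler_addgt0Pr => h h0.
pose r := h / (`|K| + 1).
have K1 : 0 < `|K| + 1 by rewrite ltr_wpDl.
have r0 : 0 < r by rewrite divr_gt0.
have lt1 : Num.max a (t - r) < Num.min b (t + r).
  by rewrite gt_max !lt_min ab/=; apply/andP; split; [|apply/andP; split]; lra.
have [s /andP[s1 s2] es] : exists2 s, Num.max a (t - r) <= s <= Num.min b (t + r) & e <= f s.
  apply: (ae_ex lt1); apply: ae_S fe => s es /andP[+ +].
  by rewrite ge_max le_min => /andP[as_ _] /andP[sb _]; apply: es; rewrite as_.
move: s1 s2; rewrite ge_max le_min => /andP[as_ ts] /andP[sb st].
apply: (le_trans es); rewrite -lerBlDl; apply: (le_trans (ler_norm _)).
apply: (le_trans (lip_sym fK tab _)); first by rewrite as_.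
have sr : `|s - t| <= r by rewrite ler_norml; apply/andP; split; lra.
apply: (@le_trans _ _ ((`|K| + 1) * `|s - t|)).
  by rewrite ler_wpM2r// (le_trans (ler_norm K))// lerDl.
by rewrite mulrC -ler_pdivlMr.
Qed.

Section Uniform.
Context {I : Type} (S : set I) (a b : R) (ab : a < b).
Implicit Types F G : I -> R -> R.

Definition ub F := exists C : R, forall i, S i ->
  measurable_fun (`[a, b] : set R) (F i) /\ forall x, a <= x <= b -> `|F i x| <= C.

(* W^{n,oo}(a, b) uniformly in the index, for representatives that are primitives
   of one another on all of [a, b]. *)
Fixpoint Reg n F : Prop :=
  if n is m.+1 then ub F /\ exists2 G, Reg m G & forall i, S i -> prim a b (F i) (G i)
  else ub F.

Lemma Reg_ub n F : Reg n F -> ub F.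
Proof. by case: n => [//|n] []. Qed.

Lemma ub_bmf F i : ub F -> S i -> bmf a b (F i).
Proof. by move=> [C FC] /FC[mF FiC]; split => //; exists C. Qed.

Lemma Reg_bmf n F i : Reg n F -> S i -> bmf a b (F i).
Proof. by move=> /Reg_ub; exact: ub_bmf. Qed.

Lemma RegW n F : Reg n.+1 F -> Reg n F.
Proof.
elim: n F => [|n IH] F; first by case.
by move=> [Fub [G /IH RG FG]]; split => //; exists G.
Qed.

Lemma Reg_leq (m n : nat) F : (m <= n)%N -> Reg n F -> Reg m F.
Proof.
move=> /subnK <-; elim: (n - m)%N => [//|k IH]; rewrite addSn => /RegW; exact: IH.
Qed.

Lemma Reg_ext n F G : (forall i x, S i -> a <= x <= b -> F i x = G i x) ->
  Reg n F -> Reg n G.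
Proof.
move=> FG RF.
have Gub : ub G.
  have [C FC] := Reg_ub RF; exists C => i Si; have [mF Fb] := FC i Si; split.
    apply: eq_measurable_fun mF => x; rewrite inE /= in_itv /= => xab; exact: FG.
  by move=> x xab; rewrite -FG//; exact: Fb.
case: n RF => [//|n] [_ [H RH FH]]; split => //; exists H => // i Si x y ax xy yb.
by rewrite -!FG// ?FH// ?ax ?yb ?(le_trans ax xy) ?(le_trans xy yb).
Qed.

Lemma Reg_cst n (c : I -> R) C : (forall i, S i -> `|c i| <= C) -> Reg n (fun i _ => c i).
Proof.
elim: n c C => [|n IH] c C cC /=.
  by exists C => i Si; split; [exact: measurable_cst|move=> x _; exact: cC].
split; first by exists C => i Si; split; [exact: measurable_cst|move=> x _; exact: cC].
exists (fun _ _ => 0); last by move=> i _; exact: prim_cst.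
by apply: (IH (fun=> 0) 0) => i _; rewrite normr0.
Qed.

Lemma ubD F G : ub F -> ub G -> ub (fun i x => F i x + G i x).
Proof.
move=> [C FC] [D GD]; exists (C + D) => i Si.
have [mF {}FC] := FC i Si; have [mG {}GD] := GD i Si.
split; first exact: measurable_funD.
move=> x xab; apply: (le_trans (ler_normD _ _)).
by apply: lerD; [exact: FC|exact: GD].
Qed.

Lemma ubM F G : ub F -> ub G -> ub (fun i x => F i x * G i x).
Proof.
move=> [C FC] [D GD]; exists (C * D) => i Si.
have [mF {}FC] := FC i Si; have [mG {}GD] := GD i Si.
split; first exact: measurable_funM.
by move=> x xab; rewrite normrM; apply: ler_pM => //; [exact: FC|exact: GD].
Qed.

Lemma RegD n F G : Reg n F -> Reg n G -> Reg n (fun i x => F i x + G i x).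
Proof.
elim: n F G => [|n IH] F G; first exact: ubD.
move=> [Fub [F' RF' FF']] [Gub [G' RG' GG']]; split; first exact: ubD.
exists (fun i x => F' i x + G' i x); first exact: IH.
move=> i Si; apply: primD; [| |exact: FF'|exact: GG'].
  exact: bmf_intg (Reg_bmf RF' Si).
exact: bmf_intg (Reg_bmf RG' Si).
Qed.

Lemma RegM n F G : Reg n F -> Reg n G -> Reg n (fun i x => F i x * G i x).
Proof.
elim: n F G => [|n IH] F G; first exact: ubM.
move=> RF RG; have := RF; have := RG.
move=> [Gub [G' RG' GG']] [Fub [F' RF' FF']]; split; first exact: ubM.
exists (fun i x => F' i x * G i x + F i x * G' i x).
  by apply: RegD; apply: IH => //; exact: RegW.
move=> i Si; apply: (primM ab); [| |exact: FF'|exact: GG'].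
  exact: Reg_bmf RF' Si.
exact: Reg_bmf RG' Si.
Qed.

Lemma RegZ n (c : R) F : Reg n F -> Reg n (fun i x => c * F i x).
Proof. by move=> RF; apply: (RegM (F := fun _ _ => c)) => //; exact: (@Reg_cst _ _ `|c|). Qed.

Lemma RegN n F : Reg n F -> Reg n (fun i x => - F i x).
Proof.
by move=> RF; apply: Reg_ext (RegZ (-1) RF) => i x _ _; rewrite mulN1r.
Qed.

Lemma RegB n F G : Reg n F -> Reg n G -> Reg n (fun i x => F i x - G i x).
Proof. by move=> RF RG; apply: RegD => //; exact: RegN. Qed.

Lemma RegX n F : Reg n F -> Reg n (fun i x => F i x ^+ 2).
Proof. by move=> RF; apply: Reg_ext (RegM RF RF) => i x _ _; rewrite expr2. Qed.

Lemma Reg_sum n (J : Type) (s : seq J) (F : J -> I -> R -> R) :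
  (forall j, Reg n (F j)) -> Reg n (fun i x => \sum_(j <- s) F j i x).
Proof.
move=> RF; elim: s => [|j s IH].
  apply: (@Reg_ext _ (fun _ _ => 0)); first by move=> i x _ _; rewrite big_nil.
  by apply: (@Reg_cst _ _ 0) => i _; rewrite normr0.
by apply: Reg_ext (RegD (RF j) IH) => i x _ _; rewrite big_cons.
Qed.

Lemma ub_inv F e : 0 < e -> (forall i x, S i -> a <= x <= b -> e <= F i x) ->
  ub F -> ub (fun i x => (F i x)^-1).
Proof.
move=> e0 Fe [C FC]; exists e^-1 => i Si; have [mF Fb] := FC i Si; split.
  have : measurable_fun `[a, b] (fun x => F i x `^ (-1)).
    by apply: (measurableT_comp (measurable_powR _)).
  apply: eq_measurable_fun => x; rewrite inE /= in_itv /= => xab.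
  by rewrite powR_inv1// (le_trans (ltW e0))// Fe.
move=> x xab; have Fex := Fe _ _ Si xab.
rewrite normfV lef_pV2 ?posrE ?normr_gt0 ?gt_eqF ?(lt_le_trans e0 Fex)//.
by rewrite (le_trans Fex)// ler_norm.
Qed.

(** The derivative - F' / F^2 involves 1 / F only at the lower order, which the induction
    provides. *)
Lemma Reg_inv n F e : 0 < e -> (forall i x, S i -> a <= x <= b -> e <= F i x) ->
  Reg n F -> Reg n (fun i x => (F i x)^-1).
Proof.
move=> e0 Fe; elim: n => [|n IH] RF.
  exact: ub_inv e0 Fe (Reg_ub RF).
split; first exact: ub_inv e0 Fe (Reg_ub RF).
have [Fub [F' RF' FF']] := RF.
have RV := IH (RegW RF).
exists (fun i x => - ((F i x)^-1 * (F i x)^-1) * F' i x).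
  by apply: RegM => //; apply: RegN; exact: RegM.
move=> i Si; have [C FC] := Fub; have [mF Fb] := FC _ Si.
have [mV _] := Reg_bmf RV Si.
apply: (@prim_comp_derive _ _ _ _ _ (fun x => x^-1) (fun x => - (x^-1 * x^-1)) e C (e^-1 * e^-1)) => //.
- exact: Reg_bmf RF' Si.
- exact: FF'.
- by move=> x xab; rewrite Fe//= (le_trans (ler_norm _))// Fb.
- move=> x /andP[ex _]; have x0 : x != 0 by rewrite gt_eqF// (lt_le_trans e0).
  rewrite (_ : - _ = - (x ^- 2) *: 1); first exact: is_deriveV.
  by rewrite /GRing.scale/= mulr1 -invfM -expr2.
- move=> x /andP[ex _]; rewrite normrN normrM.
  have h : `|x^-1| <= e^-1.
    rewrite normfV lef_pV2 ?posrE ?normr_gt0 ?gt_eqF ?(lt_le_trans e0 ex)//.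
    by rewrite (le_trans ex)// ler_norm.
  by apply: ler_pM.
- by apply: measurableT_comp => //; apply: measurable_funM.
Qed.

End Uniform.

Lemma Reg_at (I : Type) (S : set I) n a b F i : S i -> Reg S a b n F ->
  Reg [set: unit] a b n (fun _ => F i).
Proof.
move=> Si; elim: n F => [|n IH] F.
  by move=> [C FC]; exists C => _ _; exact: FC.
move=> [[C FC] [G /IH RG FG]]; split; first by exists C => _ _; exact: FC.
by exists (fun _ => G i) => // _ _; exact: FG.
Qed.

(** A single function is a family over a one-point index, so the closure lemmas for [Reg] serve both
    cases. *)
Definition Creg n a b f := Reg [set: unit] a b n (fun _ => f).

Lemma Creg0 a b f : Creg 0 a b f <-> bmf a b f.
Proof.
split; first by move=> h; exact: ub_bmf h (I : setT tt).
by move=> [mf [C fC]]; exists C => _ _.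
Qed.

Lemma CregS n a b f : Creg n.+1 a b f <-> exists2 g, Creg n a b g & prim a b f g.
Proof.
split.
  move=> [_ [G RG FG]]; exists (G tt); last exact: FG.
  exact: (Reg_at (i := tt)) RG.
move=> [g Cg fg]; split; last by exists (fun _ => g).
by apply/Creg0; apply: prim_bmf fg; exact: Reg_bmf Cg (I : setT tt).
Qed.

Lemma Creg_bmf n a b f : Creg n a b f -> bmf a b f.
Proof. by move=> Cf; exact: Reg_bmf Cf (I : setT tt). Qed.

Lemma prim_expand a b phi phi' e : bmf a b phi' -> prim a b phi phi' ->
  (forall x, a <= x <= b -> e <= phi' x) ->
  forall x y, a <= x -> x <= y -> y <= b -> e * (y - x) <= phi y - phi x.
Proof.
move=> phi'b pphi phie x y ax xy yb; rewrite pphi// -itg_cst//; apply: itg_le.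
- exact: intg_cst.
- exact: intgS (bmf_intg phi'b).
- by move=> t /andP[xt ty]; apply: phie; rewrite (le_trans ax) ?(le_trans ty).
Qed.

Lemma bmf_comp a b c d phi g : measurable_fun (`[a, b] : set R) phi ->
  (forall x, a <= x <= b -> c <= phi x <= d) -> bmf c d g -> bmf a b (fun x => g (phi x)).
Proof.
move=> mphi phicd [mg [C gC]]; split; last by exists C => x /phicd/gC.
apply: (measurable_comp _ _ mg mphi); first exact: measurable_itv.
by move=> _ [x /= xab <-]; rewrite /= in_itv/= phicd//; move: xab; rewrite in_itv.
Qed.

(** Order [n] of the composite asks for order [n - 1] of [phi'], because the derivative of the
    composite is g(phi) phi'. For [n = 0] the truncated predecessor still asks for a bounded
    [phi']. *)
Lemma Creg_comp n a b c d phi phi' f e : a < b -> c < d -> 0 < e ->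
  Creg n.-1 a b phi' -> prim a b phi phi' -> (forall x, a <= x <= b -> e <= phi' x) ->
  (forall x, a <= x <= b -> c <= phi x <= d) ->
  Creg n c d f -> Creg n a b (fun x => f (phi x)).
Proof.
move=> ab cd e0 + pphi phie phicd; elim: n f => [|n IH] f Cphi'.
  move=> /Creg0 fb; apply/Creg0; apply: bmf_comp phicd fb.
  by case: (prim_bmf (Creg_bmf Cphi') pphi).
move=> /CregS[g Cg fg]; apply/CregS; exists (fun x => g (phi x) * phi' x).
  apply: (RegM ab) => //; apply: IH => //.
  by apply: Reg_leq Cphi' => /=; exact: leq_pred.
have phi'b := Creg_bmf Cphi'.
exact: (prim_comp ab cd e0 phi'b pphi (prim_expand phi'b pphi phie) phicd (Creg_bmf Cg) fg).2.
Qed.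

(** Expansion of [phi] makes [psi] Lipschitz, hence the primitive of some density, which the
    identity phi(psi y) = y determines. The order then bootstraps: order [n] of the derivative of
    [psi] gives order [n + 1] of phi'(psi) by [Creg_comp], hence of its inverse. *)
Lemma Creg_inverse n a b phi phi' psi e : a < b -> 0 < e ->
  Creg n a b phi' -> prim a b phi phi' -> (forall x, a <= x <= b -> e <= phi' x) ->
  (forall y, phi a <= y <= phi b -> a <= psi y <= b /\ phi (psi y) = y) ->
  Creg n (phi a) (phi b) (fun y => (phi' (psi y))^-1) /\
  prim (phi a) (phi b) psi (fun y => (phi' (psi y))^-1).
Proof.
move=> ab e0 Cphi' pphi phie psiP.
have phi'b := Creg_bmf Cphi'.
have phix := prim_expand phi'b pphi phie.
have [K K0 phiK] := prim_bmf_lip phi'b pphi.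
have phi_lt x y : a <= x -> x < y -> y <= b -> phi x < phi y.
  move=> ax xy yb; rewrite -subr_gt0; apply: lt_le_trans (phix _ _ ax (ltW xy) yb).
  by rewrite mulr_gt0// subr_gt0.
have cd : phi a < phi b by exact: phi_lt.
have psi_in y : phi a <= y <= phi b -> a <= psi y <= b by move=> /psiP[].
have psi_mono x y : phi a <= x -> x <= y -> y <= phi b -> psi x <= psi y.
  move=> ax xy yb; rewrite leNgt; apply/negP => yx.
  have [|/andP[_ p1] p2] := psiP x; first by rewrite ax (le_trans xy).
  have [|/andP[q1 _] q2] := psiP y; first by rewrite yb (le_trans ax).
  by have := phi_lt _ _ q1 yx p1; rewrite p2 q2 ltNge xy.
have psi_e x y : phi a <= x -> x <= y -> y <= phi b -> e * (psi y - psi x) <= y - x.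
  move=> ax xy yb.
  have [|/andP[p1 _] p2] := psiP x; first by rewrite ax (le_trans xy).
  have [|/andP[_ q1] q2] := psiP y; first by rewrite yb (le_trans ax).
  by rewrite -{2}p2 -{2}q2; apply: phix => //; exact: psi_mono.
have psi_K x y : phi a <= x -> x <= y -> y <= phi b -> (K + 1)^-1 * (y - x) <= psi y - psi x.
  move=> ax xy yb.
  have [|/andP[p1 _] p2] := psiP x; first by rewrite ax (le_trans xy).
  have [|/andP[_ q1] q2] := psiP y; first by rewrite yb (le_trans ax).
  rewrite mulrC ler_pdivrMr ?ltr_wpDl// mulrC.
  have h := psi_mono _ _ ax xy yb.
  have := phiK _ _ p1 h q1; rewrite p2 q2 => /(le_trans (ler_norm _)) /le_trans; apply.
  by rewrite mulrDl lerDl mul1r subr_ge0.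
have psi_lip : lip (phi a) (phi b) psi e^-1.
  move=> x y ax xy yb; rewrite ger0_norm ?subr_ge0 ?psi_mono//.
  by rewrite mulrC ler_pdivlMr// mulrC; exact: psi_e.
have ei0 : 0 <= e^-1 by rewrite invr_ge0 ltW.
have K10 : 0 < (K + 1)^-1 by rewrite invr_gt0 ltr_wpDl.
have [g [mg gK pg]] := lip_prim cd ei0 psi_lip.
have gb : bmf (phi a) (phi b) g by split => //; exists e^-1.
have mpsi := lip_measurable psi_lip.
have phi'psib : bmf (phi a) (phi b) (fun y => phi' (psi y)) by exact: bmf_comp phi'b.
have [_ pc] := prim_comp cd ab K10 gb pg psi_K psi_in phi'b pphi.
(* Chain rule for phi(psi y) = y. Comparison with the density 1 of the identity gives phi'(psi) g =
   1 almost everywhere. *)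
have pid : prim (phi a) (phi b) id (fun y => phi' (psi y) * g y).
  move=> x y ax xy yb; rewrite -pc//.
  by have [|_ ->] := psiP x; [rewrite ax (le_trans xy)|have [|_ ->] := psiP y; rewrite ?yb ?(le_trans ax)].
have psi'b : bmf (phi a) (phi b) (fun y => (phi' (psi y))^-1).
  apply/Creg0; apply: (@Reg_inv _ _ _ _ cd 0 _ e) => //; last exact/Creg0.
  by move=> _ y _ /psi_in; exact: phie.
have ppsi : prim (phi a) (phi b) psi (fun y => (phi' (psi y))^-1).
  apply: (prim_aeq (bmf_intg gb) _ _ pg); first by case: psi'b.
  have := prim_unique (intg_cst _ _ 1) (bmf_intg (bmfM phi'psib gb)) (@prim_id _ _ _) pid.
  apply: ae_S => y h /[dup] yab /h h1.
  have p0 : phi' (psi y) != 0 by rewrite gt_eqF// (lt_le_trans e0)// phie// psi_in.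
  by apply: (mulfI p0); rewrite -h1 divff.
split => //.
have [_ [C phiC]] := phi'b.
have C0 : 0 < C.
  by rewrite (lt_le_trans e0)// (le_trans (phie a _))// ?lexx ?(ltW ab)// (le_trans (ler_norm _))// phiC// lexx ltW.
clear pphi pc pid pg phix phiK.
elim: n Cphi' => [|n IH] Cphi'; first exact/Creg0.
apply: (Reg_inv cd e0) => [_ y _ /psi_in|]; first exact: phie.
apply: (@Creg_comp n.+1 _ _ a b psi (fun y => (phi' (psi y))^-1) phi' C^-1) => //.
- by rewrite invr_gt0.
- by apply: IH; exact: RegW.
- move=> y /psi_in yab; rewrite lef_pV2 ?posrE ?(lt_le_trans e0 (phie _ yab))//.
  by rewrite (le_trans (ler_norm _))// phiC.
Qed.

End Regularity.

(** * Evolution equations in weak form *)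

Section Evolution.
Context {R : realType}.
Implicit Types (T t s K E : R) (phi gam : R -> R).

Lemma is_derive_continuous phi t v : is_derive t 1 phi v -> {for t, continuous phi}.
Proof. by move=> [d _]; apply: differentiable_continuous; exact/derivable1_diffP. Qed.

Lemma is_derive_epsP phi t v : is_derive t 1 phi v <->
  forall e : R, 0 < e -> \forall s \near t, `|phi s - phi t - (s - t) * v| <= e * `|s - t|.
Proof.
split.
  move=> [/cvg_ex[l hl] dE] e e0.
  have lv : l = v by rewrite -dE; apply/esym/cvg_lim.
  move: hl; rewrite lv => /cvgrPdist_le /(_ e e0).
  rewrite near_withinE => hl; apply/nbhs0P; apply: filterS hl => h hh.
  rewrite (addrC t) addrK; have [->|h0] := eqVneq h 0.
    by rewrite add0r subrr mul0r subrr normr0 mulr0.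
  have := hh h0; rewrite /= /GRing.scale/= mulr1 distrC => {}hh.
  rewrite (_ : _ - _ = h * (h^-1 * (phi (h + t) - phi t) - v)); last first.
    by rewrite mulrBr mulVKf.
  by rewrite normrM mulrC ler_wpM2r.
move=> H.
have cv : h^-1 *: ((phi \o shift t) (h *: 1) - phi t) @[h --> 0^'] --> v.
  apply/cvgrPdist_le => e e0; rewrite near_withinE.
  have /nbhs0P := H e e0; apply: filterS => h; rewrite (addrC t) addrK => hh h0.
  rewrite /= /GRing.scale/= mulr1 distrC.
  rewrite (_ : _ - _ = h^-1 * (phi (h + t) - phi t - h * v)); last first.
    by rewrite [RHS]mulrBr mulKf.
  by rewrite normrM normfV mulrC ler_pdivrMr ?normr_gt0.
apply: DeriveDef; last exact/cvg_lim.
by apply/cvg_ex; exists v.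
Qed.

(** Continuity relative to [0, T] and derivatives only at interior times: this is what a C^1 curve
    on [0, oo) yields for its scalar functionals, and it is enough for the mean value theorem. *)
Definition evol T phi gam :=
  (forall t, 0 <= t <= T -> phi s @[s --> within [set s | 0 <= s <= T] (nbhs t)] --> phi t) /\
  (forall t, 0 < t < T -> is_derive t 1 phi (gam t)).

Lemma evol_within T phi gam : evol T phi gam -> {within `[0, T], continuous phi}.
Proof.
move=> [ch _]; apply/subspace_continuousP => t; rewrite /= in_itv/= => tT.
have := ch t tT; suff -> : [set s | 0 <= s <= T] = [set` `[0, T]] by [].
by apply/seteqP; split => s; rewrite /= in_itv.
Qed.

Lemma evol_ext T phi phi' gam gam' : (forall t, 0 <= t <= T -> phi t = phi' t) ->
  (forall t, 0 < t < T -> gam t = gam' t) -> evol T phi gam -> evol T phi' gam'.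
Proof.
move=> pp gg [c d]; split=> [t tT|t tT].
  rewrite -pp//; apply: cvg_trans (c t tT); apply: near_eq_cvg.
  by apply: filterS (withinT _ _) => s /=; exact: pp.
rewrite -gg//; apply: near_eq_is_derive (d t tT).
apply: filterS (near_itvoo tT) => s /andP[/ltW s0 /ltW sT].
by rewrite pp// s0.
Qed.

Lemma evolD T phi phi' gam gam' : evol T phi gam -> evol T phi' gam' ->
  evol T (fun t => phi t + phi' t) (fun t => gam t + gam' t).
Proof.
move=> [c d] [c' d']; split=> t tT.
  by apply: cvgD; [exact: c|exact: c'].
have := d t tT; have := d' t tT => d1 d2; exact: is_deriveD.
Qed.

Lemma evolM T phi phi' gam gam' : evol T phi gam -> evol T phi' gam' ->
  evol T (fun t => phi t * phi' t) (fun t => gam t * phi' t + phi t * gam' t).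
Proof.
move=> [c d] [c' d']; split=> t tT.
  by apply: cvgM; [exact: c|exact: c'].
have := d t tT; have := d' t tT => d1 d2.
rewrite (_ : _ + _ = phi t *: gam' t + phi' t *: gam t); first exact: is_deriveM.
by rewrite /GRing.scale/= addrC (mulrC (phi' t)).
Qed.

Lemma evol_cst T c : evol T (fun=> c) (fun=> 0).
Proof. by split=> t tT; [exact: cvg_cst|exact: is_derive_cst]. Qed.

Lemma evolZ T c phi gam : evol T phi gam -> evol T (fun t => c * phi t) (fun t => c * gam t).
Proof.
move=> h; have := evolM (evol_cst T c) h; apply: evol_ext => // t _.
by rewrite mul0r add0r.
Qed.

Lemma evolB T phi phi' gam gam' : evol T phi gam -> evol T phi' gam' ->
  evol T (fun t => phi t - phi' t) (fun t => gam t - gam' t).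
Proof.
move=> h h'; have := evolD h (evolZ (-1) h').
by apply: evol_ext => t _; rewrite mulN1r.
Qed.

Lemma evol_sum T (J : Type) (r : seq J) (phi gam : J -> R -> R) :
  (forall j, evol T (phi j) (gam j)) ->
  evol T (fun t => \sum_(j <- r) phi j t) (fun t => \sum_(j <- r) gam j t).
Proof.
move=> h; elim: r => [|j r IH].
  by apply: evol_ext (evol_cst T 0) => t _; rewrite big_nil.
by apply: evol_ext (evolD (h j) IH) => t _; rewrite big_cons.
Qed.

Lemma evol_mvt T phi gam s t : evol T phi gam -> 0 <= s -> s < t -> t <= T ->
  exists2 r, s < r < t & phi t - phi s = gam r * (t - s).
Proof.
move=> h s0 st tT.
have [r||r] := @MVT _ phi gam _ _ st.
- rewrite in_itv/= => /andP[sr rt]; apply: h.2.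
  by rewrite (le_lt_trans s0 sr) (lt_le_trans rt tT).
- apply: continuous_subspaceW (evol_within h); exact: subset_itvcc.
- by rewrite in_itv/= => srt E; exists r.
Qed.

Lemma evol_derive_bound T phi gam C s t : evol T phi gam ->
  (forall t, 0 < t < T -> `|gam t| <= C) ->
  0 <= s -> s <= t -> t <= T -> `|phi t - phi s| <= C * (t - s).
Proof.
move=> h gC s0; rewrite le_eqVlt => /predU1P[-> _|st tT].
  by rewrite !subrr normr0 mulr0.
have [r /andP[sr rt] ->] := evol_mvt h s0 st tT.
rewrite normrM (ger0_norm (_ : 0 <= t - s)) ?subr_ge0 ?(ltW st)//.
rewrite ler_wpM2r ?subr_ge0 ?(ltW st)// gC//.
by rewrite (le_lt_trans s0 sr) (lt_le_trans rt tT).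
Qed.

(** The mean value theorem is applied to e^{-K t} phi(t) - E t, whose derivative is nonpositive. *)
Lemma gronwall T K E phi gam : 0 <= K -> 0 <= E -> evol T phi gam ->
  (forall t, 0 < t < T -> gam t <= K * phi t + E) ->
  forall t, 0 <= t <= T -> phi t <= expR (K * t) * (phi 0 + E * t).
Proof.
move=> K0 E0 h hg t /andP[]; rewrite le_eqVlt => /predU1P[<- _|t0 tT].
  by rewrite !mulr0 expR0 mul1r addr0.
have hexp : evol T (fun s => expR (- K * s)) (fun s => - K * expR (- K * s)).
  have dexp s : is_derive s 1 (fun s => expR (- K * s)) (- K * expR (- K * s)).
    rewrite mulrC; apply: (@is_derive1_comp R expR (fun s => - K * s)).
    by rewrite -[X in is_derive _ _ _ X](@mulr1 R); exact: is_deriveZ.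
  split=> s _ //; apply: cvg_within_filter.
  exact: is_derive_continuous (dexp s).
have hid : evol T (fun s => - E * s) (fun=> - E).
  have did s : is_derive s 1 (fun s => - E * s) (- E).
    by rewrite -[X in is_derive _ _ _ X](@mulr1 R); exact: is_deriveZ.
  split=> s _ //; apply: cvg_within_filter.
  exact: is_derive_continuous (did s).
have := evolD (evolM hexp h) hid => hh.
have [r /andP[r0 rt]] := evol_mvt hh (lexx 0) t0 tT.
rewrite !mulr0 expR0 mul1r addr0 subr0 => EE.
have rT : 0 < r < T by rewrite r0 (lt_le_trans rt).
have e0 := expR_gt0 (- K * r).
have e1 : expR (- K * r) <= 1.
  by rewrite -expR0 ler_expR mulNr oppr_le0 mulr_ge0// ltW.
have hr := hg r rT.
have neg : - K * expR (- K * r) * phi r + expR (- K * r) * gam r - E <= 0.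
  have : expR (- K * r) * gam r <= expR (- K * r) * (K * phi r + E) by rewrite ler_pM2l.
  have : expR (- K * r) * E <= E by rewrite ler_piMl.
  by rewrite mulrDr; lra.
have {EE neg hr} : expR (- K * t) * phi t <= phi 0 + E * t.
  have : (- K * expR (- K * r) * phi r + expR (- K * r) * gam r - E) * t <= 0.
    by rewrite mulr_le0_ge0// ltW.
  by rewrite -EE; lra.
rewrite mulNr expRN => H.
by rewrite -ler_pdivrMl// expR_gt0.
Qed.

(** Termwise differentiation of a uniform limit. By the mean value theorem the increments of two
    approximations differ by at most 2 e |s - t|, and letting the second approximation tend to [phi]
    transfers this bound to [phi]. *)
Lemma evol_unif T phi gam : 0 < T ->
  (forall e : R, 0 < e -> exists (phi' gam' : R -> R), [/\ evol T phi' gam',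
    forall t, 0 <= t <= T -> `|phi' t - phi t| <= e &
    forall t, 0 < t < T -> `|gam' t - gam t| <= e]) -> evol T phi gam.
Proof.
move=> T0 H; split=> [t tT|t tT].
  apply/cvgrPdist_le => e e0.
  have e3 : 0 < e / 3 by rewrite divr_gt0.
  have [phi' [gam' [h pe _]]] := H _ e3.
  have /cvgrPdist_le /(_ _ e3) := h.1 t tT.
  apply: filterS2 (withinT _ _) => s /= sT hs.
  have := pe t tT; have := pe s sT; rewrite distrC => h1 h2.
  rewrite (_ : _ - _ = (phi' s - phi s) + (phi' t - phi' s) - (phi' t - phi t)); last by ring.
  apply: (le_trans (ler_normB _ _)); rewrite distrC in h1.
  have := ler_normD (phi' s - phi s) (phi' t - phi' s); lra.
have key e : 0 < e -> exists (phi' gam' : R -> R), [/\ is_derive t 1 phi' (gam' t),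
    `|gam' t - gam t| <= e & forall s, 0 <= s <= T ->
    `|(phi s - phi t) - (phi' s - phi' t)| <= 2 * e * `|s - t|].
  move=> e0; have [phi' [gam' [h pe ge]]] := H _ e0.
  exists phi', gam'; split; [exact: h.2|exact: ge|move=> s sT].
  apply/ler_addgt0Pr => eta eta0.
  (* The second approximation has its own tolerance [eta], which is arbitrary while [e] stays
     fixed. *)
  have m0 : 0 < Num.min e (eta / 2) by rewrite lt_min e0 divr_gt0.
  have [phi2 [gam2 [h2 pe2 ge2]]] := H _ m0.
  have hB := evolB h2 h.
  have gB r : 0 < r < T -> `|gam2 r - gam' r| <= 2 * e.
    move=> rT; have := ge2 r rT; have := ge r rT; rewrite le_min => h3 /andP[h4 _].
    rewrite (_ : _ - _ = (gam2 r - gam r) - (gam' r - gam r)); last by ring.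
    by apply: (le_trans (ler_normB _ _)); lra.
  have tT' : 0 <= t <= T by move/andP: tT => [? ?]; rewrite !ltW.
  have bnd : `|(phi2 s - phi' s) - (phi2 t - phi' t)| <= 2 * e * `|s - t|.
    move/andP: sT => [s0 sT]; move/andP: tT' => [t0 tT'].
    have [ts|/ltW st] := leP t s.
      by rewrite (ger0_norm (_ : 0 <= s - t)) ?subr_ge0//; exact: (evol_derive_bound hB gB).
    rewrite distrC (distrC s) (ger0_norm (_ : 0 <= t - s)) ?subr_ge0//.
    exact: (evol_derive_bound hB gB).
  have := pe2 s sT; have := pe2 t tT'; rewrite !le_min => /andP[_ h3] /andP[_ h4].
  rewrite (_ : _ - _ = ((phi2 s - phi' s) - (phi2 t - phi' t)) - (phi2 s - phi s) + (phi2 t - phi t)); last by ring.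
  apply: (le_trans (ler_normD _ _)).
  have := ler_normB ((phi2 s - phi' s) - (phi2 t - phi' t)) (phi2 s - phi s); lra.
apply/is_derive_epsP => e e0.
have e4 : 0 < e / 4 by rewrite divr_gt0.
have [phi' [gam' [/is_derive_epsP/(_ _ e4) d ge hs]]] := key _ e4.
apply: filterS2 d (near_itvoo tT) => s ds /andP[/ltW s0 /ltW sT].
have {hs} := hs s; rewrite s0 => /(_ sT) h1.
rewrite (_ : _ - _ = (phi s - phi t - (phi' s - phi' t)) + (phi' s - phi' t - (s - t) * gam' t)
   + (s - t) * (gam' t - gam t)); last by ring.
apply: (le_trans (ler_normD _ _)); rewrite normrM.
have := ler_normD (phi s - phi t - (phi' s - phi' t)) (phi' s - phi' t - (s - t) * gam' t).
have : `|s - t| * `|gam' t - gam t| <= `|s - t| * (e / 4) by rewrite ler_wpM2l.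
have := normr_ge0 (s - t); lra.
Qed.


End Evolution.

(** * Recovering a function from its interval averages *)

Section Averages.
Context {R : realType}.
Implicit Types (a b x y p q L : R) (A : R -> R -> R).

(** The value at [z] is the supremum of A x y - L (y - x) over the intervals [x, y] around [z].
    Every A x y + L (y - x) is an upper bound, because two intervals containing [z] have a hull no
    longer than the sum of their lengths. Thus a value is fixed at every point, end points
    included. *)
Lemma interval_limit a b A L : a < b -> 0 <= L ->
  (forall p q x y x' y', a <= p -> q <= b -> p <= x -> x < y -> y <= q ->
    p <= x' -> x' < y' -> y' <= q -> `|A x y - A x' y'| <= L * (q - p)) ->
  exists w : R -> R, lip a b w (2 * L) /\
    forall x y z, a <= x -> x <= z -> z <= y -> y <= b -> x < y ->
      `|A x y - w z| <= L * (y - x).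
Proof.
move=> ab L0 AL.
pose S z := [set r | exists x y, [/\ a <= x, x <= z, z <= y, y <= b & x < y /\ r = A x y - L * (y - x)]].
have SP z : a <= z <= b -> has_sup (S z) /\ forall x y, a <= x -> x <= z -> z <= y -> y <= b ->
     x < y -> ubound (S z) (A x y + L * (y - x)).
  move=> /andP[az zb].
  have U x y : a <= x -> x <= z -> z <= y -> y <= b ->
     x < y -> ubound (S z) (A x y + L * (y - x)).
    move=> ax xz zy yb xy _ [x' [y' [ax' xz' zy' yb' [xy' ->]]]].
    have := AL (Num.min x x') (Num.max y y') x y x' y'.
    rewrite !le_min !ge_max !ge_min !le_max !lexx !orbT ax ax' yb yb' xy xy'/=.
    move=> /(_ isT isT isT isT isT isT isT isT)/ler_normlP[h _].
    have : L * (Num.max y y' - Num.min x x') <= L * (y - x) + L * (y' - x').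
      rewrite -mulrDr ler_wpM2l//.
      have [? ?] : x <= z /\ z <= y by [].
      by case: (leP x x') => ?; case: (leP y y') => ?; lra.
    lra.
  split; last exact: U.
  split; last by exists (A a b + L * (b - a)); exact: U.
  by exists (A a b - L * (b - a)); exists a, b.
pose w z := sup (S z).
have wP x y z : a <= x -> x <= z -> z <= y -> y <= b -> x < y ->
      `|A x y - w z| <= L * (y - x).
  move=> ax xz zy yb xy.
  have zab : a <= z <= b by rewrite (le_trans ax xz) (le_trans zy yb).
  have [hs U] := SP _ zab.
  have : w z <= A x y + L * (y - x) by apply: ge_sup => //; [exact: hs.1|exact: U].
  have : A x y - L * (y - x) <= w z.
    by apply: sup_ubound; [exact: hs.2|exists x, y].
  by move=> h1 h2; rewrite ler_norml; apply/andP; split; lra.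
exists w; split=> // x y ax; rewrite le_eqVlt => /predU1P[-> _|xy yb].
  by rewrite !subrr normr0 mulr0.
have h1 := wP x y x ax (lexx x) (ltW xy) yb xy.
have h2 := wP x y y ax (ltW xy) (lexx y) yb xy.
rewrite (_ : w y - w x = (A x y - w x) - (A x y - w y)); last by ring.
by apply: (le_trans (ler_normB _ _)); lra.
Qed.

(** The estimate makes [w] the derivative of the primitive of [g] at every interior point, and that
    derivative is [g] almost everywhere. *)
Lemma averages_aeq a b g w L : intg a b g -> 0 <= L ->
  (forall x y z, a <= x -> x <= z -> z <= y -> y <= b -> x < y ->
      `|itg x y g / (y - x) - w z| <= L * (y - x)) -> aeq a b g w.
Proof.
move=> gi L0 H; apply: ae_oo_cc.
have pg := @primitive_prim _ a b g 0 gi.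
apply: ae_S (prim_derive gi pg) => t dt tab.
apply: is_derive_uniq (dt tab) _; apply/is_derive_epsP => e e0.
have K1 : 0 < L + 1 by rewrite ltr_wpDl.
have near1 : \forall s \near t, `|s - t| <= e / (L + 1).
  exists (e / (L + 1)) => /=; first by rewrite divr_gt0.
  by move=> s /=; rewrite distrC => /ltW.
apply: filterS2 near1 (near_itvoo tab) => s ds /andP[as_ sb].
have /andP[at' tb] := tab.
have key : `|0 + itg a s g - (0 + itg a t g) - (s - t) * w t| <= L * `|s - t| * `|s - t|.
  have [ts|] := ltrP t s; last rewrite le_eqVlt => /predU1P[->|st].
  - rewrite pg ?(ltW at') ?(ltW ts) ?(ltW sb)//.
    have st0 : 0 < s - t by rewrite subr_gt0.
    have := H t s t (ltW at') (lexx t) (ltW ts) (ltW sb) ts.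
    rewrite (_ : itg t s g - _ = (s - t) * (itg t s g / (s - t) - w t)); last first.
      by field; rewrite gt_eqF.
    by move=> h; rewrite normrM (gtr0_norm st0) mulrC ler_pM2r.
  - by rewrite !subrr mul0r subrr normr0 mulr0.
  - have -> : 0 + itg a s g - (0 + itg a t g) - (s - t) * w t =
      - ((0 + itg a t g) - (0 + itg a s g) - (t - s) * w t) by ring.
    rewrite pg ?(ltW as_) ?(ltW st) ?(ltW tb)// normrN.
    have st0 : 0 < t - s by rewrite subr_gt0.
    have := H s t t (ltW as_) (ltW st) (lexx t) (ltW tb) st.
    rewrite (_ : itg s t g - _ = (t - s) * (itg s t g / (t - s) - w t)); last first.
      by field; rewrite gt_eqF.
    by move=> h; rewrite normrM (gtr0_norm st0) mulrC ler_pM2r.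
apply: (le_trans key); rewrite ler_wpM2r//.
apply: (@le_trans _ _ ((L + 1) * `|s - t|)); first by rewrite ler_wpM2r// lerDl.
by rewrite mulrC -ler_pdivlMr.
Qed.

End Averages.

(** * Propagation of space regularity by linear systems *)

Section LinearSystem.
Context {R : realType}.
Implicit Types (a b x y z p q T t C L : R).

Lemma normr_mul_self (u : R) : `|u| * `|u| = u * u.
Proof. by rewrite -normrM ger0_norm// -expr2 sqr_ge0. Qed.

Lemma two_mul_le (u v : R) : 2 * (`|u| * v) <= u * u + v * v.
Proof.
rewrite -(normr_mul_self u) -subr_ge0.
rewrite (_ : _ - _ = (`|u| - v) ^+ 2); first exact: sqr_ge0.
by ring.
Qed.

Lemma fin_bound (J : finType) (P : J -> R -> Prop) :
  (forall j C C', P j C -> C <= C' -> P j C') ->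
  (forall j, exists2 C, 0 <= C & P j C) -> exists2 C, 0 <= C & forall j, P j C.
Proof.
move=> mono H.
have {H} : forall j, exists C, 0 <= C /\ P j C by move=> j; have [C ? ?] := H j; exists C.
move=> /choice[c cP]; exists (\sum_j c j).
  by apply: sumr_ge0 => j _; have [] := cP j.
move=> j; apply: (mono _ (c j)); first by have [] := cP j.
by rewrite (bigD1 j)//= lerDl; apply: sumr_ge0 => k _; have [] := cP k.
Qed.

Lemma intg_sum a b (J : Type) (s : seq J) (f : J -> R -> R) :
  (forall j, intg a b (f j)) -> intg a b (fun t => \sum_(j <- s) f j t).
Proof.
move=> fi; elim: s => [|j s IH].
  by apply: eq_intg (intg_cst a b 0) => t _; rewrite big_nil.
by apply: eq_intg (intgD (fi j) IH) => t _; rewrite big_cons.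
Qed.

Lemma itg_sum a b (J : Type) (s : seq J) (f : J -> R -> R) : a <= b ->
  (forall j, intg a b (f j)) ->
  itg a b (fun t => \sum_(j <- s) f j t) = \sum_(j <- s) itg a b (f j).
Proof.
move=> ab fi; elim: s => [|j s IH].
  rewrite big_nil (@eq_itg _ _ _ _ (fun=> 0)); last by move=> t _; rewrite big_nil.
  by rewrite itg_cst// mul0r.
rewrite big_cons -IH -itgD; [|exact: fi|exact: intg_sum].
by apply: eq_itg => t _; rewrite big_cons.
Qed.

Lemma avg_near x y (g : R -> R) v e : x < y -> intg x y g ->
  (forall z, x <= z <= y -> `|g z - v| <= e) -> `|itg x y g / (y - x) - v| <= e.
Proof.
move=> xy gi ge; have yx0 : 0 < y - x by rewrite subr_gt0.
have -> : itg x y g / (y - x) - v = itg x y (fun z => g z - v) / (y - x).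
  rewrite itgB//; last exact: intg_cst.
  by rewrite itg_cst ?(ltW xy)//; field; rewrite gt_eqF.
rewrite normrM normfV (gtr0_norm yx0) ler_pdivrMr//.
by apply: itg_bound => //; [exact: ltW|apply: intgB => //; exact: intg_cst].
Qed.

Context (d : nat) (a b T : R) (ab : a < b) (T0 : 0 < T).
Implicit Types (M : 'I_d -> 'I_d -> R -> R -> R) (B W G : 'I_d -> R -> R -> R).

Let TS := [set t : R | 0 <= t <= T].

Definition lin M B W i t x := \sum_j M i j t x * W j t x + B i t x.

(* W_t = G tested on space intervals: W is only known as a curve in L^2, so the
   equation has no pointwise meaning yet. *)
Definition wsol W G := forall i x y, a <= x -> x <= y -> y <= b ->
  evol T (fun t => itg x y (W i t)) (fun t => itg x y (G i t)).

Section Estimate.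
Variables (M : 'I_d -> 'I_d -> R -> R -> R) (B W : 'I_d -> R -> R -> R).
Variables (C L Lw : R).
Hypothesis C0 : 0 <= C.
Hypothesis L0 : 0 <= L.
Hypothesis Lw0 : 0 <= Lw.
Hypothesis MC : forall i j t x, TS t -> a <= x <= b -> `|M i j t x| <= C.
Hypothesis ML : forall i j t, TS t -> lip a b (M i j t) L.
Hypothesis BL : forall i t, TS t -> lip a b (B i t) L.
Hypothesis Wm : forall i t, TS t -> measurable_fun (`[a, b] : set R) (W i t).
Hypothesis WC : forall i t x, TS t -> a <= x <= b -> `|W i t x| <= C.
Hypothesis Ws : wsol W (lin M B W).
Hypothesis Wi : forall i, exists2 w, lip a b w Lw & aeq a b (W i 0) w.

Let Wb i t : TS t -> bmf a b (W i t).
Proof. by move=> tT; split; [exact: Wm|exists C => x; exact: WC]. Qed.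

Let Gb i t : TS t -> bmf a b (lin M B W i t).
Proof.
move=> tT; apply: bmfD; last exact: lip_bmf L0 (BL i tT).
rewrite /=; elim: (index_enum _) => [|j s IH].
  by rewrite (_ : (fun _ => _) = fun=> 0); [exact: bmf_cst|apply/funext => x; rewrite big_nil].
rewrite (_ : (fun _ => _) = fun x => M i j t x * W j t x + \sum_(j <- s) M i j t x * W j t x).
  by apply: bmfD => //; apply: bmfM; [exact: lip_bmf L0 (ML i j tT)|exact: Wb].
by apply/funext => x; rewrite big_cons.
Qed.

Let kap := d%:R * (L * C) + L.

Let kap0 : 0 <= kap.
Proof. by rewrite addr_ge0// mulr_ge0// mulr_ge0. Qed.

(** The coefficients are frozen at [p]. The error uses the Lipschitz constants of [M] and [B] but
    only a bound on [W], whose regularity is what is sought. *)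
Lemma lin_avg i t p q x y : TS t -> a <= p -> q <= b -> p <= x -> x < y -> y <= q ->
  `|itg x y (lin M B W i t) / (y - x) -
     (\sum_j M i j t p * (itg x y (W j t) / (y - x)) + B i t p)| <= kap * (q - p).
Proof.
move=> tT ap qb px xy yq.
have xyab z : x <= z <= y -> a <= z <= b.
  by move=> /andP[xz zy]; rewrite (le_trans ap)// ?(le_trans px)// (le_trans zy)// (le_trans yq).
have Wxy j : intg x y (W j t).
  by apply: intgS (bmf_intg (Wb j tT)); [exact: le_trans px|exact: le_trans qb].
have Gxy : intg x y (lin M B W i t).
  by apply: intgS (bmf_intg (Gb i tT)); [exact: le_trans px|exact: le_trans qb].
have yx0 : 0 < y - x by rewrite subr_gt0.
pose H z := \sum_j M i j t p * W j t z + B i t p.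
have Hxy : intg x y H.
  by apply: intgD; [apply: intg_sum => j; exact: intgZ|exact: intg_cst].
have HE : \sum_j M i j t p * (itg x y (W j t) / (y - x)) + B i t p = itg x y H / (y - x).
  rewrite itgD; [|by apply: intg_sum => j; exact: intgZ|exact: intg_cst].
  rewrite itg_sum ?(ltW xy)//; last by move=> j; exact: intgZ.
  rewrite itg_cst ?(ltW xy)// mulrDl mulfK ?gt_eqF//; congr (_ + _).
  by rewrite mulr_suml; apply: eq_bigr => j _; rewrite itgZ// mulrA.
rewrite HE -mulrBl -itgB// normrM normfV (gtr0_norm yx0) ler_pdivrMr//.
apply: itg_bound; [exact: ltW|exact: intgB|] => z zxy.
have zab := xyab z zxy.
have pz : p <= z by case/andP: zxy => + _; exact: le_trans.
have zq : z - p <= q - p by rewrite lerB//; case/andP: zxy => _ /le_trans; apply.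
have zb : z <= b by case/andP: zab.
rewrite /lin /H.
have -> : \sum_j M i j t z * W j t z + B i t z - (\sum_j M i j t p * W j t z + B i t p) =
  \sum_j (M i j t z - M i j t p) * W j t z + (B i t z - B i t p).
  under [in RHS]eq_bigr do rewrite mulrBl.
  by rewrite sumrB; ring.
apply: (le_trans (ler_normD _ _)); rewrite /kap mulrDl; apply: lerD.
  apply: (le_trans (ler_norm_sum _ _ _)).
  apply: (@le_trans _ _ (\sum_(j < d) L * C * (q - p))); last first.
    by rewrite sumr_const card_ord -mulr_natl le_eqVlt; apply/orP; left; apply/eqP; ring.
  apply: ler_sum => j _; rewrite normrM mulrAC; apply: ler_pM => //; last exact: WC.
  by apply: (le_trans (ML i j tT ap pz zb)); rewrite ler_wpM2l.
by apply: (le_trans (BL i tT ap pz zb)); rewrite ler_wpM2l.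
Qed.

(** Constants of the Gronwall argument in [avg_close]: with r = q - p, the sum of squares [S] has
    derivative at most K S + 4 d kap^2 r^2 and starts below 4 d Lw^2 r^2, so it stays below Lam0
    r^2. *)
Let K := 2 * C * d%:R + 1.
Let Lam0 := expR (K * T) * (4 * d%:R * Lw ^+ 2 + 4 * d%:R * kap ^+ 2 * T).

Let K0 : 0 <= K.
Proof. by rewrite addr_ge0// !mulr_ge0. Qed.

Let Lam00 : 0 <= Lam0.
Proof.
apply: mulr_ge0; first exact: expR_ge0.
by apply: addr_ge0; rewrite !mulr_ge0// ?exprn_ge0// ltW.
Qed.

(** Both averages solve the system frozen at the same point [p] up to an error kap (q - p). Their
    difference is of size q - p initially, since [W] has a Lipschitz representative at time 0, and
    Gronwall keeps it at that size. *)
Lemma avg_close i t p q x y x' y' : TS t ->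
  a <= p -> q <= b -> p <= x -> x < y -> y <= q -> p <= x' -> x' < y' -> y' <= q ->
  `|itg x y (W i t) / (y - x) - itg x' y' (W i t) / (y' - x')| <= (Lam0 + 1) * (q - p).
Proof.
move=> tT ap qb px xy yq px' xy' yq'.
have r0 : 0 <= q - p by rewrite subr_ge0 (le_trans px)// (le_trans (ltW xy)).
set r := q - p in r0 *.
have ax : a <= x by exact: le_trans px.
have yb : y <= b by exact: le_trans qb.
have ax' : a <= x' by exact: le_trans px'.
have yb' : y' <= b by exact: le_trans qb.
pose D j s := itg x y (W j s) / (y - x) - itg x' y' (W j s) / (y' - x').
pose g j s := itg x y (lin M B W j s) / (y - x) - itg x' y' (lin M B W j s) / (y' - x').
have Dev j : evol T (D j) (g j).
  have h1 := evolZ ((y - x)^-1) (Ws j ax (ltW xy) yb).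
  have h2 := evolZ ((y' - x')^-1) (Ws j ax' (ltW xy') yb').
  by apply: evol_ext (evolB h1 h2) => s _; rewrite /D /g !(mulrC (_^-1)).
have gb j s : TS s -> `|g j s| <= C * \sum_k `|D k s| + 2 * kap * r.
  move=> sT.
  have e1 := lin_avg j sT ap qb px xy yq.
  have e2 := lin_avg j sT ap qb px' xy' yq'.
  set A1 := itg x y (lin M B W j s) / (y - x) in e1.
  set A2 := itg x' y' (lin M B W j s) / (y' - x') in e2.
  set B1 := (X in `|A1 - X|) in e1; set B2 := (X in `|A2 - X|) in e2.
  have -> : g j s = (B1 - B2) + (A1 - B1) - (A2 - B2) by rewrite /g -/A1 -/A2; ring.
  have -> : B1 - B2 = \sum_k M j k s p * D k s.
    rewrite /B1 /B2 /D; under [in RHS]eq_bigr do rewrite mulrBr.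
    by rewrite sumrB; ring.
  have h1 : `|\sum_k M j k s p * D k s| <= C * \sum_k `|D k s|.
    apply: (le_trans (ler_norm_sum _ _ _)); rewrite mulr_sumr; apply: ler_sum => k _.
    rewrite normrM ler_wpM2r// MC// ap/= (le_trans px)// (le_trans (ltW xy))//.
  have := ler_normB (\sum_k M j k s p * D k s + (A1 - B1)) (A2 - B2).
  have := ler_normD (\sum_k M j k s p * D k s) (A1 - B1).
  rewrite -/r in e1 e2; lra.
pose S s := \sum_j D j s * D j s.
have Sev : evol T S (fun s => \sum_j (g j s * D j s + D j s * g j s)).
  by apply: evol_sum => j; exact: evolM.
have S_le s : 0 < s < T -> \sum_j (g j s * D j s + D j s * g j s) <=
    K * S s + 4 * d%:R * kap ^+ 2 * r ^+ 2.
  move=> /andP[/ltW s0 /ltW sT']; have sT : TS s by rewrite /TS/= s0.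
  (* Young's inequality 2 |u| v <= u^2 + v^2, applied to each product, leaves only squares and the
     source r^2. *)
  have term j : g j s * D j s + D j s * g j s <=
     \sum_k C * (D j s * D j s + D k s * D k s) + (D j s * D j s + 4 * kap ^+ 2 * r ^+ 2).
    have h : g j s * D j s <= `|D j s| * (C * \sum_k `|D k s| + 2 * kap * r).
      apply: (le_trans (ler_norm _)); rewrite normrM mulrC ler_wpM2l//; exact: gb.
    have h2 : 2 * (`|D j s| * (C * \sum_k `|D k s|)) <= \sum_k C * (D j s * D j s + D k s * D k s).
      rewrite !mulr_sumr; apply: ler_sum => k _.
      rewrite (_ : 2 * _ = C * (2 * (`|D j s| * `|D k s|))); last by ring.
      rewrite ler_wpM2l//.
      by have := two_mul_le (D j s) `|D k s|; rewrite (normr_mul_self (D k s)).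
    have h3 : 2 * (`|D j s| * (2 * kap * r)) <= D j s * D j s + 4 * kap ^+ 2 * r ^+ 2.
      by apply: (le_trans (two_mul_le _ _)); rewrite lerD2l le_eqVlt; apply/orP; left; apply/eqP; ring.
    rewrite [leRHS]mulrDr in h; have -> : D j s * g j s = g j s * D j s by exact: mulrC.
    by lra.
  apply: (@le_trans _ _ (\sum_j (\sum_k C * (D j s * D j s + D k s * D k s) +
      (D j s * D j s + 4 * kap ^+ 2 * r ^+ 2)))); first exact: ler_sum.
  rewrite big_split /= big_split /= sumr_const card_ord -/(S s).
  under eq_bigr do rewrite -mulr_sumr big_split/= sumr_const card_ord -/(S s).
  rewrite -mulr_sumr big_split/= sumr_const card_ord sumrMnl.
  have E : \sum_k D k s * D k s = S s by [].
  rewrite !E -(mulr_natl (S s)) -(mulr_natl (4 * _ * _)) /K; move: (S s) (kap) => u v.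
  by rewrite le_eqVlt; apply/orP; left; apply/eqP; ring.
have S0 : S 0 <= 4 * d%:R * Lw ^+ 2 * r ^+ 2.
  have D0 j : `|D j 0| <= 2 * Lw * r.
    have [w wL Ww] := Wi j.
    have T00 : TS 0 by rewrite /TS/= lexx ltW.
    have mw := lip_measurable wL.
    have near0 u v : p <= u -> u < v -> v <= q -> `|itg u v (W j 0) / (v - u) - w p| <= Lw * r.
      move=> pu uv vq.
      have au : a <= u by exact: le_trans pu.
      have vb : v <= b by exact: le_trans qb.
      rewrite (aeq_itg (g := w)); last 3 first.
      - by apply: intg_measurable; exact: intgS (bmf_intg (Wb j T00)).
      - by apply: measurable_funS mw => //; exact: subset_itvcc.
      - apply: ae_S Ww => z h /andP[uz zv]; apply: h.
        by rewrite (le_trans au)// (le_trans zv).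
      apply: avg_near => //; first by apply: intgS (bmf_intg (lip_bmf Lw0 wL)).
      move=> z /andP[uz zv].
      apply: (le_trans (wL p z ap (le_trans pu uz) (le_trans zv vb))).
      by rewrite ler_wpM2l// lerB// (le_trans zv).
    have h1 := near0 x y px xy yq; have h2 := near0 x' y' px' xy' yq'.
    rewrite /D; set u := _ / _ in h1 *; set v := _ / _ in h2 *.
    have -> : u - v = (u - w p) - (v - w p) by ring.
    by apply: (le_trans (ler_normB _ _)); lra.
  apply: (@le_trans _ _ (\sum_(j < d) 4 * Lw ^+ 2 * r ^+ 2)).
    apply: ler_sum => j _; have := D0 j; rewrite -expr2 -real_normK ?num_real// => h.
    apply: (@le_trans _ _ ((2 * Lw * r) ^+ 2)); first by rewrite lerXn2r// nnegrE// !mulr_ge0.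
    by rewrite !exprMn -natrX.
  by rewrite sumr_const card_ord -mulr_natl le_eqVlt; apply/orP; left; apply/eqP; ring.
have E0 : 0 <= 4 * d%:R * kap ^+ 2 * r ^+ 2 by rewrite !mulr_ge0// ?exprn_ge0.
have := gronwall K0 E0 Sev S_le tT => St.
have {St} : S t <= Lam0 * r ^+ 2.
  apply: (le_trans St); rewrite /Lam0 -[leRHS]mulrA.
  move: tT => /andP[t0 tT]; apply: ler_pM.
  - exact: expR_ge0.
  - by rewrite addr_ge0// ?mulr_ge0//; apply: sumr_ge0 => j _; rewrite -expr2 sqr_ge0.
  - by rewrite ler_expR ler_wpM2l.
  - rewrite [leRHS]mulrDl; apply: lerD => //.
    by rewrite [leRHS]mulrAC ler_wpM2l.
move=> St.
(* Lam0 <= (Lam0 + 1)^2, so the linear bound on the difference is obtained without square roots. *)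
have : D i t ^+ 2 <= ((Lam0 + 1) * r) ^+ 2.
  apply: (@le_trans _ _ (S t)).
    by rewrite /S (bigD1 i)//= expr2 lerDl; apply: sumr_ge0 => j _; rewrite -expr2 sqr_ge0.
  apply: (le_trans St); rewrite exprMn ler_wpM2r ?exprn_ge0//.
  rewrite sqrrD1 mulr2n; move: (Lam0) Lam00 => l l0; have := sqr_ge0 l; lra.
have -> : itg x y (W i t) / (y - x) - itg x' y' (W i t) / (y' - x') = D i t by [].
by rewrite -real_normK ?num_real// ler_pXn2r// nnegrE mulr_ge0// addr_ge0.
Qed.

(** [avg_close] is the hypothesis of [interval_limit], which yields [W'] at every point. The
    equation for averages over intervals shrinking to [x] passes to the limit by [evol_unif] and
    becomes pointwise in [x]. *)
Lemma pointwise_solution : exists (W' : 'I_d -> R -> R -> R) (V : R), [/\ 0 <= V,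
  forall i t, TS t -> lip a b (W' i t) V /\ aeq a b (W i t) (W' i t),
  forall i t x, TS t -> a <= x <= b -> `|W' i t x| <= V &
  forall i x, a <= x <= b -> evol T (fun t => W' i t x) (fun t => lin M B W' i t x)].
Proof.
pose L1 := Lam0 + 1.
have L10 : 0 <= L1 by rewrite addr_ge0.
have /choice[W' W'P] : forall it : 'I_d * R, exists w, TS it.2 -> lip a b w (2 * L1) /\
    forall x y z, a <= x -> x <= z -> z <= y -> y <= b -> x < y ->
      `|itg x y (W it.1 it.2) / (y - x) - w z| <= L1 * (y - x).
  move=> [i t] /=; have [tT|ntT] := pselect (TS t); last by exists (fun=> 0).
  have [w wP] := interval_limit ab L10 (fun p q x y x' y' => @avg_close i t p q x y x' y' tT).
  by exists w.
have ba0 : 0 < b - a by rewrite subr_gt0.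
pose V := 2 * L1 + C + L1 * (b - a).
have LV : L1 * (b - a) <= V by rewrite /V lerDr addr_ge0// mulr_ge0.
have V0 : 0 <= V by rewrite /V !addr_ge0// mulr_ge0// ltW.
have W'V i t x : TS t -> a <= x <= b -> `|W' (i, t) x| <= V.
  move=> tT /andP[ax xb]; have [_ h] := W'P (i, t) tT.
  have := h a b x (lexx a) ax xb (lexx b) ab; rewrite /= => {}h.
  have : `|itg a b (W i t) / (b - a) - 0| <= C.
    apply: avg_near => //; first exact: bmf_intg (Wb i tT).
    by move=> z zab; rewrite subr0; exact: WC.
  rewrite subr0 => h2.
  have := ler_normB (itg a b (W i t) / (b - a)) (itg a b (W i t) / (b - a) - W' (i, t) x).
  rewrite opprB addrC subrK /V; lra.
exists (fun i t => W' (i, t)), V; split => //.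
- move=> i t tT; have [h1 h2] := W'P (i, t) tT; split.
    move=> x y ax xy yb; apply: (le_trans (h1 x y ax xy yb)).
    by rewrite ler_wpM2r ?subr_ge0// /V -addrA lerDl addr_ge0// mulr_ge0// ltW.
  exact: averages_aeq (bmf_intg (Wb i tT)) L10 h2.
- move=> i x xab; have /andP[ax xb] := xab.
  apply: evol_unif => // e e0.
  (* Error rate of the averaged right-hand side against its value at [x]: [kap] for freezing the
     coefficients at the left end, the rest for moving coefficients and averages from there to
     [x]. *)
  pose k2 := d%:R * (C * L1 + L * V) + L + kap.
  have k20 : 0 <= k2 by do 2 (apply: addr_ge0 => //); apply: mulr_ge0 => //; apply: addr_ge0; exact: mulr_ge0.
  pose K3 := L1 + k2 + 1.
  have K30 : 0 < K3 by rewrite /K3 ltr_wpDl// addr_ge0.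
  pose th := Num.min 1 (e / (K3 * (b - a))).
  have th0 : 0 < th by rewrite /th lt_min ltr01 divr_gt0// mulr_gt0.
  have th1 : th <= 1 by rewrite /th ge_min lexx.
  (* [u, v] is the image of [a, b] under the homothety of centre [x] and ratio [th]. It contains
     [x], stays inside [a, b] and has length th (b - a) even when [x] is an end point. *)
  pose u := x - th * (x - a); pose v := x + th * (b - x).
  have uv : v - u = th * (b - a) by rewrite /u /v; ring.
  have ux : u <= x by rewrite /u lerBlDr lerDl mulr_ge0 ?(ltW th0)// subr_ge0.
  have xv : x <= v by rewrite /v lerDl mulr_ge0 ?(ltW th0)// subr_ge0.
  have au : a <= u.
    by rewrite /u lerBrDr addrC -lerBrDr ler_piMl// subr_ge0.
  have vb : v <= b by rewrite /v addrC -lerBrDr ler_piMl// subr_ge0.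
  have ltuv : u < v by rewrite -subr_gt0 uv mulr_gt0.
  have r0 : 0 <= v - u by rewrite subr_ge0 ltW.
  have small : K3 * (v - u) <= e.
    rewrite uv mulrCA -ler_pdivlMr ?mulr_gt0//.
    by rewrite /th ge_min lexx orbT.
  have smallW c : 0 <= c -> c <= K3 -> c * (v - u) <= e.
    by move=> c0 cK; apply: le_trans small; rewrite ler_wpM2r.
  exists (fun t => (v - u)^-1 * itg u v (W i t)), (fun t => (v - u)^-1 * itg u v (lin M B W i t)).
  split.
  + by apply: evolZ; exact: (Ws i au (ltW ltuv) vb).
  + move=> t tT; rewrite mulrC; have [_ h] := W'P (i, t) tT.
    apply: (le_trans (h u v x au ux xv vb ltuv)); apply: smallW => //.
    by rewrite /K3 -addrA lerDl addr_ge0.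
  + move=> t /andP[/ltW t0 /ltW tT'].
    have tT : TS t by rewrite /TS/= t0.
    rewrite mulrC; have h1 := lin_avg i tT au vb (lexx u) ltuv (lexx v).
    set A := itg u v (lin M B W i t) / (v - u) in h1 *.
    set Q := (X in `|A - X|) in h1.
    have h2 : `|Q - lin M B (fun i t => W' (i, t)) i t x| <=
        (d%:R * (C * L1 + L * V) + L) * (v - u).
      rewrite /Q /lin.
      set q1 := \sum_j _; set q2 := \sum_j _.
      have -> : q1 + B i t u - (q2 + B i t x) = (q1 - q2) - (B i t x - B i t u) by ring.
      apply: (le_trans (ler_normB _ _)); rewrite mulrDl; apply: lerD; last first.
        apply: (le_trans (BL i tT au ux xb)).
        by rewrite ler_wpM2l// lerB.
      rewrite /q1 /q2 -sumrB; apply: (le_trans (ler_norm_sum _ _ _)).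
      apply: (@le_trans _ _ (\sum_(j < d) (C * L1 + L * V) * (v - u))); last first.
        by rewrite sumr_const card_ord -mulr_natl le_eqVlt; apply/orP; left; apply/eqP; ring.
      apply: ler_sum => j _.
      set m1 := M i j t u; set m2 := M i j t x; set a1 := _ / _; set w1 := W' (j, t) x.
      have -> : m1 * a1 - m2 * w1 = m1 * (a1 - w1) - (m2 - m1) * w1 by ring.
      apply: (le_trans (ler_normB _ _)); rewrite !normrM mulrDl; apply: lerD.
        have [_ h] := W'P (j, t) tT.
        rewrite -[leRHS]mulrA; apply: ler_pM => //; first by apply: MC; rewrite // au (le_trans ux).
        exact: h.
      rewrite -[leRHS]mulrA (mulrC V) mulrA; apply: ler_pM => //; last exact: W'V.
      by apply: (le_trans (ML i j tT au ux xb)); rewrite ler_wpM2l// lerB.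
    set Z := lin _ _ _ _ _ _ in h2 *.
    have -> : A - Z = (A - Q) + (Q - Z) by ring.
    apply: (le_trans (ler_normD _ _)).
    apply: (@le_trans _ _ (k2 * (v - u))); last by apply: smallW => //; rewrite /K3; lra.
    by rewrite /k2 mulrDl addrC; exact: lerD.
Qed.

End Estimate.

Lemma lipW (f : R -> R) C C' : lip a b f C -> C <= C' -> lip a b f C'.
Proof.
move=> fC CC' x y ax xy yb; apply: (le_trans (fC x y ax xy yb)).
by rewrite ler_wpM2r// subr_ge0.
Qed.

Lemma Reg_unif (I : Type) (S : set I) n F : Reg S a b n F ->
  exists2 C, 0 <= C & forall i x, S i -> a <= x <= b -> `|F i x| <= C.
Proof.
move=> /Reg_ub[C FC]; exists `|C| => // i x Si xab.
by have [_ h] := FC i Si; apply: (le_trans (h x xab)); exact: ler_norm.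
Qed.

Lemma Reg_unif_lip (I : Type) (S : set I) n F : Reg S a b n.+1 F ->
  exists2 C, 0 <= C & forall i, S i -> lip a b (F i) C.
Proof.
move=> [_ [G RG FG]]; have [C C0 GC] := Reg_unif RG; exists C => // i Si.
by apply: prim_lip (FG i Si); [exact: bmf_intg (Reg_bmf RG Si)|move=> t; exact: GC].
Qed.

Lemma lip_ub (I : Type) (S : set I) (F : I -> R -> R) C C' : 
  (forall i, S i -> lip a b (F i) C) ->
  (forall i x, S i -> a <= x <= b -> `|F i x| <= C') -> ub S a b F.
Proof.
move=> FL FC; exists C' => i Si; split; first exact: lip_measurable (FL i Si).
by move=> x; exact: FC.
Qed.

Lemma aeq_lip_eq (f g : R -> R) C C' : lip a b f C -> lip a b g C' -> aeq a b f g ->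
  forall x, a <= x <= b -> f x = g x.
Proof.
move=> fC gC fg x xab.
have h f' g' D D' : lip a b f' D -> lip a b g' D' -> aeq a b f' g' -> f' x <= g' x.
  move=> f'D g'D' fg'; rewrite -subr_ge0.
  apply: (@ae_lip_ge _ a b (fun x => g' x - f' x) (D' + D) 0 ab) => //.
    move=> u v au uv vb.
    have -> : g' v - f' v - (g' u - f' u) = (g' v - g' u) - (f' v - f' u) by ring.
    by apply: (le_trans (ler_normB _ _)); rewrite mulrDl; apply: lerD; [exact: g'D'|exact: f'D].
  by apply: ae_S fg' => t h tab; rewrite h// subrr.
by apply/eqP; rewrite eq_le (h f g _ _ fC gC fg) (h g f _ _ gC fC (aeq_sym fg)).
Qed.

(* Space averages of W over intervals solve the system up to an error of the size
   of the interval, so by Gronwall they are Lipschitz in its position and converge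
   to a Lipschitz representative of W.  Its space derivative solves the
   differentiated system, whence an induction on n. *)
Theorem linear_regularity n M B W :
  (forall i j, Reg TS a b n (M i j)) -> (forall i, Reg TS a b n (B i)) ->
  (forall i, ub TS a b (W i)) -> wsol W (lin M B W) ->
  (forall i, exists2 w, Creg n a b w & aeq a b (W i 0) w) ->
  exists W' : 'I_d -> R -> R -> R, forall i, Reg TS a b n (W' i) /\
    forall t, TS t -> aeq a b (W i t) (W' i t).
Proof.
elim: n M B W => [|n IH] M B W RM RB RW Ws Wi.
  by exists W => i; split; [exact: RW|move=> t _; exact: ae_T].
have T00 : TS 0 by rewrite /TS/= lexx ltW.
have [W1 W1P] : exists W' : 'I_d -> R -> R -> R, forall i, Reg TS a b n (W' i) /\
    forall t, TS t -> aeq a b (W i t) (W' i t).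
  apply: (IH M B W) => //.
  - by move=> i j; exact: RegW (RM i j).
  - by move=> i; exact: RegW (RB i).
  - by move=> i; have [w Cw ww] := Wi i; exists w => //; exact: RegW Cw.
have [C1 C10 MC1] : exists2 C, 0 <= C & forall ij : 'I_d * 'I_d, forall t, TS t ->
    (forall x, a <= x <= b -> `|M ij.1 ij.2 t x| <= C) /\ lip a b (M ij.1 ij.2 t) C.
  apply: fin_bound.
    move=> ij C C' h CC' t tT; have [h1 h2] := h t tT; split; last exact: lipW h2 CC'.
    by move=> x xab; exact: le_trans (h1 x xab) CC'.
  move=> [i j] /=; have [D D0 MD] := Reg_unif (RM i j).
  have [D' D'0 MD'] := Reg_unif_lip (RM i j).
  exists (D + D'); first exact: addr_ge0.
  move=> t tT; split; first by move=> x xab; rewrite (le_trans (MD _ _ tT xab))// lerDl.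
  by apply: lipW (MD' _ tT) _; rewrite lerDr.
have [C2 C20 BC2] : exists2 C, 0 <= C & forall i : 'I_d, forall t, TS t -> lip a b (B i t) C.
  apply: fin_bound; first by move=> i C C' h CC' t tT; exact: lipW (h t tT) CC'.
  by move=> i; exact: Reg_unif_lip (RB i).
have [C3 C30 WC3] : exists2 C, 0 <= C & forall i : 'I_d, forall t, TS t ->
    forall x, a <= x <= b -> `|W i t x| <= C.
  apply: fin_bound; first by move=> i C C' h CC' t tT x xab; exact: le_trans (h t tT x xab) CC'.
  by move=> i; have [D D0 WD] := @Reg_unif _ TS 0 _ (RW i); exists D => // t tT x; exact: WD.
have [C4 C40 wC4] : exists2 C, 0 <= C & forall i : 'I_d, exists2 w, lip a b w C & aeq a b (W i 0) w.
  apply: fin_bound.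
    by move=> i C C' [w wC ww] CC'; exists w => //; exact: lipW wC CC'.
  move=> i; have [w Cw ww] := Wi i; have [C C0 wC] := Reg_unif_lip Cw.
  by exists C => //; exists w => //; exact: (wC tt).
have [W' [V [V0 W'V W'b W'ev]]] : exists (W' : 'I_d -> R -> R -> R) (V : R), [/\ 0 <= V,
  forall i t, TS t -> lip a b (W' i t) V /\ aeq a b (W i t) (W' i t),
  forall i t x, TS t -> a <= x <= b -> `|W' i t x| <= V &
  forall i x, a <= x <= b -> evol T (fun t => W' i t x) (fun t => lin M B W' i t x)].
  apply: (@pointwise_solution M B W (C1 + C3) (C1 + C2) C4) => //; try exact: addr_ge0.
  - move=> i j t x tT xab; have [h _] := MC1 (i, j) t tT.
    by rewrite (le_trans (h x xab))// lerDl.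
  - move=> i j t tT; have [_ h] := MC1 (i, j) t tT; apply: lipW h _; by rewrite lerDl.
  - by move=> i t tT; apply: lipW (BC2 i t tT) _; rewrite lerDr.
  - by move=> i t tT; have [C h] := RW i; case: (h t tT).
  - by move=> i t x tT xab; rewrite (le_trans (WC3 i t tT x xab))// lerDr.
(* For n >= 1 both [W'] and the representative [W1] of order [n] are Lipschitz and a.e. equal, hence
   equal everywhere; for n = 0 only boundedness is at stake. This order [n] makes the new source
   term regular enough. *)
have RW' i : Reg TS a b n (W' i).
  have uW' : ub TS a b (W' i).
    by apply: (@lip_ub _ TS (W' i) V V) => [t tT|t x]; [have [] := W'V i t tT|exact: W'b].
  have [RW1 W1W] := W1P i.
  case: n {IH RM RB Wi W1P} RW1 => [//|m] RW1.
  have [C _ W1C] := Reg_unif_lip RW1.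
  apply: Reg_ext RW1 => t x tT xab.
  have [h1 h2] := W'V i t tT.
  apply: (aeq_lip_eq (W1C t tT) h1) => //.
  exact: aeq_trans (aeq_sym (W1W t tT)) h2.
have /choice[W2 W2P] : forall it : 'I_d * R, exists w : R -> R, TS it.2 ->
    [/\ measurable_fun (`[a, b] : set R) w, forall x, `|w x| <= V & prim a b (W' it.1 it.2) w].
  move=> [i t] /=; have [tT|ntT] := pselect (TS t); last by exists (fun=> 0).
  have [h _] := W'V i t tT.
  by have [w wP] := lip_prim ab V0 h; exists w.
have uW2 i : ub TS a b (fun t => W2 (i, t)).
  by exists V => t tT; have [h1 h2 _] := W2P (i, t) tT; split.
have /choice[M' M'P] : forall ij : 'I_d * 'I_d, exists G : R -> R -> R, Reg TS a b n G /\
    forall t, TS t -> prim a b (M ij.1 ij.2 t) (G t).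
  by move=> [i j]; have [_ [G RG h]] := RM i j; exists G.
have /choice[B' B'P] : forall i : 'I_d, exists G : R -> R -> R, Reg TS a b n G /\
    forall t, TS t -> prim a b (B i t) (G t).
  by move=> i; have [_ [G RG h]] := RB i; exists G.
(* Differentiating M W' + B in space gives the same matrix acting on the derivative of [W'], plus
   the source M' W' + B'. *)
pose B2 i t x := \sum_j M' (i, j) t x * W' j t x + B' i t x.
pose Wn (i : 'I_d) t := W2 (i, t).
have Wn_prim i t : TS t -> prim a b (W' i t) (Wn i t) by move=> tT; have [] := W2P (i, t) tT.
have lin_prim i t : TS t -> prim a b (lin M B W' i t) (lin M B2 Wn i t).
  move=> tT.
  have bM i' j' : bmf a b (M i' j' t) by exact: Reg_bmf (RM i' j') tT.
  have bM' i' j' : bmf a b (M' (i', j') t) by have [h _] := M'P (i', j'); exact: Reg_bmf h tT.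
  have bB' : bmf a b (B' i t) by have [h _] := B'P i; exact: Reg_bmf h tT.
  have bW' j' : bmf a b (W' j' t) by exact: Reg_bmf (RW' j') tT.
  have bWn j' : bmf a b (Wn j' t) by exact: ub_bmf (uW2 j') tT.
  have sum_prim : prim a b (fun x => \sum_j M i j t x * W' j t x)
      (fun x => \sum_j (M' (i, j) t x * W' j t x + M i j t x * Wn j t x)) /\
      bmf a b (fun x => \sum_j (M' (i, j) t x * W' j t x + M i j t x * Wn j t x)).
    elim: (index_enum _) => [|j s [IH1 IH2]].
      split.
        by move=> x y ax xy yb; rewrite !big_nil subrr (@eq_itg _ _ _ _ (fun=> 0)) ?itg_cst ?mul0r// => z _; rewrite big_nil.
      by rewrite (_ : (fun _ => _) = fun=> 0); [exact: bmf_cst|apply/funext => x; rewrite big_nil].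
    have bj : bmf a b (fun x => M' (i, j) t x * W' j t x + M i j t x * Wn j t x).
      by apply: bmfD; exact: bmfM.
    have pj : prim a b (fun x => M i j t x * W' j t x)
       (fun x => M' (i, j) t x * W' j t x + M i j t x * Wn j t x).
      apply: primM => //; last exact: Wn_prim.
      by have [_ h] := M'P (i, j); exact: h.
    have E1 : (fun x => \sum_(k <- j :: s) M i k t x * W' k t x) =
       (fun x => M i j t x * W' j t x + \sum_(k <- s) M i k t x * W' k t x).
      by apply/funext => x; rewrite big_cons.
    have E2 : (fun x => \sum_(k <- j :: s) (M' (i, k) t x * W' k t x + M i k t x * Wn k t x)) =
       (fun x => (M' (i, j) t x * W' j t x + M i j t x * Wn j t x) +
          \sum_(k <- s) (M' (i, k) t x * W' k t x + M i k t x * Wn k t x)).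
      by apply/funext => x; rewrite big_cons.
    rewrite E1 E2; split; last exact: bmfD.
    by apply: primD => //; exact: bmf_intg.
  have [s1 s2] := sum_prim.
  have := primD (bmf_intg s2) (bmf_intg bB') s1 ((B'P i).2 t tT).
  move=> h x y ax xy yb; rewrite [LHS]h//; apply: eq_itg => z _.
  by rewrite /lin /B2 big_split/=; ring.
have [W3 W3P] : exists W' : 'I_d -> R -> R -> R, forall i, Reg TS a b n (W' i) /\
    forall t, TS t -> aeq a b (Wn i t) (W' i t).
  apply: (IH M B2 Wn).
  - by move=> i j; exact: RegW (RM i j).
  - move=> i; apply: RegD; last by have [] := B'P i.
    have RMW j : Reg TS a b n (fun t x => M' (i, j) t x * W' j t x).
      by apply: RegM => //; have [] := M'P (i, j).
    exact (Reg_sum (index_enum _) RMW).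
  - exact: uW2.
  (* The integral of [Wn] over [x, y] is the difference of [W'] at the two ends, so the tested
     equation for the derivative is the difference of two pointwise equations. *)
  - move=> i x y ax xy yb.
    have xab : a <= x <= b by rewrite ax (le_trans xy).
    have yab : a <= y <= b by rewrite yb (le_trans ax).
    apply: evol_ext (evolB (W'ev i y yab) (W'ev i x xab)) => t.
      by move=> tT; rewrite Wn_prim.
    by move=> /andP[/ltW t0 /ltW tT]; rewrite lin_prim// /TS/= t0.
  - move=> i; have [w Cw ww] := Wi i; move/CregS : (Cw) => [w' Cw' pw].
    exists w' => //.
    have [h1 h2] := W'V i 0 T00.
    have [D _ wD] := Reg_unif_lip Cw.
    have wW : forall x, a <= x <= b -> W' i 0 x = w x.
      apply: (aeq_lip_eq h1 (wD tt _)) => //.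
      exact: aeq_trans (aeq_sym h2) ww.
    apply: (@prim_unique _ a b w) => //.
    + exact: bmf_intg (ub_bmf (uW2 i) T00).
    + exact: bmf_intg (Creg_bmf Cw').
    + move=> x y ax xy yb; rewrite -!wW ?Wn_prim// ?yb ?ax ?(le_trans ax xy) ?(le_trans xy yb)//.
exists W' => i; split; last by move=> t tT; have [] := W'V i t tT.
have [RW3 W3n] := W3P i.
split; first exact: Reg_ub (RW' i).
exists (W3 i) => // t tT.
apply: prim_aeq (W3n t tT) (Wn_prim i t tT).
  exact: bmf_intg (ub_bmf (uW2 i) tT).
by have [] := Reg_bmf RW3 tT.
Qed.

End LinearSystem.

(** * Weak derivatives *)

Section FunctionClasses.
Context {R : realType}.
Implicit Types (f g phi : R -> R) (I : set R).

Lemma lebT_gt0 : (0 < @lebesgue_measure R setT)%E.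
Proof.
apply: (@lt_le_trans _ _ (@lebesgue_measure R `[0, 1]%classic)).
  by rewrite leb_itvcc// subr0 lte_fin ltr01.
by apply: le_measure; rewrite ?inE.
Qed.

Lemma LinftyP I f : measurable I -> Linfty I f <->
  measurable_fun I f /\ exists C : R, {ae @lebesgue_measure R, forall x, I x -> `|f x| <= C}.
Proof.
move=> mI; rewrite /Linfty /=; split.
  move=> /andP[]; rewrite !inE /= => mf.
  have {}mf : measurable_fun I f by apply/(measurable_restrictT _ _).2.
  rewrite /finite_norm unlock lebT_gt0 => fin; split=> //.
  have := ess_sup_ge (@lebesgue_measure R) (abse \o (EFin \o f \_ I)).
  move: fin; set E := ess_sup _ _ => Efin h; exists (fine E).
  apply: ae_S h => x; rewrite /= => fx Ix.
  move: fx; rewrite patchE mem_set// => fx.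
  have Ef : E \is a fin_num by rewrite fin_numElt Efin andbT (lt_le_trans _ fx)// ltNyr.
  by rewrite -lee_fin fineK.
move=> [mf [C fC]]; apply/andP; split; rewrite inE /=.
  by apply/(measurable_restrictT _ _).1.
rewrite /finite_norm unlock lebT_gt0.
apply: (@le_lt_trans _ _ (Num.max C 0)%:E); last exact: ltry.
apply/ess_supP; apply: ae_S fC => x fC /=.
rewrite lee_fin patchE; case: ifPn; rewrite ?inE ?notin_setE => Ix.
  by rewrite le_max fC.
by rewrite normr0 le_max lexx orbT.
Qed.

Lemma L2_measurable f : L2 f -> measurable_fun setT f.
Proof. by rewrite /L2 /= => /andP[]; rewrite inE. Qed.

Lemma L2_norm_sqr f : (L2_norm f * L2_norm f = \int[lebesgue_measure]_x (f x ^+ 2)%:E)%E.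
Proof.
have := @poweR_Lnorm _ _ _ (@lebesgue_measure R) (EFin \o f) 2 _.
rewrite pnatr_eq0 => /(_ isT) h.
have -> : (L2_norm f * L2_norm f = L2_norm f `^ 2)%E.
  have : (0 <= L2_norm f)%E by exact: Lnorm_ge0.
  case: (L2_norm f) => [r| |//] r0; last by rewrite poweRyr.
  by rewrite poweR_EFin powR_mulrn// -EFinM -expr2.
rewrite h; apply: eq_integral => x _ /=.
by rewrite powR_mulrn// real_normK ?num_real.
Qed.

End FunctionClasses.

(** * Test functions made from the cutoff, and weak derivatives at Lebesgue points *)

Section TestFunctions.
Context {R : realType}.
Implicit Types (f g phi chi : R -> R) (I : set R) (p q k e : R).

Lemma smooth_is_derive phi n (x : R) : smooth phi ->
  is_derive x 1 (derive1n n phi) (derive1n n.+1 phi x).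
Proof. by move=> sphi; apply: DeriveDef; [exact: sphi|rewrite derive1nS derive1E]. Qed.

Lemma is_derive_affine k p (x : R) : is_derive x 1 (fun x => k * (x - p)) k.
Proof.
have h : is_derive x 1 (k *: ((id : R -> R) - cst p)) (k *: (1 - 0)) by exact: is_deriveZ.
by move: h; rewrite subr0 /GRing.scale/= mulr1.
Qed.

Lemma derive1n_affine phi k p n : smooth phi ->
  derive1n n (fun x => phi (k * (x - p))) = fun x => k ^+ n * derive1n n phi (k * (x - p)).
Proof.
move=> sphi; elim: n => [|n IH]; first by apply/funext => x; rewrite !derive1n0 expr0 mul1r.
rewrite derive1nS IH; apply/funext => x; rewrite derive1E.
have d1 := @is_derive1_comp R _ _ x _ _ (smooth_is_derive n (k * (x - p)) sphi) (is_derive_affine k p x).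
have [_ ->] := is_deriveZ (k ^+ n) d1.
by rewrite /GRing.scale/= exprSr; ring.
Qed.

Lemma smooth_affine phi k p : smooth phi -> smooth (fun x => phi (k * (x - p))).
Proof.
move=> sphi n x; rewrite derive1n_affine//.
have d1 := @is_derive1_comp R _ _ x _ _ (smooth_is_derive n (k * (x - p)) sphi) (is_derive_affine k p x).
by have [] := is_deriveZ (k ^+ n) d1.
Qed.

Lemma derive1nB phi psi n : smooth phi -> smooth psi ->
  derive1n n (fun x => phi x - psi x) = fun x => derive1n n phi x - derive1n n psi x.
Proof.
move=> sphi spsi; elim: n => [|n IH]; first by apply/funext => x; rewrite !derive1n0.
rewrite derive1nS IH; apply/funext => x; rewrite derive1E.
by have [_ ->] := is_deriveB (smooth_is_derive n x sphi) (smooth_is_derive n x spsi).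
Qed.

Lemma smoothB phi psi : smooth phi -> smooth psi -> smooth (fun x => phi x - psi x).
Proof.
move=> sphi spsi n x; rewrite derive1nB//.
by have [] := is_deriveB (smooth_is_derive n x sphi) (smooth_is_derive n x spsi).
Qed.

Lemma test_bmf I phi a b : test_function I phi ->
  [/\ bmf a b phi, bmf a b (derive1 phi) & prim a b phi (derive1 phi)].
Proof.
move=> [sphi _].
have dphi (x : R) : is_derive x 1 phi (derive1 phi x) by exact: (smooth_is_derive 0 x sphi).
have cphi' : continuous (derive1 phi).
  by move=> x; exact: is_derive_continuous (smooth_is_derive 1 x sphi).
split; [apply: continuous_bmf|exact: continuous_bmf|exact: derive_prim].
by move=> x; exact: is_derive_continuous (dphi x).
Qed.

Section Cutoff.
Variable chi : R -> R.
Hypothesis hchi : cutoff chi.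

Let schi : smooth chi. Proof. by case: hchi. Qed.

Lemma cutoff_derive (x : R) : is_derive x 1 chi (derive1 chi x).
Proof. exact: (smooth_is_derive 0 x schi). Qed.

Lemma cutoff_derive2 (x : R) : is_derive x 1 (derive1 chi) (derive1n 2 chi x).
Proof. exact: (smooth_is_derive 1 x schi). Qed.

Lemma cutoff_continuous : continuous chi.
Proof. by move=> x; exact: is_derive_continuous (cutoff_derive x). Qed.

Lemma cutoff_derive_continuous : continuous (derive1 chi).
Proof. by move=> x; exact: is_derive_continuous (cutoff_derive2 x). Qed.

Lemma cutoff_derive2_continuous : continuous (derive1n 2 chi).
Proof. by move=> x; exact: is_derive_continuous (smooth_is_derive 2 x schi). Qed.

Lemma cutoff_homo x y : x <= y -> chi x <= chi y.
Proof.
rewrite le_eqVlt => /predU1P[->//|xy].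
have [|z _ E] := @MVT _ chi (derive1 chi) _ _ xy (fun z _ => cutoff_derive z).
  by apply: continuous_subspaceT => z; exact: cutoff_continuous.
rewrite -subr_ge0 E mulr_ge0 ?subr_ge0 ?(ltW xy)//.
by case: hchi => _ _ _; exact.
Qed.

Lemma cutoff_ge0 x : 0 <= chi x.
Proof.
have [x0|x0] := ltP x 0; first by case: hchi => _ -> .
have <- : chi (-1) = 0 by case: hchi => _ -> //; rewrite ltrN10.
by apply: cutoff_homo; rewrite (le_trans _ x0)// lerN10.
Qed.

Lemma cutoff_le1 x : chi x <= 1.
Proof.
have [x1|x1] := leP 1 x; first by case: hchi => _ _ ->.
have <- : chi 1 = 1 by case: hchi => _ _ ->.
by apply: cutoff_homo; exact: ltW.
Qed.

(** [cutoff] prescribes 0 only on the open half-line; continuity adds the end point, which [step_le]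
    needs at [x = p]. *)
Lemma cutoff0 : chi 0 = 0.
Proof.
apply/eqP; rewrite eq_le cutoff_ge0 andbT.
apply/ler_addgt0Pr => e e0.
have /cvgrPdist_le/(_ _ e0) := @cutoff_continuous 0.
move=> [d /= d0 h]; have := h (- (d / 2)).
rewrite /= sub0r opprK gtr0_norm ?divr_gt0// ltr_pdivrMr// ltr_pMr// ltr1n => /(_ isT).
have -> : chi (- (d / 2)) = 0 by case: hchi => _ -> //; rewrite oppr_lt0 divr_gt0.
by rewrite subr0 add0r => /(le_trans (ler_norm _)).
Qed.

Lemma cutoff_derive_out x : x < 0 \/ 1 < x -> derive1 chi x = 0.
Proof.
move=> xo; have [_ E] := cutoff_derive x; rewrite -E.
have [c hc] : exists c : R, \forall y \near x, chi y = c.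
  case: xo => x0.
    exists 0; near=> y; case: hchi => _ h0 _ _; apply: h0; near: y.
    by exists (- x) => /= [|y /=]; rewrite ?oppr_gt0// => h; have := ler_norm (y - x); rewrite distrC; lra.
  exists 1; near=> y; case: hchi => _ _ h1 _; apply: h1; near: y.
  exists (x - 1) => /= [|y /=]; first by rewrite subr_gt0.
  by move=> h; have := ler_norm (x - y); lra.
have hc' : {near x, cst c =1 chi}.
  by apply: filterS hc => y /= ->.
by rewrite -(near_eq_derive _ hc') derive_cst.
Unshelve. all: by end_near. Qed.

(** The cutoff of the function spaces doubles as the source of test functions: rescaled, it rises
    from 0 to 1 on [p, p + e], and the difference of two such steps is a smooth bump. *)
Definition step p e x := chi (e^-1 * (x - p)).

Lemma is_derive_step p e (x : R) :
  is_derive x 1 (step p e) (derive1 chi (e^-1 * (x - p)) * e^-1).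
Proof. exact: (@is_derive1_comp R _ _ x _ _ (cutoff_derive _) (is_derive_affine _ p x)). Qed.

Lemma step_le p e x : 0 < e -> x <= p -> step p e x = 0.
Proof.
move=> e0; rewrite le_eqVlt => /predU1P[->|xp].
  by rewrite /step subrr mulr0 cutoff0.
by case: hchi => _ h _ _; apply: h; rewrite pmulr_rlt0 ?invr_gt0// subr_lt0.
Qed.

Lemma step_ge p e x : 0 < e -> p + e <= x -> step p e x = 1.
Proof.
move=> e0 px; case: hchi => _ _ h _; apply: h.
by rewrite mulrC ler_pdivlMr// mul1r lerBrDl.
Qed.

Lemma step_ge0 p e x : 0 <= step p e x. Proof. exact: cutoff_ge0. Qed.

Lemma step_le1 p e x : step p e x <= 1. Proof. exact: cutoff_le1. Qed.

Lemma bump_test I p q e : 0 < e -> p + e <= q -> (`[p, q + e] : set R) `<=` I ->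
  test_function I (fun x => step p e x - step q e x).
Proof.
move=> e0 pq sub; split; first by apply: smoothB; exact: smooth_affine.
exists `[p, q + e]%classic; split=> //; first exact: segment_compact.
move=> x; rewrite /= in_itv/= => /negP; rewrite negb_and -!ltNge => /orP[xp|qx].
  by rewrite !step_le ?subrr ?(ltW xp)//; lra.
by rewrite !step_ge ?subrr//; lra.
Qed.

Lemma derive1_bump p q e x :
  derive1 (fun x => step p e x - step q e x) x =
  derive1 chi (e^-1 * (x - p)) * e^-1 - derive1 chi (e^-1 * (x - q)) * e^-1.
Proof.
by rewrite derive1E; have [_ ->] := is_deriveB (is_derive_step p e x) (is_derive_step q e x).
Qed.

Lemma cutoff_derive_bounded : exists2 C, 0 < C & forall x, `|derive1 chi x| <= C.
Proof.
have [_ [C hC]] := continuous_bmf 0 1 cutoff_derive_continuous.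
have C0 : 0 <= C by rewrite (le_trans _ (hC 0 _))// lexx ler01.
exists (C + 1); first by rewrite ltr_wpDl.
move=> x; have [/hC h|] := boolP (0 <= x <= 1); first by rewrite (le_trans h)// lerDl.
rewrite negb_and -!ltNge => xo; rewrite cutoff_derive_out ?normr0 ?addr_ge0//.
by case/orP: xo; [left|right].
Qed.

End Cutoff.

Lemma Rintegral_supp (A B : set R) f : B `<=` A -> (forall x, A x -> ~ B x -> f x = 0) ->
  \int[lebesgue_measure]_(x in A) f x = \int[lebesgue_measure]_(x in B) f x.
Proof.
move=> BA f0; rewrite Rintegral_mkcond [RHS]Rintegral_mkcond.
apply: eq_Rintegral => x _; rewrite !patchE.
case: ifPn; rewrite ?inE ?notin_setE => Ax; case: ifPn; rewrite ?inE ?notin_setE => Bx //.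
  exact: f0.
by case: Ax; exact: BA.
Qed.

(* Right Lebesgue points; right ones because the bumps step chi p e - step chi q e
   rise on [p, p + e] and fall on [q, q + e]. *)
Definition rleb f p := forall eta : R, 0 < eta -> exists2 d, 0 < d &
  forall e, 0 < e -> e <= d -> itg p (p + e) (fun x => `|f x - f p|) <= eta * e.

Lemma intg_small p r g : p < r -> intg p r g -> forall eta : R, 0 < eta ->
  exists2 d, 0 < d & forall e, 0 < e -> e <= d -> itg p (p + e) (fun x => `|g x|) <= eta.
Proof.
move=> pr gi eta eta0.
have := parameterized_integral_near_left pr eta0 (intg_norm gi).
move=> [d /= d0 h]; exists (d / 2); first by rewrite divr_gt0.
move=> e e0 ed; have := h (p + e); rewrite /= opprD addNKr normrN gtr0_norm// => /(_ _)/(_ _).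
have ed' : e < d by rewrite (le_lt_trans ed)// ltr_pdivrMr// ltr_pMr// ltr1n.
by move=> /(_ ed')/(_ _)/ltW; rewrite lerDl (ltW e0) => /(_ isT); apply: le_trans; exact: ler_norm.
Qed.

Lemma locally_integrable_intg I f p q : locally_integrable I f -> (`[p, q] : set R) `<=` I ->
  intg p q f.
Proof.
move=> [mf oI fi] sub; apply/integrableP; split.
  by apply/measurable_EFinP; apply: measurable_funS mf => //; exact: open_measurable.
exact: fi sub (@segment_compact _ _ _).
Qed.

Lemma intgM_bmf a b f h : intg a b f -> bmf a b h -> intg a b (fun x => f x * h x).
Proof.
move=> fi [mh [C hC]].
have hb : [bounded h x | x in (`[a, b] : set R)].
  exists C; split; first exact: num_real.
  by move=> M /ltW CM x /=; rewrite in_itv/= => xab; exact: le_trans (hC x xab) CM.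
by apply: eq_integrable (integrableMl _ fi mh hb) => // x _ /=; rewrite EFinM.
Qed.

Lemma bump_bmf chi s e a b : cutoff chi -> 0 < e ->
  bmf a b (fun x => derive1 chi (e^-1 * (x - s)) * e^-1).
Proof.
move=> hchi e0; have [C C0 chiC] := cutoff_derive_bounded hchi; split.
  apply: measurable_funS (_ : measurable_fun setT _) => //.
  apply: continuous_measurable_fun => x.
  apply: cvgM; last exact: cvg_cst.
  apply: continuous_comp; last exact: cutoff_derive_continuous.
  exact: is_derive_continuous (is_derive_affine e^-1 s x).
by exists (C * e^-1) => x _; rewrite normrM (gtr0_norm (_ : 0 < e^-1)) ?invr_gt0// ler_wpM2r// invr_ge0 ltW.
Qed.

Lemma itg_bump chi s e : cutoff chi -> 0 < e ->
  itg s (s + e) (fun x => derive1 chi (e^-1 * (x - s)) * e^-1) = 1.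
Proof.
move=> hchi e0; have [mb [C bC]] := bump_bmf s s (s + e) hchi e0.
have se : s < s + e by rewrite ltrDl.
have lp : lip s (s + e) (step chi s e) C.
  by apply: derive_lip bC => x _; exact: is_derive_step.
have pr := lip_ae_prim se lp mb (ae_T (fun x _ => is_derive_step hchi s e x)).
by rewrite -pr ?(ltW se)// step_ge// step_le// subr0.
Qed.

(** The difference is the integral of f x - f s against the derivative of a step, which has integral
    1 and size at most C / e. *)
Lemma bump_avg chi f s e h C : cutoff chi -> 0 < e -> (forall x, `|derive1 chi x| <= C) ->
  intg s (s + e) f ->
  itg s (s + e) (fun x => `|f x - f s|) <= h * e ->
  `|itg s (s + e) (fun x => f x * (derive1 chi (e^-1 * (x - s)) * e^-1)) - f s| <= C * h.
Proof.
move=> hchi e0 chiC fi fh.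
pose b x := derive1 chi (e^-1 * (x - s)) * e^-1.
have bb : bmf s (s + e) b by exact: bump_bmf.
have bC x : `|b x| <= C * e^-1.
  by rewrite normrM (gtr0_norm (_ : 0 < e^-1)) ?invr_gt0// ler_wpM2r// invr_ge0 ltW.
have C0 : 0 <= C by rewrite (le_trans _ (chiC 0)).
have fsi : intg s (s + e) (fun x => f x - f s) by apply: intgB => //; exact: intg_cst.
have -> : itg s (s + e) (fun x => f x * b x) - f s = itg s (s + e) (fun x => (f x - f s) * b x).
  rewrite -[X in _ - X]mulr1 -(itg_bump s hchi e0) -itgZ; last exact: bmf_intg.
  rewrite -itgB; last 2 first.
  - exact: intgM_bmf.
  - by apply: intgZ; exact: bmf_intg.
  by apply: eq_itg => x _; rewrite mulrBl.
have fbi := intgM_bmf fsi bb.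
apply: (le_trans (itg_norm fbi)).
apply: (@le_trans _ _ (itg s (s + e) (fun x => (C * e^-1) * `|f x - f s|))).
  apply: itg_le; [exact: intg_norm|by apply: intgZ; exact: intg_norm|].
  by move=> x _; rewrite normrM mulrC ler_wpM2r.
rewrite itgZ; last exact: intg_norm.
rewrite -mulrA ler_wpM2l// mulrC ler_pdivrMr//.
Qed.

(** Test against a bump that rises on [p, p + e] and falls on [q, q + e]. Its derivative averages
    [f] near [p] and near [q], while the bump itself tends to the indicator of [p, q]; [r] leaves
    room for the falling part. *)
Lemma weak_derivative_prim chi I f g p q r : cutoff chi -> is_weak_derivative I f g ->
  p < q -> q < r -> (`[p, r] : set R) `<=` I -> rleb f p -> rleb f q ->
  f q - f p = itg p q g.
Proof.
move=> hchi [lf lg fg] pq qr sub fp fq.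
have fi := locally_integrable_intg lf sub; have gi := locally_integrable_intg lg sub.
have pr := lt_trans pq qr.
have [C C0 chiC] := cutoff_derive_bounded hchi.
apply/eqP; rewrite -subr_eq0 -normr_le0; apply/ler_addgt0Pr => eta eta0; rewrite add0r.
(* Error budget: C h for each of the two averages of [f], and [h] for each of the two integrals of
   [g] over the pieces of length [e]. *)
have [h h0 He] : exists2 h : R, 0 < h & (2 * C + 2) * h = eta.
  have C2 : 0 < 2 * C + 2 by rewrite addr_gt0// mulr_gt0.
  by exists (eta / (2 * C + 2)); rewrite ?divr_gt0// mulrC divfK// gt_eqF.
have [d1 d10 D1] := fp _ h0; have [d2 d20 D2] := fq _ h0.
have [d3 d30 D3] := intg_small pr gi h0.
have [d4 d40 D4] := intg_small qr (intgS (ltW pq) (lexx r) gi) h0.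
have [e [e0 [ed1 ed2 ed3 ed4] [epq eqr]]] : exists e : R, [/\ 0 < e,
    [/\ e <= d1, e <= d2, e <= d3 & e <= d4] & e <= q - p /\ e <= r - q].
  exists (Num.min (Num.min (Num.min d1 d2) (Num.min d3 d4)) (Num.min (q - p) (r - q))).
  by split; [rewrite !lt_min d10 d20 d30 d40 !subr_gt0 pq qr|..];
     split; rewrite !ge_min lexx ?orbT.
have pe : p + e <= q by lra.
have qe : q + e <= r by lra.
have sub' : (`[p, q + e] : set R) `<=` I.
  by apply: subset_trans sub; exact: subset_itvcc.
have := fg _ (bump_test hchi e0 pe sub').
clear d10 d20 d30 d40; pose b (s x : R) := derive1 chi (e^-1 * (x - s)) * e^-1.
pose phi x := step chi p e x - step chi q e x.
have b_out s x : x < s \/ s + e < x -> b s x = 0.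
  move=> xo; rewrite /b cutoff_derive_out ?mul0r//; case: xo => xo; [left|right].
    by rewrite pmulr_rlt0 ?invr_gt0// subr_lt0.
  by rewrite mulrC ltr_pdivlMr// mul1r ltrBrDl.
have peqe : p <= q + e by lra.
have fi' : intg p (q + e) f := intgS (lexx p) qe fi.
have gi' : intg p (q + e) g := intgS (lexx p) qe gi.
have bbp s : bmf p (q + e) (b s) by exact: bump_bmf.
have supp_in x : x < p \/ q + e < x -> phi x = 0.
  rewrite /phi => -[xp|qx]; first by rewrite !step_le ?subrr//; lra.
  by rewrite !step_ge ?subrr//; lra.
have out x : ~ `[p, q + e]%classic x -> x < p \/ q + e < x.
  by rewrite /= in_itv/= => /negP; rewrite negb_and -!ltNge => /orP.
rewrite (Rintegral_supp sub'); last first.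
  move=> x _ /out xo; rewrite derive1_bump// -/(b p x) -/(b q x) !b_out ?subrr ?mulr0//; lra.
rewrite [in RHS](Rintegral_supp sub'); last first.
  by move=> x _ /out xo; rewrite -/(phi x) supp_in ?mulr0.
rewrite -/(itg p (q + e) _) -/(itg p (q + e) _).
have -> : itg p (q + e) (fun x => f x * derive1 (fun x => step chi p e x - step chi q e x) x) =
  itg p (p + e) (fun x => f x * b p x) - itg q (q + e) (fun x => f x * b q x).
  have -> : itg p (p + e) (fun x => f x * b p x) = itg p (q + e) (fun x => f x * b p x).
    apply/esym/Rintegral_supp; first by apply: subset_itvcc => //; lra.
    move=> x; rewrite /= !in_itv/= => /andP[px xq] /negP; rewrite px/= -ltNge => xpe.
    by rewrite b_out ?mulr0//; right.
  have -> : itg q (q + e) (fun x => f x * b q x) = itg p (q + e) (fun x => f x * b q x).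
    apply/esym/Rintegral_supp; first by apply: subset_itvcc => //; lra.
    move=> x; rewrite /= !in_itv/= => /andP[px xq] /negP; rewrite xq andbT -ltNge => xpe.
    by rewrite b_out ?mulr0//; left.
  rewrite -itgB; [|exact: intgM_bmf|exact: intgM_bmf].
  by apply: eq_itg => x _; rewrite derive1_bump// mulrBr.
have phi_b x : 0 <= step chi p e x <= 1 /\ 0 <= step chi q e x <= 1.
  by split; rewrite step_ge0// step_le1.
have phi_bmf : bmf p (q + e) phi.
  split; last first.
    by exists 1 => x _; have [/andP[? ?] /andP[? ?]] := phi_b x; rewrite /phi ler_norml; apply/andP; split; lra.
  apply: measurable_funS (_ : measurable_fun setT _) => //.
  apply: continuous_measurable_fun => x; apply: cvgB.
    exact: is_derive_continuous (is_derive_step hchi p e x).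
  exact: is_derive_continuous (is_derive_step hchi q e x).
have gphi := intgM_bmf gi' phi_bmf.
rewrite (itg_cat (ltW pq) _ gphi); last by lra.
have Ap := bump_avg hchi e0 chiC (intgS (lexx p) (le_trans pe (ltW qr)) fi) (D1 e e0 ed1).
have Aq := bump_avg hchi e0 chiC (intgS (ltW pq) qe fi) (D2 e e0 ed2).
rewrite -/(b p) in Ap; rewrite -/(b q) in Aq.
set up := itg p (p + e) _ in Ap *; set uq := itg q (q + e) (fun x => f x * b q x) in Aq *.
have gpq : intg p q g := intgS (lexx p) (ltW qr) gi.
have phi_pq : bmf p q phi by apply: bmfS phi_bmf => //; lra.
have B1 : `|itg p q (fun x => g x * phi x) - itg p q g| <= h.
  have gphipq := intgM_bmf gpq phi_pq.
  rewrite -itgB//; have -> : itg p q (fun t => g t * phi t - g t) =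
      itg p (p + e) (fun t => g t * phi t - g t).
    apply: Rintegral_supp; first by apply: subset_itvcc => //; lra.
    move=> x; rewrite /= !in_itv/= => /andP[px xq] /negP; rewrite px/= -ltNge => xpe.
    by rewrite /phi step_ge ?(ltW xpe)// step_le// subr0 mulr1 subrr.
  have gi1 : intg p (p + e) (fun t => g t * phi t - g t).
    by apply: intgS (intgB gphipq gpq).
  apply: (le_trans (itg_norm gi1)); apply: le_trans (D3 e e0 ed3).
  apply: itg_le; [exact: intg_norm|apply: intg_norm; exact: intgS gpq|].
  move=> x _; have [/andP[? ?] /andP[? ?]] := phi_b x.
  rewrite -[X in _ - X]mulr1 -mulrBr normrM ler_piMr// ler_norml /phi.
  have [xq|qx] := leP x q; first by rewrite (step_le hchi e0 xq); apply/andP; split; lra.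
  have -> : step chi p e x = 1 by apply: step_ge => //; lra.
  by apply/andP; split; lra.
have B2 : `|itg q (q + e) (fun x => g x * phi x)| <= h.
  have gq : intg q (q + e) g by apply: intgS gi' => //; lra.
  have gphiq : intg q (q + e) (fun x => g x * phi x) by apply: intgS gphi => //; lra.
  apply: (le_trans (itg_norm gphiq)); apply: le_trans (D4 e e0 ed4).
  apply: itg_le; [exact: intg_norm|exact: intg_norm|].
  move=> x _; have [/andP[? ?] /andP[? ?]] := phi_b x.
  by rewrite normrM ler_piMr// ler_norml /phi; apply/andP; split; lra.
set v1 := itg p q (fun x => g x * phi x) in B1 *.
set v2 := itg q (q + e) (fun x => g x * phi x) in B2 *.
rewrite -/v1 -/v2 => E.
have -> : f q - f p - itg p q g = (v1 - itg p q g) + (up - f p) - (uq - f q) + v2 by lra.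
apply: (le_trans (ler_normD _ _)).
have n1 := ler_normB (v1 - itg p q g + (up - f p)) (uq - f q).
have n2 := ler_normD (v1 - itg p q g) (up - f p).
by rewrite mulrDl -mulrA in He; lra.
Qed.

End TestFunctions.

(** * From weak derivatives to iterated primitives and back *)

Section WeakDerivatives.
Context {R : realType}.
Implicit Types (f g F G phi chi : R -> R) (I : set R) (a b p q r : R).

Lemma rleb_continuous f p r : p < r -> intg p r f -> {for p, continuous f} -> rleb f p.
Proof.
move=> pr fi cf eta eta0.
have /cvgrPdist_le/(_ _ eta0)[d /= d0 h] := cf.
exists (Num.min (d / 2) (r - p)); first by rewrite lt_min divr_gt0//= subr_gt0.
move=> e e0; rewrite le_min => /andP[ed er].
have per : p + e <= r by lra.
have fi' : intg p (p + e) (fun x => `|f x - f p|).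
  by apply/intg_norm/intgB; [exact: intgS fi|exact: intg_cst].
have -> : eta * e = itg p (p + e) (fun=> eta).
  by rewrite itg_cst ?lerDl ?(ltW e0)//; congr (_ * _); ring.
apply: itg_le => //; first exact: intg_cst.
move=> x /andP[px xe]; rewrite distrC; apply: h => /=.
by rewrite distrC ger0_norm ?subr_ge0//; lra.
Qed.

Lemma rleb_ae f a b : locally_integrable setT (f \_ `]a, b[) ->
  {ae @lebesgue_measure R, forall p, a < p < b -> rleb f p}.
Proof.
move=> lf; apply: ae_S (lebesgue_differentiation lf) => p + /andP[ap pb] eta eta0.
(* [p, p + e] is compared with the ball of radius 2 e, of measure 4 e: a mean below eta / 4 on the
   ball is an integral below eta e. *)
have eta4 : 0 < eta / 4 by rewrite divr_gt0.
rewrite /lebesgue_pt => /fine_cvgP[fin /cvgrPdist_le/(_ _ eta4) hh].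
have [d /= d0 H] := filterI fin hh.
exists (Num.min (d / 4) ((b - p) / 2)); first by rewrite lt_min !divr_gt0// subr_gt0.
move=> e e0; rewrite le_min => /andP[ed eb].
have r0 : 0 < 2 * e by rewrite mulr_gt0.
have [|Hfin Hle] := H (2 * e) _ r0.
  by rewrite /ball_/= sub0r normrN gtr0_norm//; lra.
pose fI := f \_ `]a, b[; have mfI : measurable_fun setT fI by case: lf.
have mS (D : set R) : measurable D -> measurable_fun D (fun y => `|(fI y - fI p)%:E|%E).
  move=> mD; apply: measurableT_comp => //; apply/measurable_EFinP.
  by apply: measurable_funB => //; exact: measurable_funTS.
have fIE x : p <= x <= p + e -> fI x = f x.
  move=> /andP[px xe]; rewrite /fI patchE mem_set//= in_itv/=; apply/andP; split; lra.
have : (\int[lebesgue_measure]_(y in ball p (2 * e)) `|(fI y - fI p)%:E| <= (eta * e)%:E)%E.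
  have : (davg fI p (2 * e) <= (eta / 4)%:E)%E.
    rewrite -(fineK Hfin) lee_fin; move: Hle; rewrite sub0r normrN.
    by move/(le_trans (ler_norm _)).
  rewrite /davg /iavg lebesgue_measure_ball ?(ltW r0)// inver gt_eqF ?mulrn_wgt0//.
  rewrite lee_pdivrMl ?mulrn_wgt0// -EFinM => /le_trans; apply.
  by rewrite lee_fin le_eqVlt; apply/orP; left; apply/eqP; field.
set J := (X in (X <= _)%E) => HJ.
have sub : (`[p, p + e] : set R) `<=` ball p (2 * e).
  move=> x /=; rewrite in_itv/= => /andP[px xe]; rewrite /ball/= distrC ger0_norm ?subr_ge0//; lra.
have : (\int[lebesgue_measure]_(x in `[p, (p + e)%R]) (`|f x - f p|%R)%:E <= (eta * e)%:E)%E.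
  apply: le_trans HJ; apply: (@le_trans _ _ (\int[lebesgue_measure]_(y in `[p, (p + e)%R]) `|(fI y - fI p)%:E|)%E).
    rewrite le_eqVlt; apply/orP; left; apply/eqP; apply: eq_integral => x.
    by rewrite inE/= in_itv/= => xp; rewrite !fIE// lexx lerDl ltW.
  by apply: ge0_subset_integral => //; [exact: measurable_ball|apply: mS; exact: measurable_ball].
rewrite /itg /Rintegral; set X := integral _ _ _ => XC.
have X0 : (0 <= X)%E by apply: integral_ge0 => x _; rewrite lee_fin.
by rewrite -lee_fin fineK// ge0_fin_numE// (le_lt_trans XC)// ltry.
Qed.

Lemma Linfty_locally_integrable a b f : Linfty `]a, b[ f -> locally_integrable `]a, b[ f.
Proof.
move=> /LinftyP[//|mf [C fC]]; split=> // K KI cK.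
have mK := compact_measurable cK.
have mfK : measurable_fun K f by apply: measurable_funS mf.
apply: (@le_lt_trans _ _ (`|C|%:E * @lebesgue_measure R K)%E).
  apply: (@integral_le_bound _ _ _ (@lebesgue_measure R) K (EFin \o f) `|C|%:E) => //.
  - exact/measurable_EFinP.
  - by apply: ae_S fC => x h /KI /h fx; rewrite /= lee_fin (le_trans fx)// ler_norm.
rewrite lte_mul_pinfty//; apply: compact_finite_measure => //.
Qed.

Lemma weak_derivative_continuous chi I f g a b : cutoff chi -> is_weak_derivative I f g ->
  continuous f -> I = setT -> intg a b g /\ prim a b f g.
Proof.
move=> hchi fg cf IT; rewrite IT in fg.
have [lf lg _] := fg.
split; first exact: locally_integrable_intg lg _.
have rf p : rleb f p.
  apply: (@rleb_continuous f p (p + 1)); first by rewrite ltrDl.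
    exact: locally_integrable_intg lf _.
  exact: cf.
move=> x y _; rewrite le_eqVlt => /predU1P[-> _|xy _]; first by rewrite subrr itgxx.
by apply: (weak_derivative_prim (r := y + 1) hchi fg) => //; rewrite ltrDl.
Qed.

(** Almost every point is a right Lebesgue point and [weak_derivative_prim] links any two of them.
    One such point [p0] fixes the constant of integration. *)
Lemma weak_derivative_prim_ae chi a b f g G : cutoff chi -> a < b ->
  is_weak_derivative `]a, b[ f g -> locally_integrable setT (f \_ `]a, b[) ->
  bmf a b G -> {ae @lebesgue_measure R, forall x, a < x < b -> g x = G x} ->
  exists2 F, prim a b F G & {ae @lebesgue_measure R, forall x, a < x < b -> f x = F x}.
Proof.
move=> hchi ab fg lf Gb gG; have rf := rleb_ae lf; have [_ lg _] := fg.
have [p0 /andP[p0a p0b] rp0] : exists2 p, a < p < b & rleb f p.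
  have lt1 : a + (b - a) / 3 < b - (b - a) / 3 by lra.
  have [|t t1 t2] := @ae_ex R _ _ (fun p => a < p < b /\ rleb f p) lt1.
    apply: ae_S rf => p h /andP[p1 p2]; have pab : a < p < b by apply/andP; split; lra.
    by split => //; exact: h.
  by case: t2; exists t.
have Gi := bmf_intg Gb.
exists (fun x => (f p0 - itg a p0 G) + itg a x G); first exact: primitive_prim.
apply: ae_S rf => q h /[dup] qab /andP[aq qb]; have rq := h qab.
have key p r : a < p -> p < r -> r < b -> rleb f p -> rleb f r -> f r - f p = itg p r G.
  move=> ap pr rb rp rr.
  have lt2 : r < (r + b) / 2 by lra.
  have sub s : s < b -> (`[p, s] : set R) `<=` `]a, b[.
    by move=> sb x /=; rewrite !in_itv/= => /andP[px xs]; apply/andP; split; lra.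
  rewrite (weak_derivative_prim hchi fg pr lt2 _ rp rr); last by apply: sub; lra.
  apply: aeq_itg.
  - by apply: intg_measurable; apply: locally_integrable_intg lg _; exact: sub.
  - by apply: intg_measurable; apply: intgS Gi; exact: ltW.
  - by apply: ae_S gG => x gx /andP[px xr]; apply: gx; apply/andP; split; lra.
have cat p r : a < p -> p <= r -> r < b -> itg a r G = itg a p G + itg p r G.
  move=> ap pr rb; apply: itg_cat => //; first exact: ltW.
  by apply: intgS Gi => //; exact: ltW.
have [pq|] := ltrP p0 q; last rewrite le_eqVlt => /predU1P[->|qp].
- by rewrite (cat p0 q)// ?(ltW pq)// -(key p0 q)//; ring.
- by ring.
- by rewrite (cat q p0)// ?(ltW qp)// -(key q p0)//; ring.
Qed.

Lemma Linfty_restrict a b f : Linfty `]a, b[ f -> locally_integrable setT (f \_ `]a, b[).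
Proof.
move=> /LinftyP[//|mf [C fC]].
apply: integrable_locally_restrict => //; apply/integrableP; split; first exact/measurable_EFinP.
apply: (@le_lt_trans _ _ (`|C|%:E * @lebesgue_measure R `]a, b[%classic)%E).
  apply: (@integral_le_bound _ _ _ (@lebesgue_measure R) _ (EFin \o f) `|C|%:E) => //.
  - exact/measurable_EFinP.
  - by apply: ae_S fC => x h /h fx; rewrite /= lee_fin (le_trans fx)// ler_norm.
rewrite lte_mul_pinfty// lebesgue_measure_itv/=; case: ifP => // _; exact: ltry.
Qed.

Lemma Winfty_Linfty n I f : Winfty n I f -> Linfty I f.
Proof. by case: n => [//|n] []. Qed.

(** In the base case [f] is replaced by 0 outside ]a, b[ and above its essential bound, since
    [Linfty] controls it only almost everywhere inside. Each weak derivative then contributes one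
    integration. *)
Lemma Winfty_Creg chi n a b f : cutoff chi -> a < b -> Winfty n `]a, b[ f ->
  exists2 F, Creg n a b F & {ae @lebesgue_measure R, forall x, a < x < b -> f x = F x}.
Proof.
move=> hchi ab; elim: n f => [|n IH] f.
  move=> /LinftyP[//|mf [C fC]].
  exists (fun x => if (a < x < b) && (`|f x| <= C) then f x else 0); last first.
    by apply: ae_S fC => x h xab; rewrite xab h//= in_itv.
  apply/Creg0; split; last first.
    exists `|C| => x _; case: ifPn => [/andP[_ h]|_]; last by rewrite normr0.
    by rewrite (le_trans h)// ler_norm.
  apply: measurable_funS (_ : measurable_fun setT _) => //.
  pose fI := f \_ `]a, b[.
  have mfI : measurable_fun setT fI by apply/(measurable_restrictT _ _).1.
  have -> : (fun x => if (a < x < b) && (`|f x| <= C) then f x else 0) =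
      (fun x => if `|fI x| <= C then fI x else 0).
    apply/funext => x; rewrite /fI patchE; have [xab|xab] := boolP (a < x < b).
      by rewrite mem_set//= in_itv/=.
    by rewrite memNset/= ?in_itv/= ?if_same//; exact/negP.
  apply: measurable_fun_ifT => //.
  by apply: measurable_fun_ler => //; exact: measurableT_comp.
move=> [fL [g fg /IH[G CG gG]]].
have [F pF fF] := weak_derivative_prim_ae hchi ab fg (Linfty_restrict fL) (Creg_bmf CG) gG.
by exists F => //; apply/CregS; exists G.
Qed.

Lemma Rintegral_oo_cc a b f : measurable_fun (`]a, b[ : set R) f ->
  \int[lebesgue_measure]_(x in `]a, b[) f x = itg a b f.
Proof.
by move=> mf; rewrite /itg /Rintegral [in RHS]integral_itv_bndoo//; exact/measurable_EFinP.
Qed.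

(** The product rule for [F] times a test function has no boundary terms, as a test function on ]a,
    b[ vanishes at both ends; what remains is the weak identity. *)
Lemma Creg_Winfty n a b f F : a < b -> measurable_fun (`]a, b[ : set R) f -> Creg n a b F ->
  {ae @lebesgue_measure R, forall x, a < x < b -> f x = F x} -> Winfty n `]a, b[ f.
Proof.
move=> ab; elim: n f F => [|n IH] f F mf CF fF.
  have [_ [C FC]] := Creg_bmf CF.
  apply/LinftyP => //; split => //; exists C; apply: ae_S fF => x h /=.
  by rewrite in_itv/= => /[dup] xab /h ->; case/andP: xab => ? ?; apply: FC; rewrite !ltW.
have fL : Linfty `]a, b[ f.
  have [_ [C FC]] := Creg_bmf CF.
  apply/LinftyP => //; split => //; exists C; apply: ae_S fF => x h /=.
  by rewrite in_itv/= => /[dup] xab /h ->; case/andP: xab => ? ?; apply: FC; rewrite !ltW.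
split => //; move/CregS : CF => [G CG pF].
have sub : (`]a, b[ : set R) `<=` `[a, b].
  by move=> x /=; rewrite !in_itv/= => /andP[? ?]; rewrite !ltW.
have [mG GC] := Creg_bmf CG.
have mGo : measurable_fun (`]a, b[ : set R) G by apply: measurable_funS mG.
have WG : Winfty n `]a, b[ G by apply: IH CG _ => //; exact: ae_T.
exists G => //; split.
- exact: Linfty_locally_integrable.
- exact: Linfty_locally_integrable (Winfty_Linfty WG).
move=> phi tphi; have [_ [K [cK KI phiK]]] := tphi.
have [_ phi'b pphi] := test_bmf a b tphi.
have [mphi' _] := phi'b.
have phi0 x : ~ (a < x < b) -> phi x = 0.
  by move=> xab; apply: phiK => /KI; rewrite /= in_itv/=.
have := primM ab (Creg_bmf CG) phi'b pF pphi.
move=> /(_ a b (lexx a) (ltW ab) (lexx b)).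
rewrite !phi0 ?ltxx ?andbF// !mulr0 subr0 itgD; last 2 first.
- by apply/bmf_intg/bmfM; [exact: Creg_bmf CG|exact: prim_bmf pphi].
- by apply/bmf_intg/bmfM => //; exact: prim_bmf (Creg_bmf CG) pF.
have mF : measurable_fun (`[a, b] : set R) F by case: (prim_bmf (Creg_bmf CG) pF).
have mphi : measurable_fun (`[a, b] : set R) phi by case: (prim_bmf phi'b pphi).
have mphio : measurable_fun (`]a, b[ : set R) phi by apply: measurable_funS mphi.
have mphi'o : measurable_fun (`]a, b[ : set R) (derive1 phi) by apply: measurable_funS mphi'.
have mFo : measurable_fun (`]a, b[ : set R) F by apply: measurable_funS mF.
have -> : \int[lebesgue_measure]_(x in `]a, b[) (f x * derive1 phi x) =
    itg a b (fun x => F x * derive1 phi x).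
  rewrite -Rintegral_oo_cc; last exact: measurable_funM.
  rewrite /Rintegral; congr fine; apply: ae_eq_integral => //.
  - by apply/measurable_EFinP; exact: measurable_funM.
  - by apply/measurable_EFinP; exact: measurable_funM.
  - by apply: ae_S fF => x h; rewrite /= in_itv/= => /h ->.
rewrite Rintegral_oo_cc; last exact: measurable_funM.
by move=> /esym/eqP; rewrite addrC addr_eq0 => /eqP.
Qed.

End WeakDerivatives.

Section WeakDerivativesLine.
Context {R : realType}.
Implicit Types (f g phi chi : R -> R) (a b c x m C : R).

Lemma test_segment I phi : test_function I phi -> exists2 m, 0 < m &
  forall x, ~ (- m < x < m) -> phi x = 0 /\ derive1 phi x = 0.
Proof.
move=> [sphi [K [cK _ phi0]]].
have [M [_ MP]] := compact_bounded cK.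
have KM x : K x -> `|x| <= `|M| + 1 by apply: MP; rewrite (le_lt_trans (ler_norm _))// ltrDl.
exists (`|M| + 2); first by rewrite ltr_wpDl.
move=> x xm; have nK z : `|M| + 1 < `|z| -> phi z = 0.
  by move=> h; apply: phi0 => /KM; rewrite leNgt h.
have xM : `|M| + 1 < `|x|.
  rewrite (@lt_le_trans _ _ (`|M| + 2))// ?ltrD2l ?ltr1n// leNgt.
  by apply/negP; rewrite ltr_norml.
split; first exact: nK.
apply: is_derive_uniq (smooth_is_derive 0 x sphi) _.
apply/is_derive_epsP => e e0.
have : \forall s \near x, `|M| + 1 < `|s|.
  have : (`|s| @[s --> x] --> `|x|) by exact: norm_continuous.
  by move=> /cvgr_gt; apply.
by apply: filterS => s sM /=; rewrite (nK _ xM) (nK _ sM) mulr0 !subrr normr0 mulr_ge0// ltW.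
Qed.

Lemma is_weak_derivative_lin f g f' g' c : is_weak_derivative setT f f' ->
  is_weak_derivative setT g g' ->
  is_weak_derivative setT (fun x => f x + c * g x) (fun x => f' x + c * g' x).
Proof.
move=> [lf lf' hf] [lg lg' hg].
have locZ u : locally_integrable setT u -> locally_integrable setT (fun x => c * u x).
  move=> [mu oT iu]; split => //; first exact: measurable_funM.
  move=> K KT cK; have := iu K KT cK; move/lte_mul_pinfty => /(_ `|c|%:E).
  rewrite lee_fin normr_ge0 => /(_ isT isT).
  rewrite -ge0_integralZl//; last 2 first.
  - exact: compact_measurable.
  - apply/measurable_EFinP; apply: measurableT_comp => //.
    by apply: measurable_funS mu.
  by under eq_integral do rewrite -EFinM -normrM.
have [mf _ _] := lf; have [mg _ _] := lg; have [mf' _ _] := lf'; have [mg' _ _] := lg'.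
split.
- exact: locally_integrableD (locZ _ lg).
- exact: locally_integrableD (locZ _ lg').
move=> phi tphi; have [m m0 phi0] := test_segment tphi.
have [bphi bphi' _] := test_bmf (- m) m tphi.
have supp u : \int[lebesgue_measure]_x (u x * phi x) = itg (- m) m (fun x => u x * phi x).
  apply: Rintegral_supp => // x _ xm; rewrite (phi0 x _).1 ?mulr0// => /andP[? ?].
  by apply: xm; rewrite /= in_itv/= !ltW.
have supp' u : \int[lebesgue_measure]_x (u x * derive1 phi x) =
    itg (- m) m (fun x => u x * derive1 phi x).
  apply: Rintegral_supp => // x _ xm; rewrite (phi0 x _).2 ?mulr0// => /andP[? ?].
  by apply: xm; rewrite /= in_itv/= !ltW.
have ii u : locally_integrable setT u -> intg (- m) m u.
  by move=> lu; apply: locally_integrable_intg lu _.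
have dist u v w : intg (- m) m u -> intg (- m) m v -> bmf (- m) m w ->
    itg (- m) m (fun x => (u x + c * v x) * w x) =
    itg (- m) m (fun x => u x * w x) + c * itg (- m) m (fun x => v x * w x).
  move=> iu iv bw; have iuw := intgM_bmf iu bw; have ivw := intgM_bmf iv bw.
  rewrite -itgZ// -itgD//; last exact: intgZ.
  by apply: eq_itg => x _; rewrite mulrDl mulrA.
rewrite supp supp' !dist//; [|exact: ii..].
by rewrite -!supp -!supp' hf// hg// mulrN opprD.
Qed.

Lemma prim_is_weak_derivative f f' : continuous f -> measurable_fun setT f' -> (forall a b, bmf a b f') ->
  (forall a b, prim a b f f') -> is_weak_derivative setT f f'.
Proof.
move=> cf mf' bf' pf.
have loc u : measurable_fun setT u -> (forall a b, bmf a b u) -> locally_integrable setT u.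
  move=> mu bu; split => //; first exact: openT.
  move=> K _ cK; have [M [_ MP]] := compact_bounded cK.
  have KM : K `<=` `[- (`|M| + 1), `|M| + 1].
    move=> x /(MP (`|M| + 1)); rewrite (le_lt_trans (ler_norm _)) ?ltrDl// => /(_ isT).
    by rewrite /= in_itv/= ler_norml.
  have [/integrableP[_]] := bmf_intg (bu (- (`|M| + 1)) (`|M| + 1)).
  apply: le_lt_trans; apply: ge0_subset_integral => //; first exact: compact_measurable.
  by apply/measurable_EFinP; apply: measurableT_comp => //; apply: measurable_funS mu.
split; [|exact: loc|].
  by apply: loc => [|a b]; [exact: continuous_measurable_fun|exact: continuous_bmf].
move=> phi tphi; have [m m0 phi0] := test_segment tphi.
have [bphi bphi' pphi] := test_bmf (- m) m tphi.
rewrite (@Rintegral_supp _ _ `[- m, m])//; last first.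
  move=> x _ xm; rewrite (phi0 x _).2 ?mulr0// => /andP[? ?].
  by apply: xm; rewrite /= in_itv/= !ltW.
rewrite [in RHS](@Rintegral_supp _ _ `[- m, m])//; last first.
  move=> x _ xm; rewrite (phi0 x _).1 ?mulr0// => /andP[? ?].
  by apply: xm; rewrite /= in_itv/= !ltW.
have mm : - m < m by rewrite (@lt_trans _ _ 0)// oppr_lt0.
have := primM mm (bf' _ _) bphi' (pf _ _) pphi.
move=> /(_ _ _ (lexx _) (ltW mm) (lexx _)).
rewrite (phi0 m _).1 ?ltxx ?andbF// (phi0 (- m) _).1 ?ltxx// !mulr0 subr0 itgD; last 2 first.
- exact/bmf_intg/bmfM.
- by apply/bmf_intg/bmfM => //; exact: prim_bmf (bf' _ _) (pf _ _).
by move=> /esym/eqP; rewrite addrC addr_eq0 => /eqP.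
Qed.

Lemma wderivP f : (exists g, is_weak_derivative setT f g) -> is_weak_derivative setT f (wderiv f).
Proof. by move=> [g fg]; rewrite /wderiv; case: xgetP => [h -> //|/(_ g)]. Qed.

End WeakDerivativesLine.

(** * The exponential kernel *)

Section ExponentialKernel.
Context {R : realType}.
Implicit Types (f g h : R -> R) (a b x z : R).

(** Monotone convergence along the segments [-n, n], on which a uniform bound is assumed. *)
Lemma integrable_line g C : measurable_fun setT g ->
  (forall n : nat, intg (- n%:R) n%:R g) ->
  (forall n : nat, itg (- n%:R) n%:R (fun x => `|g x|) <= C) ->
  (@lebesgue_measure R).-integrable setT (EFin \o g) /\ `|\int[leb]_x g x| <= C.
Proof.
move=> mg ig gC.
have mng : measurable_fun setT (fun x => (`|g x|)%:E).
  by apply/measurable_EFinP; apply: measurableT_comp.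
pose B (n : nat) : set R := `[- n%:R, n%:R]%classic.
have line : \bigcup_n B n = setT.
  apply/seteqP; split => // x _; exists (Num.truncn `|x|).+1 => //=.
  by rewrite /B /= in_itv/= -ler_norml ltW// truncnS_gt.
have cvgI : ((\int[leb]_(x in B n) (`|g x|)%:E) @[n --> \oo] -->
    \int[leb]_x (`|g x|)%:E)%E.
  rewrite -line; apply: ge0_nondecreasing_set_cvg_integral => //.
  - move=> m n mn; apply/subsetPset => x; rewrite /B /= !in_itv/= -!ler_norml => h.
    by rewrite (le_trans h)// ler_nat.
  - by move=> n; exact: measurable_itv.
  - by move=> n; apply: measurable_funS mng.
have le : (\int[leb]_x (`|g x|)%:E <= C%:E)%E.
  rewrite -(cvg_lim _ cvgI)//; apply: lime_le; first by apply/cvg_ex; eexists; exact: cvgI.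
  apply: nearW => n; have /(intg_norm) /integrable_fin_num h := ig n.
  rewrite -[X in (X <= _)%E]fineK; last exact: h.
  by rewrite lee_fin; exact: gC.
have Ig : (@lebesgue_measure R).-integrable setT (EFin \o g).
  apply/integrableP; split; first exact/measurable_EFinP.
  exact: le_lt_trans le (ltry _).
split => //; rewrite (le_trans (le_normr_Rintegral _ Ig))//.
by rewrite -lee_fin /Rintegral fineK//; apply: integrable_fin_num => //; exact: integrable_abse Ig.
Qed.

Lemma measurable_sg_sub x : measurable_fun setT (fun z => Num.sg (x - z)).
Proof.
have m1 : measurable_fun setT (fun u : R => Num.sg u).
  apply: nondecreasing_measurable => // u v.
  by case: (sgrP u); case: (sgrP v) => //; lra.
by apply: measurableT_comp => //; exact: measurable_funB.
Qed.

Lemma prim_chain G G' a b f f' : (forall x : R, is_derive x 1 G (G' x)) -> continuous G' ->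
  bmf a b f' -> prim a b f f' ->
  bmf a b (fun x => G' (f x)) /\ prim a b (fun x => G (f x)) (fun x => G' (f x) * f' x).
Proof.
move=> dG cG' bf' pf; have [mf [C fC]] := prim_bmf bf' pf.
have fm x : a <= x <= b -> - `|C| <= f x <= `|C|.
  by move=> /fC fx; rewrite -ler_norml (le_trans fx)// ler_norm.
have [mG' [K G'K]] := continuous_bmf (- `|C|) `|C| cG'.
have mG'f : measurable_fun (`[a, b] : set R) (fun x => G' (f x)).
  by apply: measurableT_comp mf => //; exact: continuous_measurable_fun.
split; first by split=> //; exists K => x /fm; exact: G'K.
move=> x y ax xy yb; move: xy; rewrite le_eqVlt => /predU1P[->|xy].
  by rewrite subrr itgxx.
have ab : a < b by rewrite (le_lt_trans ax)// (lt_le_trans xy).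
apply: (prim_comp_derive ab bf' pf fm (fun x _ => dG x) G'K mG'f) => //; exact: ltW.
Qed.

Lemma continuousT_comp f g : continuous f -> continuous g -> continuous (fun x => g (f x)).
Proof. by move=> cf cg x; apply: (@continuous_comp _ _ _ f g); [exact: cf|exact: cg]. Qed.

Lemma is_derive_expR_affine s p (x : R) :
  is_derive x 1 (fun x => expR (s * (x - p))) (s * expR (s * (x - p))).
Proof.
rewrite mulrC; exact: (@is_derive1_comp _ expR (fun x : R => s * (x - p)) x _ _
  (is_derive_expR _) (is_derive_affine s p x)).
Qed.

Section Kernel.
Variables (y q : R -> R).
Hypotheses (bq : forall a b, bmf a b q) (q0 : forall x, 0 <= q x)
  (yq : forall a b, prim a b y q) (cy : continuous y).

Lemma expR_prim s p a b : bmf a b (fun x => expR (s * (y x - p))) /\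
  prim a b (fun x => expR (s * (y x - p))) (fun x => s * expR (s * (y x - p)) * q x).
Proof.
have cexp (k : R) : continuous (fun x : R => k * expR (s * (x - p))).
  move=> x; apply: cvgM; first exact: cvg_cst.
  exact: is_derive_continuous (is_derive_expR_affine s p x).
have [_ h] := prim_chain (is_derive_expR_affine s p) (cexp s) (bq a b) (@yq a b).
split=> //; apply: continuous_bmf; apply: (@continuousT_comp y (fun u => expR (s * (u - p))) cy) => x.
by have := cexp 1 x; under eq_fun do rewrite mul1r.
Qed.

Definition ker x z : R := expR (- `|y x - y z|).

Lemma kernel_homo a b : a <= b -> y a <= y b.
Proof.
move=> ab; rewrite -subr_ge0 (yq (lexx a) ab (lexx b)).
exact: itg_ge0.
Qed.

Lemma ker_le x z : z <= x -> ker x z = expR (1 * (y z - y x)).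
Proof. by move=> /kernel_homo yzx; rewrite /ker mul1r ger0_norm ?subr_ge0// opprB. Qed.

Lemma ker_ge x z : x <= z -> ker x z = expR (-1 * (y z - y x)).
Proof. by move=> /kernel_homo yzx; rewrite /ker distrC mulN1r ger0_norm ?subr_ge0. Qed.

Lemma ker_continuous x : continuous (ker x).
Proof.
apply: (@continuousT_comp (fun z => - `|y x - y z|)); last exact: continuous_expR.
move=> z; apply: cvgN; apply: (@continuousT_comp (fun z => y x - y z) (fun u => `|u|)).
  by move=> u; apply: cvgB; [exact: cvg_cst|exact: cy].
exact: norm_continuous.
Qed.

Lemma ker_gt0 x z : 0 < ker x z. Proof. exact: expR_gt0. Qed.

Lemma ker_le1 x z : ker x z <= 1.
Proof. by rewrite /ker -expR0 ler_expR oppr_le0. Qed.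

(** In the variable s = y z this is the integral of e^{-|y x - s|} over an interval, so zeros of [q]
    are harmless. On either side of [x] the integrand is, up to sign, an exact derivative, and each
    side contributes at most 1. *)
Lemma kernel_mass x a b : a <= b -> itg a b (fun z => ker x z * q z) <= 2.
Proof.
move=> ab; have bk u v : bmf u v (fun z => ker x z * q z).
  by apply: bmfM => //; exact/continuous_bmf/ker_continuous.
pose a' := Num.min a x; pose b' := Num.max b x.
have a'a : a' <= a by rewrite ge_min lexx.
have bb' : b <= b' by rewrite le_max lexx.
have a'x : a' <= x by rewrite ge_min lexx orbT.
have xb' : x <= b' by rewrite le_max lexx orbT.
have k0 u v : 0 <= itg u v (fun z => ker x z * q z).
  by apply: itg_ge0 => z _; rewrite mulr_ge0// ltW// ker_gt0.
have h : itg a b (fun z => ker x z * q z) <= itg a' b' (fun z => ker x z * q z).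
  rewrite (@itg_cat _ a' a b')//; last 2 first.
  - exact: le_trans ab bb'.
  - exact: bmf_intg.
  rewrite (@itg_cat _ a b b')//; last exact: bmf_intg.
  by rewrite addrCA lerDl addr_ge0.
apply: le_trans h _; rewrite (@itg_cat _ a' x b')//; last exact: bmf_intg.
rewrite (_ : 2 = 1 + 1)// lerD//.
- rewrite (@eq_itg _ _ _ _ (fun z => 1 * expR (1 * (y z - y x)) * q z)); last first.
    by move=> z /andP[_ zx]; rewrite ker_le// !mul1r.
  rewrite -(expR_prim 1 (y x) a' x).2// subrr mulr0 expR0 lerBlDr lerDl.
  exact: expR_ge0.
- rewrite (@eq_itg _ _ _ _ (fun z => -1 * (-1 * expR (-1 * (y z - y x)) * q z))); last first.
    by move=> z /andP[xz _]; rewrite ker_ge//; ring.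
  rewrite itgZ; last first.
    by apply: bmf_intg; apply: bmfM => //; apply: bmfM; [exact: bmf_cst|exact: (expR_prim _ _ _ _).1].
  rewrite -(expR_prim (-1) (y x) x b').2// subrr mulr0 expR0 mulN1r opprB lerBlDr lerDl.
  exact: expR_ge0.
Qed.


End Kernel.

Section KernelBound.
Variables (y q : R -> R) (Z : R).
Hypotheses (bq : forall a b, bmf a b q) (q0 : forall x, 0 <= q x)
  (yq : forall a b, prim a b y q) (cy : continuous y).
Local Notation ker := (ker y).
Hypothesis (yZ : forall x, `|y x - x| <= Z).

Lemma ker_dom x z : ker x z <= expR (2 * Z) * expR (- `|x - z|).
Proof.
rewrite /ker -expRD ler_expR lerNl opprD opprK.
have : `|x - z| <= `|y x - y z| + `|y x - x| + `|y z - z|.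
  have -> : x - z = (y x - y z) - (y x - x) + (y z - z) by ring.
  by rewrite (le_trans (ler_normD _ _))// lerD2r (le_trans (ler_normB _ _)).
have := yZ x; have := yZ z; lra.
Qed.

(** The kernel is used in three ways: mass at most 2 against [q], domination by e^{2 Z} e^{-|x - z|}
    against the constant, and ker <= 1 against [m]. The estimate contains no sup norm of [f]; later
    [m] is h^2, and [s] is 1 or a sign. *)
Lemma kernel_bound (s f m : R -> R) (al be Bm : R) x : measurable_fun setT s -> (forall z, `|s z| <= 1) ->
  measurable_fun setT f -> (forall a b, bmf a b f) ->
  (forall a b, bmf a b m) -> (forall z, 0 <= m z) ->
  (forall n : nat, itg (- n%:R) n%:R m <= Bm) -> 0 <= al -> 0 <= be ->
  (forall z, `|f z| <= al * q z + be * (1 + m z)) ->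
  (@lebesgue_measure R).-integrable setT (fun z => (s z * ker x z * f z)%:E) /\
  `|\int[leb]_z (s z * ker x z * f z)| <= 2 * al + be * (2 * expR (2 * Z) + Bm).
Proof.
move=> ms s1 mf bf bm m0 mB al0 be0 fle.
have bk a b : bmf a b (ker x) by exact/continuous_bmf/ker_continuous.
have bs a b : bmf a b s.
  by split; [apply: measurable_funS ms|exists 1 => z _; exact: s1].
have bg a b : bmf a b (fun z => s z * ker x z * f z) by apply: bmfM => //; exact: bmfM.
have be1 a b : bmf a b (fun z => expR (- `|x - z|)).
  apply: continuous_bmf; apply: (@continuousT_comp (fun z => - `|x - z|)); last exact: continuous_expR.
  move=> z; apply: cvgN; apply: (@continuousT_comp (fun z => x - z) (fun u => `|u|)).
    by move=> u; apply: cvgB; [exact: cvg_cst|exact: cvg_id].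
  exact: norm_continuous.
apply: integrable_line.
- apply: measurable_funM => //; apply: measurable_funM => //.
  by apply: continuous_measurable_fun; exact: ker_continuous.
- by move=> n; exact/bmf_intg.
move=> n; have nn : - n%:R <= n%:R :> R by rewrite ge0_cp.
have i1 : intg (- n%:R) n%:R (fun z => al * (ker x z * q z)) by apply/intgZ/bmf_intg/bmfM.
have i2 : intg (- n%:R) n%:R (fun z => be * expR (2 * Z) * expR (- `|x - z|)).
  exact/intgZ/bmf_intg.
have i3 : intg (- n%:R) n%:R (fun z => be * m z) by exact/intgZ/bmf_intg.
apply: (@le_trans _ _ (itg (- n%:R) n%:R (fun z => al * (ker x z * q z) +
    be * expR (2 * Z) * expR (- `|x - z|) + be * m z))).
  apply: itg_le; [exact/intg_norm/bmf_intg|by apply: intgD => //; exact: intgD|move=> z _].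
  have k0 := ltW (ker_gt0 y x z); have k1 := ker_le1 y x z; have k2 := ker_dom x z.
  rewrite !normrM (ger0_norm k0); apply: (@le_trans _ _ (ker x z * (al * q z + be * (1 + m z)))).
    rewrite -[X in _ <= X]mul1r -mulrA ler_pM// ?mulr_ge0// ler_wpM2l//.
  have : ker x z * (be * m z) <= be * m z by rewrite ler_piMl// mulr_ge0.
  have : be * ker x z <= be * (expR (2 * Z) * expR (- `|x - z|)) by rewrite ler_wpM2l.
  lra.
rewrite itgD//; last exact: intgD.
rewrite itgD// !itgZ//; try (by apply: bmf_intg => //; exact: bmfM).
have h1 := kernel_mass bq q0 yq cy x nn.
have h2 : itg (- n%:R) n%:R (fun z => expR (- `|x - z|)) <= 2.
  have := @kernel_mass id (fun=> 1) (fun a b => bmf_cst a b 1) (fun=> ler01)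
    (@prim_id R) (fun x => cvg_id) x _ _ nn.
  by apply: le_trans; rewrite le_eqVlt; apply/orP; left; apply/eqP/eq_itg => z _; rewrite mulr1.
have h3 := mB n.
have e0 := expR_gt0 (2 * Z).
have j1 : al * itg (- n%:R) n%:R (fun z => ker x z * q z) <= al * 2 by rewrite ler_wpM2l.
have j2 : be * expR (2 * Z) * itg (- n%:R) n%:R (fun z => expR (- `|x - z|)) <= be * expR (2 * Z) * 2.
  by rewrite ler_wpM2l// mulr_ge0// ltW.
have j3 : be * itg (- n%:R) n%:R m <= be * Bm by rewrite ler_wpM2l.
lra.
Qed.

End KernelBound.

Section KernelPrim.
Variables (y q f : R -> R) (Z C : R).
Hypotheses (bq : forall a b, bmf a b q) (q0 : forall x, 0 <= q x)
  (yq : forall a b, prim a b y q) (cy : continuous y)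
  (yZ : forall x, `|y x - x| <= Z) (mf : measurable_fun setT f) (fC : forall x, `|f x| <= C).
Local Notation ker := (ker y).

Let bf a b : bmf a b f.
Proof. by split; [apply: measurable_funS mf|exists C => x _]. Qed.

Let C0 : 0 <= C. Proof. by rewrite (le_trans _ (fC 0)). Qed.

Lemma ker_integrable (s : R -> R) x : measurable_fun setT s -> (forall z, `|s z| <= 1) ->
  (@lebesgue_measure R).-integrable setT (fun z => (s z * ker x z * f z)%:E).
Proof.
move=> ms s1; have [] // := @kernel_bound y q Z bq q0 yq cy yZ s f (fun=> 0) 0 C 0 x.
- by move=> a b; exact: bmf_cst.
- by move=> n; rewrite itg_cst ?mul0r// ge0_cp.
- by move=> z; rewrite mul0r add0r addr0 mulr1.
Qed.

(* Both potentials are controlled by splitting the kernel into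
   e^{-y x} e^{y z} for z <= x and e^{y x} e^{-y z} for z >= x. *)
Definition kerP x : R := \int[leb]_z (ker x z * f z).
Definition kerQ x : R := \int[leb]_z (Num.sg (x - z) * ker x z * f z).

Let e (s z : R) : R := expR (s * (y z - 0)).
Let E1 x : R := \int[leb]_(z in `]-oo, x]) (e 1 z * f z).
Let E2 x : R := \int[leb]_(z in `]x, +oo[) (e (-1) z * f z).

Let kerL x z : z <= x -> ker x z = e (-1) x * e 1 z.
Proof. by move=> zx; rewrite (ker_le q0 yq zx) -expRD; congr expR; ring. Qed.

Let kerR x z : x <= z -> ker x z = e 1 x * e (-1) z.
Proof. by move=> xz; rewrite (ker_ge q0 yq xz) -expRD; congr expR; ring. Qed.

Let ee x : e 1 x * e (-1) x = 1.
Proof. by rewrite -expRD -expR0; congr expR; ring. Qed.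

Let ker_integrable1 x : (@lebesgue_measure R).-integrable setT (fun z => (ker x z * f z)%:E).
Proof.
have := @ker_integrable (fun=> 1) x; rewrite normr1 => /(_ (measurable_cst _) (fun=> lexx _)).
by under eq_fun do rewrite mul1r.
Qed.

Let int1 x : (@lebesgue_measure R).-integrable `]-oo, x] (fun z => (e 1 z * f z)%:E).
Proof.
have h : (@lebesgue_measure R).-integrable `]-oo, x] (fun z => (ker x z * f z)%:E).
  by apply: integrableS (ker_integrable1 x).
apply: eq_integrable (integrableZl _ (e 1 x) h) => // z; rewrite inE/= in_itv/= => zx.
by rewrite -EFinM mulrA kerL// mulrA ee mul1r.
Qed.

Let int2 x : (@lebesgue_measure R).-integrable `]x, +oo[ (fun z => (e (-1) z * f z)%:E).
Proof.
have h : (@lebesgue_measure R).-integrable `]x, +oo[ (fun z => (ker x z * f z)%:E).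
  by apply: integrableS (ker_integrable1 x).
apply: eq_integrable (integrableZl _ (e (-1) x) h) => // z; rewrite inE/= in_itv/= andbT => xz.
by rewrite -EFinM mulrA (kerR (ltW xz)) mulrA [e (-1) x * _]mulrC ee mul1r.
Qed.

Let be' s a b : bmf a b (e s). Proof. exact: (expR_prim bq yq cy s 0 a b).1. Qed.

Let prime s a b : prim a b (e s) (fun x => s * e s x * q x).
Proof. exact: (expR_prim bq yq cy s 0 a b).2. Qed.

Let itg_oc x x' (g : R -> R) : intg x x' g -> \int[leb]_(z in `]x, x']) g z = itg x x' g.
Proof. by move=> ig; rewrite Rintegral_itv_obnd_cbnd//; apply: integrableS ig => //; exact: subset_itv_oc_cc. Qed.

Let primE1 a b : prim a b E1 (fun z => e 1 z * f z).
Proof.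
move=> x x' _ xx' _; rewrite /E1 Rintegral_itvB//; first exact: itg_oc (bmf_intg (bmfM (be' _ _ _) (bf _ _))).
Qed.

Let primE2 a b : prim a b E2 (fun z => - (e (-1) z * f z)).
Proof.
move=> x x' _ xx' _; apply/eqP; rewrite subr_eq addrC; apply/eqP.
have ig := bmf_intg (bmfM (be' (-1) x x') (bf x x')).
have -> : itg x x' (fun z => - (e (-1) z * f z)) = - itg x x' (fun z => e (-1) z * f z).
  by rewrite -[RHS]mulN1r -itgZ//; apply: eq_itg => z _; rewrite mulN1r.
have := @Rintegral_itvB _ (fun z => e (-1) z * f z) (BRight x) +oo%O x' (int2 x).
rewrite !bnd_simp => /(_ xx' isT); rewrite itg_oc// => <-; rewrite /E2; ring.
Qed.

(** One computation for both potentials: the pair (c1, c2) is (1, 1) for [kerP] and (1, -1) for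
    [kerQ]. The point [x], where the sign is 0, is a null set. *)
Let splitS (s : R -> R) x c1 c2 : measurable_fun setT s -> (forall z, `|s z| <= 1) ->
  (forall z, z < x -> s z = c1) -> (forall z, x < z -> s z = c2) ->
  \int[leb]_z (s z * ker x z * f z) = c1 * (e (-1) x * E1 x) + c2 * (e 1 x * E2 x).
Proof.
move=> ms s1 sc1 sc2.
have ik := ker_integrable x ms s1.
rewrite -(setUv (`]-oo, x] : set R)) Rintegral_setU//; last 3 first.
- exact: measurableC.
- by rewrite setUv.
- exact/disj_setPCl.
congr (_ + _).
- rewrite [c1 * _]mulrA -(RintegralZl (c1 * e (-1) x) _ (int1 x))//.
  rewrite /Rintegral; congr fine; apply: ae_eq_integral => //.
  + by apply: measurable_funS (_ : measurable_fun setT _) => //; case/integrableP: ik.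
  + have /integrableP[mi _] := int1 x; apply/measurable_EFinP; apply: measurable_funM => //.
    exact/measurable_EFinP.
  apply: ae_S (ae_neq x) => z zx; rewrite /= in_itv/= => zlex.
  by rewrite sc1 ?lt_neqAle ?zx// kerL// !mulrA.
- rewrite setCitvl [c2 * _]mulrA -(RintegralZl (c2 * e 1 x) _ (int2 x))//.
  apply: eq_Rintegral => z; rewrite inE/= in_itv/= andbT => xz.
  by rewrite sc2// (kerR (ltW xz)) !mulrA.
Qed.

Let kerPE x : kerP x = e (-1) x * E1 x + e 1 x * E2 x.
Proof.
have := @splitS (fun=> 1) x 1 1; rewrite !mul1r => <- //; last by move=> ?; rewrite normr1.
by apply: eq_Rintegral => z _; rewrite mul1r.
Qed.

Let kerQE x : kerQ x = e (-1) x * E1 x - e 1 x * E2 x.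
Proof.
have := @splitS (fun z => Num.sg (x - z)) x 1 (-1); rewrite !mul1r mulN1r; apply.
- exact: measurable_sg_sub.
- by move=> z; rewrite normr_sg; case: (_ != _).
- by move=> z zx; rewrite gtr0_sg// subr_gt0.
- by move=> z zx; rewrite ltr0_sg// subr_lt0.
Qed.

Let prim1 a b : a < b -> prim a b (fun x => e (-1) x * E1 x)
  (fun x => f x - q x * (e (-1) x * E1 x)).
Proof.
move=> ab; have b1 := bmfM (be' 1 a b) (bf a b).
have := primM ab (bmfM (bmfM (bmf_cst a b (-1)) (be' (-1) a b)) (bq a b)) b1 (@prime (-1) a b) (@primE1 a b).
move=> h x y' ax xy yb; rewrite (h _ _ ax xy yb); apply: eq_itg => z _.
by rewrite !mulrA [e (-1) z * _]mulrC ee; ring.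
Qed.

Let prim2 a b : a < b -> prim a b (fun x => e 1 x * E2 x)
  (fun x => q x * (e 1 x * E2 x) - f x).
Proof.
move=> ab; have b2 : bmf a b (fun z => - (e (-1) z * f z)).
  exact/bmfN/bmfM.
have := primM ab (bmfM (bmfM (bmf_cst a b 1) (be' 1 a b)) (bq a b)) b2 (@prime 1 a b) (@primE2 a b).
move=> h x y' ax xy yb; rewrite (h _ _ ax xy yb); apply: eq_itg => z _.
by rewrite mulrN !mulrA ee; ring.
Qed.

Let bE1 a b : bmf a b E1. Proof. exact: prim_bmf (bmfM (be' 1 a b) (bf a b)) (@primE1 a b). Qed.
Let bE2 a b : bmf a b E2.
Proof.
apply: prim_bmf _ (@primE2 a b).
exact/bmfN/bmfM.
Qed.

Lemma kerP_bmf a b : bmf a b kerP.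
Proof.
have : bmf a b (fun x => e (-1) x * E1 x + e 1 x * E2 x) by apply: bmfD; exact: bmfM.
by under eq_fun do rewrite -kerPE.
Qed.

Lemma kerQ_bmf a b : bmf a b kerQ.
Proof.
have : bmf a b (fun x => e (-1) x * E1 x + -1 * (e 1 x * E2 x)).
  by apply: bmfD; [exact: bmfM|apply: bmfM; [exact: bmf_cst|exact: bmfM]].
by under eq_fun do rewrite mulN1r -kerQE.
Qed.

(** Differentiating e^{-y} E1 produces [f] and differentiating e^{y} E2 produces [- f]. The two
    cancel in the sum [kerP], whereas they add up to [2 f] in the difference [kerQ]. *)
Lemma kerP_prim a b : a < b -> prim a b kerP (fun x => - (q x * kerQ x)).
Proof.
move=> ab.
have i1 : intg a b (fun x => f x - q x * (e (-1) x * E1 x)).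
  by apply: intgB; apply: bmf_intg => //; do 2 apply: bmfM => //.
have i2 : intg a b (fun x => q x * (e 1 x * E2 x) - f x).
  by apply: intgB; apply: bmf_intg => //; do 2 apply: bmfM => //.
have h := primD i1 i2 (prim1 ab) (prim2 ab) => x y' ax xy yb.
by rewrite !kerPE (h _ _ ax xy yb); apply: eq_itg => z _; rewrite kerQE; ring.
Qed.

Lemma kerQ_prim a b : a < b -> prim a b kerQ (fun x => 2 * f x - q x * kerP x).
Proof.
move=> ab.
have i1 : intg a b (fun x => f x - q x * (e (-1) x * E1 x)).
  by apply: intgB; apply: bmf_intg => //; do 2 apply: bmfM => //.
have i2 : intg a b (fun x => q x * (e 1 x * E2 x) - f x).
  by apply: intgB; apply: bmf_intg => //; do 2 apply: bmfM => //.
move=> x y' ax xy yb; rewrite !kerQE.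
have h : itg x y' (fun z => 2 * f z - q z * kerP z) =
    itg x y' (fun z => f z - q z * (e (-1) z * E1 z)) -
    itg x y' (fun z => q z * (e 1 z * E2 z) - f z).
  rewrite -itgB; [|exact: intgS i1|exact: intgS i2].
  by apply: eq_itg => z _; rewrite kerPE; ring.
have aux (u1 u2 u3 u4 A B : R) : u1 - u3 = A -> u2 - u4 = B -> u1 - u2 - (u3 - u4) = A - B.
  by move=> <- <-; ring.
by rewrite h; exact: aux (prim1 ab ax xy yb) (prim2 ab ax xy yb).
Qed.

End KernelPrim.

End ExponentialKernel.

(** * The Green function term of P and Q *)

Section GreenFunction.
Context {R : realType}.
Implicit Types (f : R -> R) (a b x : R).

Lemma prim_continuous f f' : (forall a b, bmf a b f') -> (forall a b, prim a b f f') -> continuous f.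
Proof.
move=> bf' pf x; have [K K0 lf] := prim_bmf_lip (bf' (x - 1) (x + 1)) (pf _ _).
apply/cvgrPdist_le => /= e e0; near=> s.
have /ltW sx1 : `|x - s| < 1 by near: s; exact: (@cvgr_dist_lt _ _ _ _ _ id _ cvg_id).
have sx : `|x - s| < e / (K + 1).
  by near: s; apply: (@cvgr_dist_lt _ _ _ _ _ id _ cvg_id); rewrite divr_gt0// ltr_wpDl.
have /(le_trans) : `|f x - f s| <= K * `|x - s|.
  apply: lip_sym lf _ _; first by move: sx1; rewrite ler_norml; lra.
  by rewrite lerBlDr !lerDl ler01.
apply; rewrite (@le_trans _ _ ((K + 1) * (e / (K + 1))))//.
  by apply: ler_pM => //; [lra|exact: ltW].
by rewrite mulrCA divff ?mulr1// gt_eqF// ltr_wpDl.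
Unshelve. all: by end_near. Qed.

Lemma prim_is_derive f f' x : (forall a b, prim a b f f') -> continuous f' ->
  is_derive x 1 f (f' x).
Proof.
move=> pf cf'; apply/is_derive_epsP => e e0.
have : \forall z \near x, `|f' x - f' z| <= e by have /cvgrPdist_le := cf' x; exact.
move=> /nbhs_ballP[d /= d0 hd].
have key u v : u <= v -> (forall z, u <= z <= v -> ball x d z) ->
    `|f v - f u - (v - u) * f' x| <= e * (v - u).
  move=> uv buv; have i1 := bmf_intg (continuous_bmf u v cf').
  rewrite (pf u v u v)// [_ * f' x]mulrC -(itg_cst (f' x) uv) -itgB//; last exact: intg_cst.
  apply: itg_bound => //; first by apply: intgB => //; exact: intg_cst.
  by move=> z zuv; rewrite distrC; exact: hd (buv z zuv).
apply/nbhs_ballP; exists d => //= s; rewrite /ball/= => xs.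
have [sx|xs'] := leP s x.
- have := key s x sx; rewrite ger0_norm ?subr_ge0// in xs.
  rewrite (distrC s x) (ger0_norm (_ : 0 <= x - s)) ?subr_ge0// => h.
  rewrite -normrN (_ : - (f s - f x - (s - x) * f' x) = f x - f s - (x - s) * f' x); last by ring.
  apply: h => z zsx; rewrite /ball/= ger0_norm; lra.
- have := key x s (ltW xs'); rewrite (distrC x s) ger0_norm ?subr_ge0 1?ltW// in xs.
  rewrite (ger0_norm (_ : 0 <= s - x)); last by rewrite subr_ge0 ltW.
  move=> h.
  apply: h => z zsx; rewrite /ball/= distrC ger0_norm; lra.
Qed.

Variable chi : R -> R.
Hypothesis hchi : cutoff chi.

(** This is the second derivative of chi^2. Since convolution with e^{-|x|} / 2 inverts 1 -
    d^2/dx^2, [gfun] solves g - g'' = chi^2; the convolution is [kerP] for y = id and q = 1. *)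
Let kappa z : R := 2 * derive1 chi z ^+ 2 + 2 * chi z * derive1n 2 chi z.

Lemma cutoff_derive2_out x : x < 0 \/ 1 < x -> derive1n 2 chi x = 0.
Proof.
move=> xo; apply: is_derive_uniq (cutoff_derive2 hchi x) _.
apply/is_derive_epsP => e e0.
have : \forall s \near x, s < 0 \/ 1 < s.
  case: xo => x0; [have := lt_nbhsl x0|have := lt_nbhsr x0]; apply: filterS => s; by [left|right].
apply: filterS => s so.
by rewrite !(cutoff_derive_out hchi)// mulr0 !subrr normr0 mulr_ge0// ltW.
Qed.

Let kappa_continuous : continuous kappa.
Proof.
have c0 := cutoff_continuous hchi; have c1 := cutoff_derive_continuous hchi.
have c2 := cutoff_derive2_continuous hchi.
move=> x; apply: cvgD; apply: cvgM.
- exact: cvg_cst.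
- by apply: (@cvgM _ _ _ _ _ _ _ _ _); exact: c1.
- by apply: cvgM; [exact: cvg_cst|exact: c0].
- exact: c2.
Qed.

Let kappa_bounded : exists C, forall x, `|kappa x| <= C.
Proof.
have [_ [C hC]] := continuous_bmf 0 1 kappa_continuous.
exists C => x; have [x0|x0] := ltP x 0; last have [x1|x1] := leP x 1; last 1 first.
- by rewrite /kappa (cutoff_derive_out hchi) ?cutoff_derive2_out//;
    [rewrite expr0n !mulr0 addr0 normr0 (le_trans (normr_ge0 _) (hC 0 _))// lexx ler01|right..].
- rewrite /kappa (cutoff_derive_out hchi) ?cutoff_derive2_out//; [|left..] => //.
  by rewrite expr0n !mulr0 addr0 normr0 (le_trans (normr_ge0 _) (hC 0 _))// lexx ler01.
- by apply: hC; rewrite x0.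
Qed.

Let P1 := @kerP R id kappa.
Let Q1 := @kerQ R id kappa.

Let P1Q1 : (forall a b, bmf a b P1) /\ (forall a b, bmf a b Q1) /\
  (forall x : R, is_derive x 1 P1 (- Q1 x)) /\
  (forall x : R, is_derive x 1 Q1 (2 * kappa x - P1 x)).
Proof.
have [C kC] := kappa_bounded.
have mk : measurable_fun setT kappa by exact: continuous_measurable_fun.
have b1 (a b : R) : bmf a b (fun=> 1) := bmf_cst a b 1.
have i0 (x : R) : `|id x - x| <= 0 by rewrite subrr normr0.
have bP a b : bmf a b P1.
  exact: (@kerP_bmf R id (fun=> 1) kappa 0 C b1 (fun=> ler01) (@prim_id R) (fun x => cvg_id) i0 mk kC).
have bQ a b : bmf a b Q1.
  exact: (@kerQ_bmf R id (fun=> 1) kappa 0 C b1 (fun=> ler01) (@prim_id R) (fun x => cvg_id) i0 mk kC).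
have ex f f' (a b : R) : (a < b -> prim a b f f') -> prim a b f f'.
  move=> h x y ax xy yb; move: xy; rewrite le_eqVlt => /predU1P[->|xy].
    by rewrite subrr itgxx.
  by apply: h => //; [rewrite (le_lt_trans ax)// (lt_le_trans xy)|exact: ltW].
have pP a b : prim a b P1 (fun x => - Q1 x).
  apply: ex => /(@kerP_prim R id (fun=> 1) kappa 0 C b1 (fun=> ler01) (@prim_id R) (fun x => cvg_id) i0 mk kC) h.
  by move=> x y ax xy yb; rewrite (h _ _ ax xy yb); apply: eq_itg => z _; rewrite mul1r.
have pQ a b : prim a b Q1 (fun x => 2 * kappa x - P1 x).
  apply: ex => /(@kerQ_prim R id (fun=> 1) kappa 0 C b1 (fun=> ler01) (@prim_id R) (fun x => cvg_id) i0 mk kC) h.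
  by move=> x y ax xy yb; rewrite (h _ _ ax xy yb); apply: eq_itg => z _; rewrite mul1r.
have cP : continuous P1 by apply: prim_continuous pP => a b; exact: bmfN.
have cQ : continuous Q1.
  apply: prim_continuous pQ => a b; apply: bmfD; last exact: bmfN.
  by apply: bmfM; [exact: bmf_cst|exact: continuous_bmf].
split=> //; split=> //; split=> x.
- by apply: (prim_is_derive _ pP) => z; apply: cvgN; exact: cQ.
- apply: (prim_is_derive _ pQ) => z; apply: cvgB; last exact: cP.
  by apply: cvgM; [exact: cvg_cst|exact: kappa_continuous].
Qed.

Let gfunE : gfun chi = fun x => chi x ^+ 2 + 2^-1 * P1 x.
Proof. by []. Qed.

Let gfunE2 : gfun chi = chi * chi + 2^-1 \*: P1.
Proof. by apply/funext => x; rewrite gfunE expr2. Qed.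

Let g1 x : R := 2 * (chi x * derive1 chi x) - 2^-1 * Q1 x.

Let is_derive_gfun1 x : is_derive x 1 (gfun chi) (g1 x).
Proof.
have [_ [_ [dP _]]] := P1Q1; rewrite gfunE2.
have h := is_deriveD (is_deriveM (cutoff_derive hchi x) (cutoff_derive hchi x)) (is_deriveZ 2^-1 (dP x)).
by apply: is_derive_eq h _; rewrite /g1 /GRing.scale/=; ring.
Qed.

Let derive1_gfun : derive1 (gfun chi) = g1.
Proof.
by apply/funext => x; rewrite derive1E; have [_ ->] := is_derive_gfun1 x.
Qed.

Lemma is_derive_gfun x : is_derive x 1 (gfun chi) (derive1 (gfun chi) x).
Proof. by rewrite derive1_gfun; exact: is_derive_gfun1. Qed.

Lemma is_derive_gfun' x : is_derive x 1 (derive1 (gfun chi)) (gfun chi x - chi x ^+ 2).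
Proof.
have [_ [_ [_ dQ]]] := P1Q1; rewrite derive1_gfun.
have h := is_deriveB (is_deriveZ 2 (is_deriveM (cutoff_derive hchi x) (cutoff_derive2 hchi x)))
  (is_deriveZ 2^-1 (dQ x)).
by apply: is_derive_eq h _; rewrite gfunE /kappa /GRing.scale/=; field.
Qed.

Lemma gfun_continuous : continuous (gfun chi).
Proof. by move=> x; exact: is_derive_continuous (is_derive_gfun x). Qed.

Lemma derive1_gfun_continuous : continuous (derive1 (gfun chi)).
Proof. by move=> x; exact: is_derive_continuous (is_derive_gfun' x). Qed.

End GreenFunction.

(** * Lagrangian dynamics *)

Section LagrangianRepresentatives.
Context {R : realType}.
Implicit Types (f g : R -> R) (a b x : R).

Lemma ae_line (P : R -> Prop) :
  (forall n : nat, {ae @lebesgue_measure R, forall x, - n%:R <= x <= n%:R -> P x}) ->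
  {ae @lebesgue_measure R, forall x, P x}.
Proof.
move=> h; have := ae_foralln h; apply: ae_S => x hx.
by apply: (hx (Num.truncn `|x|).+1); rewrite -ler_norml ltW// truncnS_gt.
Qed.

Lemma Linfty_bounded f : Linfty setT f -> measurable_fun setT f /\
  exists C : R, {ae @lebesgue_measure R, forall x, `|f x| <= C}.
Proof.
move=> /(LinftyP _ (measurableT))[mf [C fC]]; split => //; exists C.
by apply: ae_S fC => x; apply.
Qed.

(** A violation at one point would persist on a neighbourhood, which has positive measure. *)
Lemma continuous_ae_le f C : continuous f -> {ae @lebesgue_measure R, forall x, `|f x| <= C} ->
  forall x, `|f x| <= C.
Proof.
move=> cf fC x; rewrite leNgt; apply/negP => Cf.
have : \forall z \near x, C < `|f z|.
  have /cvgr_gt : `|f z| @[z --> x] --> `|f x| by apply: cvg_norm; exact: cf.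
  exact.
move=> /nbhs_ballP[d /= d0 hd].
have xd : x < x + d / 2 by rewrite ltrDl divr_gt0.
have [z zx] := @ae_ex R x (x + d / 2) (fun z => `|f z| <= C) xd (ae_S (fun z h _ => h) fC).
rewrite leNgt => /negP; apply; apply: hd; rewrite /ball/= ltr_norml; lra.
Qed.

Variable chi : R -> R.
Hypothesis hchi : cutoff chi.

Lemma weak_derivative_unique f g g' : continuous f -> is_weak_derivative setT f g ->
  is_weak_derivative setT f g' -> {ae @lebesgue_measure R, forall x, g x = g' x}.
Proof.
move=> cf fg fg'; apply: ae_line => n.
have [i p] := weak_derivative_continuous (- n%:R) n%:R hchi fg cf erefl.
have [i' p'] := weak_derivative_continuous (- n%:R) n%:R hchi fg' cf erefl.
exact: prim_unique i i' p p'.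
Qed.

Lemma wderiv_prim f a b : continuous f -> (exists g, is_weak_derivative setT f g) ->
  intg a b (wderiv f) /\ prim a b f (wderiv f).
Proof. by move=> cf /wderivP fg; exact: weak_derivative_continuous hchi fg cf erefl. Qed.

Lemma Winfty1_wderiv f : continuous f -> Winfty 1 setT f ->
  [/\ forall x a b, intg a b (wderiv f) /\ prim a b f (wderiv f),
   measurable_fun setT (wderiv f), exists C : R, forall x, `|f x| <= C &
   exists C : R, {ae @lebesgue_measure R, forall x, `|wderiv f x| <= C}].
Proof.
move=> cf [/Linfty_bounded[_ [C fC]] [g fg /Linfty_bounded[mg [C' gC]]]].
have ex : exists g, is_weak_derivative setT f g by exists g.
have fw := wderivP ex; split.
- by move=> _ a b; exact: wderiv_prim.
- by have [_ [] ] := fw.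
- by exists C; exact: continuous_ae_le.
- by exists C'; apply: ae_S2 gC (weak_derivative_unique cf fg fw) => x h <-.
Qed.

Lemma id_weak_derivative : is_weak_derivative setT (@id R) (fun=> 1).
Proof.
apply: prim_is_weak_derivative => //.
- by move=> x; exact: cvg_id.
- by move=> a b; exact: (bmf_cst a b 1).
- by move=> a b; exact: prim_id.
Qed.

(* Representatives of (y_xi, U_xi, h, rbar) for which the relations defining
   calG hold everywhere. *)
Record lagrangian_repr (X : lagrangian R) (q v h r : R -> R) : Prop := {
  repr_measurable : [/\ measurable_fun setT q, measurable_fun setT v,
    measurable_fun setT h & measurable_fun setT r] ;
  repr_measurable0 : [/\ measurable_fun setT (y_xi X), measurable_fun setT (U_xi X),
    measurable_fun setT (lh X) & measurable_fun setT (rbar X)] ;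
  repr_bounded : exists C : R, forall x,
    [/\ `|q x| <= C, `|v x| <= C, `|h x| <= C & `|r x| <= C] ;
  repr_q_ge0 : forall x, 0 <= q x ;
  repr_h_ge0 : forall x, 0 <= h x ;
  repr_qh : forall x, q x * h x = v x ^+ 2 + r x ^+ 2 ;
  repr_y_xi : {ae @lebesgue_measure R, forall x, q x = y_xi X x} ;
  repr_U_xi : {ae @lebesgue_measure R, forall x, v x = U_xi X x} ;
  repr_lh : {ae @lebesgue_measure R, forall x, h x = lh X x} ;
  repr_rbar : {ae @lebesgue_measure R, forall x, r x = rbar X x} ;
  repr_y_prim : forall a b, prim a b (ly X) q ;
  repr_U_prim : forall a b, prim a b (lU X) v ;
  repr_y_continuous : continuous (ly X) ;
  repr_U_continuous : continuous (lU X) ;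
  repr_zeta_bounded : exists Z : R, forall x, `|ly X x - x| <= Z ;
  repr_U_bounded : exists Z : R, forall x, `|lU X x| <= Z }.

Lemma calG_repr X : calG chi X -> exists q v h r, lagrangian_repr X q v h r.
Proof.
move=> [[[cz _ _] [c [cU _ _]] _ _] [Wz WU] [Lh Lr] G].
have cU' : continuous (lU X).
  move=> x; rewrite (_ : lU X = fun x => (lU X x - c * chi x) + c * chi x); last first.
    by apply/funext => z; rewrite subrK.
  apply: cvgD; first exact: cU.
  by apply: cvgM; [exact: cvg_cst|exact: cutoff_continuous].
have cy : continuous (ly X).
  by move=> x; apply: cvgD; [exact: cvg_id|exact: cz].
have [_ [Z zZ]] := Linfty_bounded Wz.1.
have {}zZ := continuous_ae_le cz zZ.
have [_ [gz zgz /Linfty_bounded[mgz [Cz gzC]]]] := Wz.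
have ygz : is_weak_derivative setT (ly X) (fun x => 1 + 1 * gz x).
  have -> : ly X = fun x => x + 1 * zeta X x by apply/funext => x; rewrite mul1r.
  exact: is_weak_derivative_lin id_weak_derivative zgz.
have yw : is_weak_derivative setT (ly X) (y_xi X) by apply: wderivP; eexists; exact: ygz.
have yae := weak_derivative_unique cy yw ygz.
have [pU mU [CU UC] [CU' UxC]] := Winfty1_wderiv cU' WU.
have [mh [Ch hC]] := Linfty_bounded Lh.
have [mr [Cr rC]] := Linfty_bounded Lr.
have mq : measurable_fun setT (y_xi X) by case: yw => _ [].
have mrb : measurable_fun setT (rbar X).
  by apply: measurable_funB => //; exact: measurable_funM.
pose C := 1 + `|Cz| + (`|CU'| + (`|Ch| + (`|Cr| + `|lk X| * (1 + `|Cz|)))).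
have [N [mN N0 hN]] : {ae @lebesgue_measure R, forall x,
    [/\ `|y_xi X x| <= C, `|U_xi X x| <= C, `|lh X x| <= C & `|rbar X x| <= C] /\
    [/\ 0 <= y_xi X x, 0 <= lh X x &
            y_xi X x * lh X x = U_xi X x ^+ 2 + rbar X x ^+ 2]}.
  have yC : {ae @lebesgue_measure R, forall x, `|y_xi X x| <= 1 + `|Cz|}.
    apply: ae_S2 yae gzC => x -> hg; rewrite (le_trans (ler_normD _ _))// normr1 mul1r lerD2l.
    by rewrite (le_trans hg)// ler_norm.
  have k0 : 0 <= `|lk X| * (1 + `|Cz|) by rewrite mulr_ge0// addr_ge0.
  have hs := ae_S2 (fun x (p : _ /\ _) (p' : _ /\ _) => conj p p')
    (ae_S2 (fun x p p' => conj p p') yC UxC) (ae_S2 (fun x p p' => conj p p') hC rC).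
  apply: ae_S2 G hs => x [q0 h0 _ qh] [[hy hu] [hh hr]]; split; split=> //.
  - by have := normr_ge0 Cr; have := normr_ge0 Ch; have := normr_ge0 CU'; rewrite /C; lra.
  - by have := normr_ge0 Cr; have := normr_ge0 Ch; have := normr_ge0 Cz; have := ler_norm CU'; rewrite /C; lra.
  - by have := normr_ge0 Cr; have := normr_ge0 CU'; have := normr_ge0 Cz; have := ler_norm Ch; rewrite /C; lra.
  - have : `|rbar X x| <= `|Cr| + `|lk X| * (1 + `|Cz|).
      rewrite (le_trans (ler_normB _ _))// lerD//; first exact: le_trans hr (ler_norm _).
      by rewrite normrM ler_wpM2l.
    by have := normr_ge0 Ch; have := normr_ge0 CU'; have := normr_ge0 Cz; rewrite /C; lra.
(* On the exceptional null set all four functions are set to 0, values that satisfy the sign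
   conditions and q h = v^2 + r^2. *)
pose cut (f : R -> R) := f \_ (~` N).
have mcut f : measurable_fun setT f -> measurable_fun setT (cut f).
  move=> mf; apply/(measurable_restrictT _ (measurableC mN)) => //.
  exact: measurable_funS mf.
have good x : ~ N x -> [/\ `|y_xi X x| <= C, `|U_xi X x| <= C, `|lh X x| <= C & `|rbar X x| <= C] /\
    [/\ 0 <= y_xi X x, 0 <= lh X x &
            y_xi X x * lh X x = U_xi X x ^+ 2 + rbar X x ^+ 2].
  by move=> nNx; apply: contrapT => /hN.
have aecut f : {ae @lebesgue_measure R, forall x, cut f x = f x}.
  exists N; split => // x /= h; apply: contrapT => nNx; apply: h.
  by rewrite /cut patchE ifT// inE.
have cutP x : N x /\ (forall f, cut f x = 0) \/ ~ N x /\ (forall f, cut f x = f x).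
  have [Nx|nNx] := pselect (N x); [left|right]; split=> // f; rewrite /cut patchE.
    by rewrite ifF//; apply/negbTE; rewrite notin_setE /= => h; exact: h.
  by rewrite ifT// inE.
have C0 : 0 <= C by rewrite /C !addr_ge0// mulr_ge0// addr_ge0.
exists (cut (y_xi X)), (cut (U_xi X)), (cut (lh X)), (cut (rbar X)); split; try exact: aecut.
- by split; exact: mcut.
- by split.
- exists C => x; have [[_ E]|[nN E]] := cutP x; rewrite !E ?normr0//.
  by case: (good x nN).
- move=> x; have [[_ E]|[nN E]] := cutP x; rewrite E//.
  by case: (good x nN) => _ [].
- move=> x; have [[_ E]|[nN E]] := cutP x; rewrite E//.
  by case: (good x nN) => _ [].
- move=> x; have [[_ E]|[nN E]] := cutP x; rewrite !E ?mulr0 ?expr0n ?addr0//.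
  by case: (good x nN) => _ [].
- move=> a b; have [i p] := @wderiv_prim (ly X) a b cy (ex_intro _ _ ygz).
  apply: prim_aeq i _ _ p; first by apply: measurable_funS (mcut _ mq).
  by apply: ae_S (aecut (y_xi X)) => x -> _.
- move=> a b; have [i p] := pU 0 a b.
  apply: prim_aeq i _ _ p; first by apply: measurable_funS (mcut _ mU).
  by apply: ae_S (aecut (U_xi X)) => x -> _.
- exact: cy.
- exact: cU'.
- by exists Z => x; rewrite /ly addrC addKr.
- by exists CU.
Qed.

Section Repr.
Variables (X : lagrangian R) (q v h r : R -> R).
Hypothesis HX : lagrangian_repr X q v h r.

Let bddm f C : measurable_fun setT f -> (forall x, `|f x| <= C) -> forall a b, bmf a b f.
Proof. by move=> mf fC a b; split; [apply: measurable_funS mf|exists C => x _]. Qed.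

Lemma repr_bmf : [/\ forall a b, bmf a b q, forall a b, bmf a b v,
  forall a b, bmf a b h & forall a b, bmf a b r].
Proof.
have [[mq mv mh mr] _ [C hC] _ _ _ _ _ _ _ _ _ _ _ _ _] := HX.
by split; apply: (@bddm _ C) => // x; case: (hC x).
Qed.

Lemma chi_y_continuous : continuous (fun x => chi (ly X x)).
Proof. exact: continuousT_comp (repr_y_continuous HX) (cutoff_continuous hchi). Qed.

Lemma Ubar_continuous : continuous (Ubar chi X).
Proof.
move=> x; apply: cvgB; first exact: (repr_U_continuous HX).
by apply: cvgM; [exact: cvg_cst|exact: chi_y_continuous].
Qed.

Definition density x : R :=
  (2 * Ubar chi X x ^+ 2 + 4 * lc chi X * Ubar chi X x * chi (ly X x)) * q x
  + 2 * lk X * r x + h x.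

Let coef_continuous : continuous (fun x => 2 * Ubar chi X x ^+ 2 + 4 * lc chi X * Ubar chi X x * chi (ly X x)).
Proof.
have cU := Ubar_continuous; move=> x.
apply: cvgD; apply: cvgM => //; try exact: chi_y_continuous.
- exact: cvg_cst.
- by apply: cvgM; exact: cU.
- by apply: cvgM; [exact: cvg_cst|exact: cU].
Qed.

Lemma measurable_density : measurable_fun setT density.
Proof.
have [mq mv mh mr] := repr_measurable HX.
apply: measurable_funD => //; apply: measurable_funD; apply: measurable_funM => //.
exact: continuous_measurable_fun coef_continuous.
Qed.

Let measurable_PQ_density : measurable_fun setT (PQ_density chi X).
Proof.
have [mq mv mh mr] := repr_measurable0 HX.
apply: measurable_funD => //; apply: measurable_funD; apply: measurable_funM => //.
exact: continuous_measurable_fun coef_continuous.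
Qed.

Let density_ae : {ae @lebesgue_measure R, forall x, density x = PQ_density chi X x}.
Proof.
apply: ae_S3 (repr_y_xi HX) (repr_lh HX) (repr_rbar HX) => x.
by rewrite /density /PQ_density => -> -> ->.
Qed.

Let integral_density (w : R -> R) : measurable_fun setT w ->
  \int[leb]_z (w z * PQ_density chi X z) = \int[leb]_z (w z * density z).
Proof.
move=> mw; have md := measurable_density.
rewrite /Rintegral; congr fine; apply: ae_eq_integral => //.
- by apply/measurable_EFinP; exact: measurable_funM.
- by apply/measurable_EFinP; exact: measurable_funM.
- by apply: ae_S density_ae => z -> _.
Qed.

Lemma Pfun_kerP x : Defs.Pfun chi X x = 4^-1 * kerP (ly X) density x
  + lc chi X ^+ 2 * gfun chi (ly X x) + 2^-1 * lk X ^+ 2.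
Proof.
rewrite /Defs.Pfun integral_density//; apply: continuous_measurable_fun.
exact: ker_continuous (repr_y_continuous HX) x.
Qed.

Lemma Qfun_kerQ x : Qfun chi X x = - 4^-1 * kerQ (ly X) density x
  + lc chi X ^+ 2 * derive1 (gfun chi) (ly X x).
Proof.
rewrite /Qfun integral_density//; apply: measurable_funM; first exact: measurable_sg_sub.
apply: continuous_measurable_fun; exact: ker_continuous (repr_y_continuous HX) x.
Qed.

Let r_le x : `|r x| <= (q x + h x) / 2.
Proof.
have q0 := repr_q_ge0 HX x; have h0 := repr_h_ge0 HX x; have qh := repr_qh HX x.
rewrite -(@ler_pXn2r _ 2)// ?nnegrE ?normr_ge0 ?divr_ge0 ?addr_ge0//.
by rewrite real_normK ?num_real//; have := sqr_ge0 (v x); have := sqr_ge0 (q x - h x); nra.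
Qed.

(** This is the shape that [kernel_bound] takes, with m = h^2. The constraint gives |r| <= (q + h) /
    2, and the remaining linear [h] is absorbed by h <= 1 + h^2, because over a time interval [h] is
    so far controlled only in L^2. *)
Lemma density_le CU x : `|Ubar chi X x| <= CU ->
  `|density x| <= (2 * CU ^+ 2 + 4 * `|lc chi X| * CU + `|lk X|) * q x
    + (1 + `|lk X|) * (1 + h x ^+ 2).
Proof.
move=> UC; have q0 := repr_q_ge0 HX x; have h0 := repr_h_ge0 HX x.
have chi0 := cutoff_ge0 hchi (ly X x); have chi1 := cutoff_le1 hchi (ly X x).
have CU0 : 0 <= CU := le_trans (normr_ge0 _) UC.
have h1 : `|2 * Ubar chi X x ^+ 2 + 4 * lc chi X * Ubar chi X x * chi (ly X x)| <=
   2 * CU ^+ 2 + 4 * `|lc chi X| * CU.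
  rewrite (le_trans (ler_normD _ _))// lerD//.
    by rewrite normrM normrX ger0_norm// ler_wpM2l// lerXn2r// nnegrE.
  rewrite !normrM (ger0_norm chi0) (ger0_norm (_ : 0 <= 4))// -[leRHS]mulr1.
  by rewrite ler_pM// ?mulr_ge0// ler_wpM2l// mulr_ge0.
have h2 : `|2 * lk X * r x| <= `|lk X| * (q x + h x).
  rewrite !normrM (ger0_norm (_ : 0 <= 2))//.
  have := ler_wpM2l (normr_ge0 (lk X)) (r_le x); lra.
have h3 : h x <= 1 + h x ^+ 2 by have := sqr_ge0 (h x - 1); nra.
rewrite /density (le_trans (ler_normD _ _))// (ger0_norm h0).
have := ler_normD ((2 * Ubar chi X x ^+ 2 + 4 * lc chi X * Ubar chi X x * chi (ly X x)) * q x) (2 * lk X * r x).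
rewrite [X in _ <= X + _]normrM (ger0_norm q0).
have := ler_wpM2r q0 h1; have := ler_wpM2l (normr_ge0 (lk X)) h3; lra.
Qed.

Lemma density_bounded : exists C : R, forall x, `|density x| <= C.
Proof.
have [C hC] := repr_bounded HX; have [CU hU] := repr_U_bounded HX.
have UC x : `|Ubar chi X x| <= CU + `|lc chi X|.
  rewrite (le_trans (ler_normB _ _))// lerD// normrM -[leRHS]mulr1 ler_wpM2l//.
  by rewrite ger0_norm; [exact: cutoff_le1|exact: cutoff_ge0].
set CU' := CU + _ in UC; exists ((2 * CU' ^+ 2 + 4 * `|lc chi X| * CU' + `|lk X|) * C
    + (1 + `|lk X|) * (1 + C ^+ 2)) => x.
have CU0 : 0 <= CU' := le_trans (normr_ge0 _) (UC 0).
have [hq _ hh _] := hC x; have C0 := le_trans (normr_ge0 _) hq.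
rewrite (le_trans (density_le (UC x)))// lerD//.
- rewrite ler_wpM2l// ?(le_trans (ler_norm _) hq)//.
  by rewrite !addr_ge0// !mulr_ge0// exprn_ge0.
- by rewrite ler_wpM2l ?addr_ge0// lerD2l -real_normK ?num_real// lerXn2r// nnegrE.
Qed.

(** For Q_xi the local terms recombine through g'' = g - chi^2 and U^2 = Ubar^2 + 2 c Ubar chi + c^2
    chi^2; the non-differentiated kernel integral reappears as P. *)
Lemma PQ_prim a b : a < b ->
  [/\ bmf a b (Defs.Pfun chi X), bmf a b (Qfun chi X),
    prim a b (Defs.Pfun chi X) (fun x => Qfun chi X x * q x) &
    prim a b (Qfun chi X) (fun x => - (2^-1 * h x + lk X * r x +
      (lU X x ^+ 2 + 2^-1 * lk X ^+ 2 - Defs.Pfun chi X x) * q x))].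
Proof.
move=> ab; have [bq bv bh br] := repr_bmf; have [C dC] := density_bounded.
have [Z yZ] := repr_zeta_bounded HX.
have q0 := repr_q_ge0 HX; have yq := repr_y_prim HX; have cy := repr_y_continuous HX.
have md := measurable_density.
have bd : bmf a b density by exact: bddm md dC a b.
have bP := kerP_bmf bq q0 yq cy yZ md dC a b.
have bQ := kerQ_bmf bq q0 yq cy yZ md dC a b.
have pP := kerP_prim bq q0 yq cy yZ md dC ab.
have pQ := kerQ_prim bq q0 yq cy yZ md dC ab.
have [bg pg] := prim_chain (is_derive_gfun hchi) (derive1_gfun_continuous hchi) (bq a b) (yq a b).
have cg2 : continuous (fun x => gfun chi x - chi x ^+ 2).
  have c0 := cutoff_continuous hchi.
  move=> x; apply: cvgB; first exact: (gfun_continuous hchi).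
  by apply: cvgM; exact: c0.
have [bg2 pg2] := prim_chain (is_derive_gfun' hchi) cg2 (bq a b) (yq a b).
have bg0 : bmf a b (fun x => gfun chi (ly X x)) by apply: prim_bmf pg; exact: bmfM.
have bc := bmf_cst a b.
have PE : Defs.Pfun chi X = fun x => 4^-1 * kerP (ly X) density x
  + lc chi X ^+ 2 * gfun chi (ly X x) + 2^-1 * lk X ^+ 2 by apply/funext => x; exact: Pfun_kerP.
have QE : Qfun chi X = fun x => - 4^-1 * kerQ (ly X) density x
  + lc chi X ^+ 2 * derive1 (gfun chi) (ly X x) by apply/funext => x; exact: Qfun_kerQ.
split.
- by rewrite PE; apply: bmfD => //; apply: bmfD; exact: bmfM.
- by rewrite QE; apply: bmfD; exact: bmfM.
- have i1 : intg a b (fun x => 4^-1 * - (q x * kerQ (ly X) density x)).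
    by apply: bmf_intg; apply: bmfM => //; apply: bmfN; exact: bmfM.
  have i2 : intg a b (fun x => lc chi X ^+ 2 * (derive1 (gfun chi) (ly X x) * q x)).
    by apply: bmf_intg; apply: bmfM => //; exact: bmfM.
  move=> x z ax xz zb; rewrite !Pfun_kerP.
  rewrite (@eq_itg _ _ _ _ (fun x => 4^-1 * - (q x * kerQ (ly X) density x) +
    lc chi X ^+ 2 * (derive1 (gfun chi) (ly X x) * q x))); last first.
    move=> u _; rewrite Qfun_kerQ.
    by move: (kerQ _ _ _) (derive1 _ _) => A B; ring.
  rewrite itgD; [|exact: intgS i1|exact: intgS i2].
  have j1 : intg x z (fun x => - (q x * kerQ (ly X) density x)).
    by apply: bmf_intg; apply: bmfS ax zb _; apply: bmfN; exact: bmfM.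
  have j2 : intg x z (fun x => derive1 (gfun chi) (ly X x) * q x).
    by apply: bmf_intg; apply: bmfS ax zb _; exact: bmfM.
  rewrite !itgZ// -(pP x z ax xz zb) -(pg x z ax xz zb).
  move: (kerP _ _ z) (kerP _ _ x) (gfun _ (ly X z)) (gfun _ (ly X x)) => A B C' D; ring.
- have j1 : intg a b (fun x => 2 * density x - q x * kerP (ly X) density x).
    by apply: intgB; apply: bmf_intg; exact: bmfM.
  have j2 : intg a b (fun x => (gfun chi (ly X x) - chi (ly X x) ^+ 2) * q x).
    by apply: bmf_intg; exact: bmfM.
  move=> x z ax xz zb.
  rewrite (@eq_itg _ _ _ _ (fun x => - 4^-1 * (2 * density x - q x * kerP (ly X) density x) +
    lc chi X ^+ 2 * ((gfun chi (ly X x) - chi (ly X x) ^+ 2) * q x))); last first.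
    move=> u _; rewrite Pfun_kerP.
    move: (kerP _ _ _) (gfun _ _) => A B; rewrite /density /Ubar; by field.
  have k1 := intgS ax zb j1; have k2 := intgS ax zb j2.
  rewrite itgD; [|exact: intgZ|exact: intgZ].
  rewrite !itgZ// -(pQ x z ax xz zb) -(pg2 x z ax xz zb) !Qfun_kerQ.
  move: (kerQ _ _ z) (kerQ _ _ x) (derive1 _ (ly X z)) (derive1 _ (ly X x)) => A B C' D; ring.
Qed.

End Repr.

(** The constant is chosen before the state [X], so that a single one serves all times of a
    trajectory. The restriction |x| <= M keeps y x in a compact set, on which [gfun] and its
    derivative are bounded. *)
Lemma PQ_bounded (k c CU Z B M : R) : exists K : R, forall X q v h r,
  lagrangian_repr X q v h r -> lk X = k -> lc chi X = c ->
  (forall x, `|Ubar chi X x| <= CU) -> (forall x, `|ly X x - x| <= Z) ->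
  (forall n : nat, itg (- n%:R) n%:R (fun x => h x ^+ 2) <= B) ->
  forall x, `|x| <= M -> `|Defs.Pfun chi X x| <= K /\ `|Qfun chi X x| <= K.
Proof.
have [_ [G hG]] := continuous_bmf (- (M + Z)) (M + Z) (gfun_continuous hchi).
have [_ [G' hG']] := continuous_bmf (- (M + Z)) (M + Z) (derive1_gfun_continuous hchi).
pose D := 2 * (2 * CU ^+ 2 + 4 * `|c| * CU + `|k|) + (1 + `|k|) * (2 * expR (2 * Z) + B).
exists (4^-1 * D + c ^+ 2 * (`|G| + `|G'|) + 2^-1 * k ^+ 2) => X q v h r HX kX cX UC yZ hB x xM.
rewrite -[in c ^+ 2]cX -[in k ^+ 2]kX.
have [bq bv bh br] := repr_bmf HX.
have q0 := repr_q_ge0 HX; have yq := repr_y_prim HX; have cy := repr_y_continuous HX.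
have bd : forall a b, bmf a b (density X q h r).
  have [C dC] := density_bounded HX => a b.
  by split; [apply: measurable_funS (measurable_density HX)|exists C => z _].
have CU0 : 0 <= CU := le_trans (normr_ge0 _) (UC 0).
have bh2 a b : bmf a b (fun x => h x ^+ 2).
  by rewrite (_ : (fun x => _) = fun x => h x * h x); [exact: bmfM|apply/funext => z; rewrite expr2].
have kb (s : R -> R) : measurable_fun setT s -> (forall z, `|s z| <= 1) ->
    `|\int[leb]_z (s z * ker (ly X) x z * density X q h r z)| <= D.
  move=> ms s1; rewrite /D -kX -cX.
  have [] // := @kernel_bound R (ly X) q Z bq q0 yq cy yZ s (density X q h r)
    (fun x => h x ^+ 2) (2 * CU ^+ 2 + 4 * `|lc chi X| * CU + `|lk X|) (1 + `|lk X|) B x ms s1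
    (measurable_density HX) bd bh2.
  - by move=> z; exact: sqr_ge0.
  - by rewrite !addr_ge0// !mulr_ge0// exprn_ge0.
  - by move=> z; exact: (density_le HX).
have yM : - (M + Z) <= ly X x <= M + Z.
  have := yZ x; rewrite -ler_norml; move: xM; rewrite !ler_norml; lra.
have gG := hG _ yM; have gG' := hG' _ yM.
have c2 : 0 <= lc chi X ^+ 2 := sqr_ge0 _; have k2 : 0 <= lk X ^+ 2 := sqr_ge0 _.
split.
- rewrite (Pfun_kerP HX).
  have hP : `|kerP (ly X) (density X q h r) x| <= D.
    have := kb (fun=> 1) (measurable_cst _) (fun=> _); rewrite normr1 => /(_ (fun=> lexx _)).
    by under eq_Rintegral do rewrite mul1r.
  rewrite (le_trans (ler_normD _ _))// (le_trans (lerD (ler_normD _ _) (lexx _)))//.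
  rewrite [`|4^-1 * _|]normrM [`|lc chi X ^+ 2 * _|]normrM [`|2^-1 * _|]normrM (ger0_norm (_ : 0 <= 4^-1))// (ger0_norm c2) (ger0_norm k2) (ger0_norm (_ : 0 <= 2^-1))//.
  have := ler_wpM2l c2 (le_trans gG (ler_norm G)); have := mulr_ge0 c2 (normr_ge0 G').
  move: hP; lra.
- rewrite (Qfun_kerQ HX).
  have hQ : `|kerQ (ly X) (density X q h r) x| <= D.
    apply: kb; first exact: measurable_sg_sub.
    by move=> z; rewrite normr_sg; case: (_ != _); rewrite ?lexx ?ler01.
  rewrite (le_trans (ler_normD _ _))// [`|- 4^-1 * _|]normrM [`|lc chi X ^+ 2 * _|]normrM normrN (ger0_norm (_ : 0 <= 4^-1))// (ger0_norm c2).
  have := ler_wpM2l c2 (le_trans gG' (ler_norm G')); have := mulr_ge0 c2 (normr_ge0 G).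
  move: hQ; lra.
Qed.

End LagrangianRepresentatives.

(** * C^1 curves in function spaces: scalar evolutions and uniform bounds *)

Section Curves.
Context {R : realType}.
Implicit Types (t s T C : R).

(** Compactness of [0, T] in the near-covering form, with the constants running along the filter at
    +oo. *)
Lemma interval_bounded T (P : R -> R -> Prop) :
  (forall t C C', P t C -> C <= C' -> P t C') ->
  (forall t, 0 <= t <= T -> exists C, \forall s \near t, 0 <= s -> P s C) ->
  exists C, forall t, 0 <= t <= T -> P t C.
Proof.
move=> mono loc.
have /compact_near_coveringP cov := @segment_compact R 0 T.
have := cov R (+oo%R : set_system R) (fun C t => 0 <= t -> P t C) _ _.
case.
- move=> t /=; rewrite in_itv/= => /loc[C hC].
  exists ([set s | 0 <= s -> P s C], [set C' | C <= C']) => /=.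
    by split => //; exact: nbhs_pinfty_ge (num_real C).
  by move=> [s C'] /= [hs CC'] s0; exact: mono (hs s0) CC'.
- move=> M [_ hM]; exists (M + 1) => t t0T; have /andP[t0 _] := t0T.
  by apply: (hM (M + 1)); rewrite ?ltrDl//= in_itv.
Qed.

Section Abstract.
Variables (W : lmodType R) (D : set W) (N : W -> \bar R) (f v : R -> W).
Hypothesis fv : C1_curve D N f v.

Lemma C1_curve_near t (d : R) : 0 <= t -> 0 < d -> \forall s \near t, s != t -> 0 <= s ->
  (N ((s - t)^-1 *: (f s - f t) - v t) <= d%:E)%E.
Proof.
move=> t0 d0; have [_ _ h _] := fv t0.
have nd : nbhs (0%E : \bar R) [set x | (x <= d%:E)%E].
  change (nbhs (0 : R) [set r : R | (r%:E <= d%:E)%E]).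
  by apply: filterS (lt_nbhsl d0) => r /ltW; rewrite /= lee_fin.
exact: (h _ nd).
Qed.

(* l is the restriction to the difference quotients of a functional bounded by
   K N. *)
Lemma C1_curve_evol (l : W -> R) (K T : R) : 0 <= K ->
  (forall a x y z d, D x -> D y -> D z -> 0 < d -> (N (a *: (x - y) - z) <= d%:E)%E ->
    `|a * (l x - l y) - l z| <= K * d) ->
  evol T (fun t => l (f t)) (fun t => l (v t)).
Proof.
move=> K0 hl.
have key t e : 0 <= t -> 0 < e -> \forall s \near t, 0 <= s ->
    `|l (f s) - l (f t) - (s - t) * l (v t)| <= e * `|s - t|.
  move=> t0 e0; have d0 : 0 < e / (K + 1) by rewrite divr_gt0// ltr_wpDl.
  apply: filterS (C1_curve_near t0 d0) => s hs s0.
  have [->|st] := eqVneq s t; first by rewrite !subrr mul0r subrr normr0 mulr0.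
  have [Dt vt _ _] := fv t0; have [Ds _ _ _] := fv s0.
  have st0 : s - t != 0 by rewrite subr_eq0.
  have -> : l (f s) - l (f t) - (s - t) * l (v t) =
      (s - t) * ((s - t)^-1 * (l (f s) - l (f t)) - l (v t)).
    by rewrite mulrBr mulrA divff// mul1r.
  rewrite normrM mulrC ler_wpM2r//.
  apply: le_trans (hl _ _ _ _ _ Ds Dt vt d0 (hs st s0)) _.
  rewrite mulrCA ler_piMr//; first exact: ltW.
  by rewrite ler_pdivrMr ?mul1r ?lerDl// ltr_wpDl.
split.
- move=> t /andP[t0 tT]; apply/cvgrPdist_le => e e0.
  suff h : \forall s \near t, 0 <= s <= T -> `|l (f t) - l (f s)| <= e by exact: h.
  have M0 : 0 < `|l (v t)| + 1 by rewrite ltr_wpDl.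
  have near_t : \forall s \near t, `|t - s| < e / (`|l (v t)| + 1).
    by exists (e / (`|l (v t)| + 1)) => //=; rewrite divr_gt0.
  apply: filterS2 near_t (key t 1 t0 ltr01) => s st hs /andP[s0 _].
  rewrite distrC in st; have := hs s0; rewrite mul1r distrC => h.
  have h2 : `|l (f t) - l (f s)| <= `|s - t| * (`|l (v t)| + 1).
    rewrite distrC -[X in `|X|](subrK ((s - t) * l (v t))) (le_trans (ler_normD _ _))//.
    by rewrite mulrDr mulr1 normrM addrC lerD2l distrC.
  apply: le_trans h2 _; rewrite -ler_pdivlMr//; exact: ltW.
- move=> t /andP[t0 tT]; apply/is_derive_epsP => e e0.
  apply: filterS2 (lt_nbhsr t0) (key t e (ltW t0) e0) => s s0; apply; exact: ltW.
Qed.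

End Abstract.

Section Norms.
Implicit Types (f g v : R -> R) (a b x d : R).

Lemma L2_norm_ge0 g : (0 <= L2_norm g)%E.
Proof. exact: Lnorm_ge0. Qed.

Lemma L2_norm_le g d a b : measurable_fun setT g -> (L2_norm g <= d%:E)%E ->
  intg a b (fun x => g x ^+ 2) /\ itg a b (fun x => g x ^+ 2) <= d ^+ 2.
Proof.
move=> mg gd; have d0 : 0 <= d by rewrite -lee_fin (le_trans (L2_norm_ge0 g)).
have mg2 : measurable_fun setT (fun x => (g x ^+ 2)%:E).
  by apply/measurable_EFinP; exact: measurable_funX.
have le : (\int[lebesgue_measure]_x (g x ^+ 2)%:E <= (d ^+ 2)%:E)%E.
  by rewrite -L2_norm_sqr expr2 EFinM lee_pmul// L2_norm_ge0.
have le' : (\int[lebesgue_measure]_(x in `[a, b]) (g x ^+ 2)%:E <= (d ^+ 2)%:E)%E.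
  apply: le_trans le; apply: ge0_subset_integral => //.
  by move=> x _; rewrite lee_fin sqr_ge0.
have ii : intg a b (fun x => g x ^+ 2).
  apply/integrableP; split; first exact: measurable_funS mg2.
  under eq_integral do rewrite /= ger0_norm ?sqr_ge0//.
  by apply: le_lt_trans le' _; exact: ltry.
by split => //; rewrite -lee_fin /itg /Rintegral fineK//; exact: integrable_fin_num.
Qed.

(* [|g| <= d + g^2 / d] *)
Lemma L2_norm_itg g d a b : measurable_fun setT g -> 0 < d -> a <= b -> (L2_norm g <= d%:E)%E ->
  intg a b g /\ itg a b (fun x => `|g x|) <= (b - a + 1) * d.
Proof.
move=> mg d0 ab gd; have [i2 h2] := L2_norm_le a b mg gd.
have le x : `|g x| <= d + d^-1 * g x ^+ 2.
  rewrite -(ler_pM2l d0) mulrDr mulrA divff ?gt_eqF// mul1r -[g x ^+ 2]real_normK ?num_real//.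
  by have := sqr_ge0 (d - `|g x|); have := normr_ge0 (g x); nra.
have i3 : intg a b (fun x => d + d^-1 * g x ^+ 2) by apply: intgD; [exact: intg_cst|exact: intgZ].
have ig : intg a b g.
  apply: le_integrable i3 => //; first by apply/measurable_EFinP; apply: measurable_funS mg.
  by move=> x _ /=; rewrite lee_fin (le_trans (le x))// ler_norm.
split=> //; apply: le_trans (itg_le (intg_norm ig) i3 (fun x _ => le x)) _.
rewrite itgD; [|exact: intg_cst|exact: intgZ].
rewrite itg_cst// itgZ//.
have : d^-1 * itg a b (fun x => g x ^+ 2) <= d^-1 * d ^+ 2 by rewrite ler_wpM2l// invr_ge0 ltW.
rewrite expr2 mulrA mulVf ?gt_eqF// mul1r; lra.
Qed.

Lemma L2_norm_fin g : L2 g -> exists2 d, 0 < d & (L2_norm g <= d%:E)%E.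
Proof.
move=> Lg; have := Lg; rewrite /L2/= => /andP[_]; rewrite inE /= /finite_norm => gfin.
have gn : L2_norm g \is a fin_num by rewrite ge0_fin_numE// L2_norm_ge0.
exists (fine (L2_norm g) + 1); first by rewrite ltr_wpDl// fine_ge0// L2_norm_ge0.
by rewrite EFinD fineK// leeDl.
Qed.

Lemma L2_curve_evol (f v : R -> R -> R) a b T : a <= b -> C1_curve L2 (@L2_norm R) f v ->
  evol T (fun t => itg a b (f t)) (fun t => itg a b (v t)).
Proof.
move=> ab fv; have K0 : 0 <= b - a + 1 by rewrite addr_ge0// subr_ge0.
apply: (@C1_curve_evol _ _ _ _ _ fv (fun g => itg a b g) (b - a + 1) T K0) => k x y z d Lx Ly Lz d0 hd.
have fin g : L2 g -> intg a b g.
  by move=> Lg; have [e e0 ge] := L2_norm_fin Lg; case: (L2_norm_itg (L2_measurable Lg) e0 ab ge).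
have ix := fin _ Lx; have iy := fin _ Ly; have iz := fin _ Lz.
have mx := L2_measurable Lx; have my := L2_measurable Ly; have mz := L2_measurable Lz.
have mg : measurable_fun setT (k *: (x - y) - z).
  apply: measurable_funB => //; apply: measurable_funM => //; exact: measurable_funB.
have [ig hg] := L2_norm_itg mg d0 ab hd.
have -> : k * (itg a b x - itg a b y) - itg a b z = itg a b (k *: (x - y) - z).
  rewrite -itgB// -itgZ; last exact: intgB.
  by rewrite -itgB//; apply: intgZ; exact: intgB.
exact: le_trans (itg_norm ig) hg.
Qed.

(** Near [t] one has f s = f t + (s - t) v t + (s - t) g with |s - t| < 1 and the L^2 norm of [g] at
    most 1; the square of a sum of three terms costs a factor 3. *)
Lemma L2_curve_bounded (f v : R -> R -> R) T : C1_curve L2 (@L2_norm R) f v ->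
  exists C, forall t, 0 <= t <= T -> forall n : nat, itg (- n%:R) n%:R (fun x => f t x ^+ 2) <= C.
Proof.
move=> fv; apply: interval_bounded => [t C C' hC CC' n|t /andP[t0 _]].
  exact: le_trans (hC n) CC'.
have [Lf Lv _ _] := fv t t0.
have [df df0 hf] := L2_norm_fin Lf; have [dv dv0 hv] := L2_norm_fin Lv.
exists (3 * (df ^+ 2 + dv ^+ 2 + 1)).
have near1 : \forall s \near t, `|t - s| < 1 by exists 1 => /=.
apply: filterS2 near1 (C1_curve_near fv t0 ltr01) => s ts hs s0 n.
have [Ls _ _ _] := fv s s0.
have nn : - n%:R <= n%:R :> R by rewrite ge0_cp.
have [If hf2] := L2_norm_le (- n%:R) n%:R (L2_measurable Lf) hf.
have [Iv hv2] := L2_norm_le (- n%:R) n%:R (L2_measurable Lv) hv.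
have [st|st] := eqVneq s t.
  rewrite st; apply: le_trans hf2 _; have := sqr_ge0 df; have := sqr_ge0 dv; lra.
have mg : measurable_fun setT ((s - t)^-1 *: (f s - f t) - v t).
  apply: measurable_funB; last exact: L2_measurable.
  by apply: measurable_funM => //; apply: measurable_funB; exact: L2_measurable.
have [Ig hg2] := L2_norm_le (- n%:R) n%:R mg (hs st s0).
set g := (_ - v t) in mg Ig hg2.
have st0 : s - t != 0 by rewrite subr_eq0.
have fE x : f s x = f t x + (s - t) * v t x + (s - t) * g x.
  have -> : g x = (s - t)^-1 * (f s x - f t x) - v t x by [].
  by field.
have [Is _] : intg (- n%:R) n%:R (fun x => f s x ^+ 2) /\ True.
  by have [e e0 he] := L2_norm_fin Ls; have [] := L2_norm_le (- n%:R) n%:R (L2_measurable Ls) he.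
apply: (@le_trans _ _ (itg (- n%:R) n%:R (fun x => 3 * (f t x ^+ 2 + v t x ^+ 2 + g x ^+ 2)))).
  apply: itg_le => //; first by apply: intgZ; apply: intgD => //; exact: intgD.
  move=> x _; rewrite fE.
  have ts2 : (s - t) ^+ 2 <= 1.
    by rewrite -real_normK ?num_real// expr_le1// distrC ltW.
  have h1 := ler_wpM2r (sqr_ge0 (v t x)) ts2; have h2 := ler_wpM2r (sqr_ge0 (g x)) ts2.
  have := sqr_ge0 (f t x - (s - t) * v t x).
  have := sqr_ge0 (f t x - (s - t) * g x).
  have := sqr_ge0 ((s - t) * v t x - (s - t) * g x).
  move: h1 h2; nra.
rewrite itgZ; last by apply: intgD => //; exact: intgD.
rewrite itgD//; last exact: intgD.
rewrite itgD// ler_wpM2l//; move: hg2; rewrite expr1n => hg2; lra.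
Qed.

Variable chi : R -> R.
Hypothesis hchi : cutoff chi.

Lemma continuous_lin a f g v : continuous f -> continuous g -> continuous v ->
  continuous (a *: (f - g) - v).
Proof.
move=> cf cg cv x; apply: cvgB; last exact: cv.
by apply: cvgZr; apply: cvgB; [exact: cf|exact: cg].
Qed.

(** Averaging |g x| <= |g z| + 2 d over z in [x, x + 1]. On this interval of length 1, [L2_norm_itg]
    bounds the integrals of |g| and of |w| by 2 d each. *)
Lemma H1_sup g w d x : continuous g -> is_weak_derivative setT g w -> 0 < d ->
  (L2_norm g <= d%:E)%E -> (L2_norm w <= d%:E)%E -> `|g x| <= 4 * d.
Proof.
move=> cg gw d0 hg hw.
have mg : measurable_fun setT g by exact: continuous_measurable_fun.
have [_ [mw _ _] _] := gw.
have x1 : x <= x + 1 by rewrite lerDl.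
have [ig hg'] := L2_norm_itg mg d0 x1 hg; have [iw hw'] := L2_norm_itg mw d0 x1 hw.
have [_ pw] := weak_derivative_continuous x (x + 1) hchi gw cg erefl.
have le z : x <= z <= x + 1 -> `|g x| <= `|g z| + 2 * d.
  move=> /andP[xz zx]; have e := pw x z (lexx x) xz zx.
  have h1 : `|itg x z w| <= itg x z (fun u => `|w u|).
    by apply: itg_norm; exact: intgS iw.
  have h2 : itg x z (fun u => `|w u|) <= itg x (x + 1) (fun u => `|w u|).
    rewrite (itg_cat xz zx (intg_norm iw)) lerDl; exact: itg_ge0.
  have -> : g x = g z - (g z - g x) by rewrite subKr.
  rewrite (le_trans (ler_normB _ _))// lerD2l e; lra.
have := itg_le (intg_cst x (x + 1) `|g x|) (intgD (intg_norm ig) (intg_cst x (x + 1) (2 * d))) le.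
rewrite itgD; [|exact: intg_norm|exact: intg_cst].
rewrite !itg_cst//; lra.
Qed.

Lemma H1_norm_sup g d x : continuous g -> (exists w, is_weak_derivative setT g w) -> 0 < d ->
  (H1_norm g <= d%:E)%E -> `|g x| <= 4 * d.
Proof.
move=> cg /wderivP gw d0 hd; apply: (H1_sup x cg gw d0).
  by apply: le_trans hd; rewrite /H1_norm leeDl// L2_norm_ge0.
by apply: le_trans hd; rewrite /H1_norm leeDr// L2_norm_ge0.
Qed.

Lemma H1_bounded g : H1 g -> exists C, forall x, `|g x| <= C.
Proof.
move=> [cg Lg [w gw Lw]].
have [d d0 hd] := L2_norm_fin Lg; have [e e0 he] := L2_norm_fin Lw.
exists (4 * (d + e)) => x; apply: (H1_sup x cg gw); first exact: addr_gt0.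
  by apply: le_trans hd _; rewrite lee_fin lerDl ltW.
by apply: le_trans he _; rewrite lee_fin lerDr ltW.
Qed.

Lemma H1_lin a f g v : H1 f -> H1 g -> H1 v -> continuous (a *: (f - g) - v) /\
  exists w, is_weak_derivative setT (a *: (f - g) - v) w.
Proof.
move=> [cf _ [f' ff' _]] [cg _ [g' gg' _]] [cv _ [v' vv' _]].
split; first exact: continuous_lin.
(* - v is written v + -2 v because [is_weak_derivative_lin] takes its first summand with coefficient
   1. *)
eexists; rewrite (_ : _ - v = fun x => (v x + -2 * v x) + a * (f x + -1 * g x)); last first.
  apply/funext => x; have -> : (a *: (f - g) - v) x = a * (f x - g x) - v x by [].
  ring.
apply: is_weak_derivative_lin; first by have h := vv'; exact: is_weak_derivative_lin h vv'.
exact: is_weak_derivative_lin ff' gg'.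
Qed.

Lemma H1_curve_evol (f v : R -> R -> R) x T : C1_curve H1 (@H1_norm R) f v ->
  evol T (fun t => f t x) (fun t => v t x).
Proof.
move=> fv; apply: (C1_curve_evol fv (K := 4) (l := fun g => g x)) => // k f1 f2 g d Hf1 Hf2 Hg d0 hd.
by have [c w] := H1_lin k Hf1 Hf2 Hg; have := H1_norm_sup x c w d0 hd.
Qed.

Lemma H1_curve_bounded (f v : R -> R -> R) T : C1_curve H1 (@H1_norm R) f v ->
  exists C, forall t, 0 <= t <= T -> forall x, `|f t x| <= C.
Proof.
move=> fv; apply: interval_bounded => [t C C' hC CC' x|t /andP[t0 _]].
  exact: le_trans (hC x) CC'.
have [Hf Hv _ _] := fv t t0.
have [Cf hf] := H1_bounded Hf; have [Cv hv] := H1_bounded Hv.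
exists (Cf + (Cv + 4)).
have near1 : \forall s \near t, `|t - s| < 1 by exists 1 => /=.
apply: filterS2 near1 (C1_curve_near fv t0 ltr01) => s ts hs s0 x.
have C40 : 0 <= Cv + 4 by rewrite addr_ge0// (le_trans _ (hv 0)).
have [->|st] := eqVneq s t; first by rewrite (le_trans (hf x))// lerDl.
have [Hs _ _ _] := fv s s0.
have [c w] := H1_lin (s - t)^-1 Hs Hf Hv.
have := H1_norm_sup x c w ltr01 (hs st s0); set g := (_ - v t) => hg.
have st0 : s - t != 0 by rewrite subr_eq0.
have fE : f s x = f t x + (s - t) * (v t x + g x).
  have -> : g x = (s - t)^-1 * (f s x - f t x) - v t x by [].
  by field.
rewrite fE (le_trans (ler_normD _ _))// lerD// normrM.
rewrite (@le_trans _ _ (1 * `|v t x + g x|))//.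
  by rewrite ler_wpM2r// distrC ltW.
rewrite mul1r (le_trans (ler_normD _ _))// lerD//; rewrite mulr1 in hg; exact: hg.
Qed.

Lemma V_curve_evol (f v : R -> R -> R) x T : C1_curve V (@V_norm R) f v ->
  evol T (fun t => f t x) (fun t => v t x).
Proof.
move=> fv; apply: (C1_curve_evol fv (K := 1) (l := fun g => g x)) => // k f1 f2 g d [c1 _ _] [c2 _ _] [c3 _ _] d0 hd.
have cg := @continuous_lin k _ _ _ c1 c2 c3; set G := (_ - g) in cg hd.
rewrite mul1r; apply: (@continuous_ae_le _ G d cg).
have : ('N[@lebesgue_measure R]_+oo[EFin \o G] <= d%:E)%E.
  by apply: le_trans hd; rewrite /V_norm leeDl// L2_norm_ge0.
rewrite unlock lebT_gt0 => /ess_supP; apply: ae_S => z /=.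
by rewrite lee_fin.
Qed.

Lemma cst_curve (f : R -> R) t : C1_curve (setT : set R^o) (fun x => `|x|%:E) (f : R -> R^o) (fun=> 0) ->
  0 <= t -> f t = f 0.
Proof.
move=> fv t0; have ev : evol t f (fun=> 0).
  apply: (C1_curve_evol fv (K := 1) (l := id)) => // k x y z d _ _ _ _.
  by rewrite lee_fin mul1r.
have h : `|f t - f 0| <= 0 * (t - 0).
  by apply: (evol_derive_bound ev) => // r _; rewrite normr0.
by move: h; rewrite mul0r normr_le0 subr_eq0 => /eqP.
Qed.

End Norms.

End Curves.

(** * Bounds and regularity along a trajectory *)

Section Trajectory.
Context {R : realType}.
Implicit Types (t s x y : R).

Lemma evol_comp (G G' : R -> R) (T : R) phi gam : (forall x : R, is_derive x 1 G (G' x)) ->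
  evol T phi gam -> evol T (fun t => G (phi t)) (fun t => G' (phi t) * gam t).
Proof.
move=> dG [cphi dphi]; split.
- move=> t tT; have := cphi t tT.
  by move=> h; apply: (cvg_comp _ _ h); exact: is_derive_continuous (dG _).
- by move=> t tT; have := is_derive1_comp (dG (phi t)) (dphi t tT).
Qed.

Variables (chi : R -> R) (X : R -> lagrangian R).
Hypotheses (hchi : cutoff chi) (hX : lagrangian_solution chi X).

Local Notation k := (lk (X 0)).
Local Notation c := (lc chi (X 0)).

Lemma lk_cst t : 0 <= t -> lk (X t) = k.
Proof. by have [_ _ _ [_ _ _ h]] := hX; exact: cst_curve h. Qed.

Lemma lc_cst t : 0 <= t -> lc chi (X t) = c.
Proof. by have [_ _ _ [_ _ h _]] := hX; exact: cst_curve h. Qed.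

Lemma y_evol x T : evol T (fun t => ly (X t) x) (fun t => lU (X t) x).
Proof.
have [_ h _ _] := hX; have := evolD (evol_cst T x) (V_curve_evol x T h).
by apply: evol_ext => // t _; rewrite add0r.
Qed.

(** U = Ubar + c chi(y) with y_t = U, so the term c chi'(y) U in the equation for Ubar cancels. *)
Lemma U_evol x T : evol T (fun t => lU (X t) x) (fun t => - Qfun chi (X t) x).
Proof.
have [_ _ h _] := hX.
have := evolD (H1_curve_evol hchi x T h)
  (evolZ c (evol_comp (cutoff_derive hchi) (y_evol x T))).
apply: evol_ext => t /andP[t0 tT].
  by rewrite /Ubar lc_cst// subrK.
by rewrite lc_cst ?ltW//; ring.
Qed.

Section Interval.
Variable T : R.
Hypothesis T0 : 0 <= T.

Lemma Ubar_bounded : exists C, forall t x, 0 <= t <= T -> `|Ubar chi (X t) x| <= C.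
Proof.
have [_ _ h _] := hX; have [C hC] := H1_curve_bounded hchi T h.
by exists C => t x tT; exact: hC.
Qed.

Lemma U_bounded : exists C, forall t x, 0 <= t <= T -> `|lU (X t) x| <= C.
Proof.
have [C hC] := Ubar_bounded; exists (C + `|c|) => t x tT; have /andP[t0 _] := tT.
have -> : lU (X t) x = Ubar chi (X t) x + c * chi (ly (X t) x) by rewrite /Ubar lc_cst// subrK.
rewrite (le_trans (ler_normD _ _))// lerD ?hC// normrM -[leRHS]mulr1 ler_wpM2l//.
by rewrite ger0_norm; [exact: cutoff_le1|exact: cutoff_ge0].
Qed.

Lemma zeta_bounded : exists C, forall t x, 0 <= t <= T -> `|ly (X t) x - x| <= C.
Proof.
have [C hC] := U_bounded.
have [/(_ 0 (lexx 0)) G0 _ _ _] := hX.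
have [q0 [v0 [h0 [r0 H0]]]] := calG_repr hchi G0.
have [Z hZ] := repr_zeta_bounded H0.
exists (Z + C * T) => t x tT; have /andP[t0 tT'] := tT.
have C0 : 0 <= C by apply: le_trans (hC 0 0 _); rewrite ?normr_ge0// lexx T0.
have := @evol_derive_bound _ _ _ _ C 0 t (y_evol x T) _ (lexx 0) t0 tT'.
rewrite subr0 => /(_ _)/wrap[].
  by move=> s /andP[s0 sT]; apply: hC; rewrite !ltW.
move=> h; have := hZ x; have : C * t <= C * T by rewrite ler_wpM2l.
have -> : ly (X t) x - x = (ly (X t) x - ly (X 0) x) + (ly (X 0) x - x) by ring.
by move=> h1 h2; rewrite (le_trans (ler_normD _ _))// [Z + _]addrC lerD// (le_trans h).
Qed.

Variables (q v h r : R -> R -> R).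
Hypothesis HX : forall t, 0 <= t -> lagrangian_repr (X t) (q t) (v t) (h t) (r t).

Let bm t : 0 <= t -> [/\ forall a b, bmf a b (q t), forall a b, bmf a b (v t),
  forall a b, bmf a b (h t) & forall a b, bmf a b (r t)].
Proof. by move=> t0; exact: repr_bmf (HX t0). Qed.

Lemma PQ_time_bounded M : exists K, forall t x, 0 <= t <= T -> `|x| <= M ->
  `|Defs.Pfun chi (X t) x| <= K /\ `|Qfun chi (X t) x| <= K.
Proof.
have [CU hU] := Ubar_bounded; have [Z hZ] := zeta_bounded.
have [_ _ _ [hh _ _ _]] := hX; have [B hB] := L2_curve_bounded T hh.
have [K hK] := PQ_bounded hchi k c CU Z B M; exists K => t x tT xM; have /andP[t0 _] := tT.
apply: (hK _ _ _ _ _ (HX t0)) => //.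
- exact: lk_cst.
- exact: lc_cst.
- by move=> z; exact: hU.
- by move=> z; exact: hZ.
move=> n; have [mq mv mh mr] := repr_measurable (HX t0).
have [_ _ mlh _] := repr_measurable0 (HX t0).
rewrite (_ : itg _ _ _ = itg (- n%:R) n%:R (fun x => lh (X t) x ^+ 2)); first exact: hB.
apply: aeq_itg.
- by apply: measurable_funX; exact: measurable_funS mh.
- by apply: measurable_funX; exact: measurable_funS mlh.
by apply: ae_S (repr_lh (HX t0)) => z ->.
Qed.

Definition accel t x : R := lU (X t) x ^+ 2 + 2^-1 * k ^+ 2 - Defs.Pfun chi (X t) x.

Lemma accel_bounded M : exists2 K, 0 <= K & forall t x, 0 <= t <= T -> `|x| <= M -> `|accel t x| <= K.
Proof.
have [C hC] := U_bounded; have [K hK] := PQ_time_bounded M.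
exists (`|C ^+ 2 + 2^-1 * k ^+ 2 + K|) => // t x tT xM.
have [hP _] := hK t x tT xM; rewrite /accel.
have k0 : 0 <= k ^+ 2 by exact: sqr_ge0.
have : lU (X t) x ^+ 2 <= C ^+ 2.
  rewrite -(real_normK (num_real (lU (X t) x))) lerXn2r// ?nnegrE ?normr_ge0 ?hC//.
  exact: le_trans (normr_ge0 _) (hC t x tT).
have := sqr_ge0 (lU (X t) x); move: hP; rewrite ler_norml => /andP[h1 h2] h3 h4.
apply: le_trans (ler_norm _); rewrite ler_norml; lra.
Qed.

Lemma accel_bmf t a b : 0 <= t -> a < b -> bmf a b (accel t).
Proof.
move=> t0 ab; have [bq bv bh br] := bm t0; have [bP _ _ _] := PQ_prim hchi (HX t0) ab.
have bU : bmf a b (lU (X t)) by exact: prim_bmf (bv a b) (@repr_U_prim _ _ _ _ _ _ (HX t0) a b).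
apply: bmfD; last exact: bmfN.
apply: bmfD; last exact: bmf_cst.
rewrite (_ : (fun x => _) = fun x => lU (X t) x * lU (X t) x); first exact: bmfM.
by apply/funext => x; rewrite expr2.
Qed.

(** The equations for y and U hold at every xi. Subtracting them at two points gives the tested
    equations for their derivatives, so nothing is differentiated in xi under the time
    derivative. *)
Lemma q_evol x y : x <= y -> evol T (fun t => itg x y (q t)) (fun t => itg x y (v t)).
Proof.
move=> xy; apply: evol_ext (evolB (y_evol y T) (y_evol x T)) => t /andP[t0 _].
  by rewrite (repr_y_prim (HX t0) (lexx x) xy (lexx y)).
by rewrite (repr_U_prim (HX (ltW t0)) (lexx x) xy (lexx y)).
Qed.

Lemma v_evol x y : x <= y -> evol T (fun t => itg x y (v t))
  (fun t => itg x y (fun z => 2^-1 * h t z + k * r t z + accel t z * q t z)).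
Proof.
rewrite le_eqVlt => /predU1P[->|xy].
  by apply: evol_ext (evol_cst T 0) => t _; rewrite itgxx.
apply: evol_ext (evolB (U_evol y T) (U_evol x T)) => t /andP[t0 _].
  by rewrite (repr_U_prim (HX t0) (lexx x) (ltW xy) (lexx y)).
have [bq bv bh br] := bm (ltW t0).
have [_ _ _ pQ] := PQ_prim hchi (HX (ltW t0)) xy.
have bA := accel_bmf (ltW t0) xy.
have E (u w I J : R) : u - w = I -> I = - J -> - u - - w = J.
  by move=> e1 e2; rewrite -opprD e1 e2 opprK.
apply: E (pQ x y (lexx x) (ltW xy) (lexx y)) _.
rewrite -mulN1r -itgZ; last first.
  apply: bmf_intg; apply: bmfD; first by apply: bmfD; apply: bmfM => //; exact: bmf_cst.
  exact: bmfM.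
by apply: eq_itg => z _; rewrite mulN1r (lk_cst (ltW t0)).
Qed.

Lemma h_evol x y : x <= y -> evol T (fun t => itg x y (h t))
  (fun t => itg x y (fun z => 2 * accel t z * v t z)).
Proof.
rewrite le_eqVlt => /predU1P[->|xy].
  by apply: evol_ext (evol_cst T 0) => t _; rewrite itgxx.
have [_ _ _ [hh _ _ _]] := hX.
apply: evol_ext (L2_curve_evol T (ltW xy) hh) => t /andP[t0 _].
- have [_ _ mh _] := repr_measurable (HX t0); have [_ _ mlh _] := repr_measurable0 (HX t0).
  apply: aeq_itg; [exact: measurable_funS mlh|exact: measurable_funS mh|].
  by apply: ae_S (repr_lh (HX t0)) => z ->.
have [_ mv _ _] := repr_measurable (HX (ltW t0)); have [_ mU _ _] := repr_measurable0 (HX (ltW t0)).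
have [mA _] := accel_bmf (ltW t0) xy.
rewrite (lk_cst (ltW t0)); apply: aeq_itg.
- apply: (@measurable_funM _ _ _ _ (fun z => 2 * accel t z) (U_xi (X t))); last exact: measurable_funS mU.
  exact: measurable_funM.
- by apply: measurable_funM; [exact: measurable_funM|exact: measurable_funS mv].
- by apply: ae_S (repr_U_xi (HX (ltW t0))) => z ->.
Qed.

Lemma r_evol x y : x <= y -> evol T (fun t => itg x y (r t))
  (fun t => itg x y (fun z => - k * v t z)).
Proof.
move=> xy; have [_ _ _ [_ hr _ _]] := hX.
apply: evol_ext (L2_curve_evol T xy hr) => t /andP[t0 _].
- have [_ _ _ mr] := repr_measurable (HX t0); have [_ _ _ mlr] := repr_measurable0 (HX t0).
  apply: aeq_itg; [exact: measurable_funS mlr|exact: measurable_funS mr|].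
  by apply: ae_S (repr_rbar (HX t0)) => z ->.
have [_ mv _ _] := repr_measurable (HX (ltW t0)); have [_ mU _ _] := repr_measurable0 (HX (ltW t0)).
rewrite (lk_cst (ltW t0)); apply: aeq_itg.
- by apply: measurable_funM => //; exact: measurable_funS mU.
- by apply: measurable_funM => //; exact: measurable_funS mv.
- by apply: ae_S (repr_U_xi (HX (ltW t0))) => z ->.
Qed.

Variables (a b : R).
Hypothesis ab : a < b.

Let v_le t x : 0 <= t -> `|v t x| <= (q t x + h t x) / 2.
Proof.
move=> t0; have q0 := repr_q_ge0 (HX t0) x; have h0 := repr_h_ge0 (HX t0) x.
have qh := repr_qh (HX t0) x.
rewrite -(@ler_pXn2r _ 2)// ?nnegrE ?normr_ge0 ?divr_ge0 ?addr_ge0//.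
by rewrite real_normK ?num_real//; have := sqr_ge0 (r t x); have := sqr_ge0 (q t x - h t x); nra.
Qed.

Let r_le t x : 0 <= t -> `|r t x| <= (q t x + h t x) / 2.
Proof.
move=> t0; have q0 := repr_q_ge0 (HX t0) x; have h0 := repr_h_ge0 (HX t0) x.
have qh := repr_qh (HX t0) x.
rewrite -(@ler_pXn2r _ 2)// ?nnegrE ?normr_ge0 ?divr_ge0 ?addr_ge0//.
by rewrite real_normK ?num_real//; have := sqr_ge0 (v t x); have := sqr_ge0 (q t x - h t x); nra.
Qed.

(* q + h dominates 2 |v|, because q h = v^2 + r^2; its averages therefore satisfy a
   closed Gronwall inequality. *)
Lemma energy_average_bounded : exists2 C, 0 <= C & forall t x y, 0 <= t <= T ->
  a <= x -> x <= y -> y <= b -> itg x y (fun z => q t z + h t z) <= C * (y - x).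
Proof.
have [C0 hC0] := repr_bounded (HX (lexx 0)).
have C00 : 0 <= C0 by apply: le_trans (_ : `|q 0 0| <= _); [exact: normr_ge0|case: (hC0 0)].
have [K K0 hK] := accel_bounded (`|a| + `|b|).
have Mx z : a <= z <= b -> `|z| <= `|a| + `|b|.
  by move=> /andP[az zb]; rewrite ler_norml; have := ler_norm (- a); have := ler_norm b;
    have := normr_ge0 a; have := normr_ge0 b; rewrite normrN; lra.
(* The rate is that of |v + 2 A v| <= (1 + 2 K) (q + h) / 2, and 2 C0 bounds q + h at time 0. *)
exists (expR ((1 + 2 * K) / 2 * T) * (2 * C0)); first by rewrite mulr_ge0 ?expR_ge0// mulr_ge0.
move=> t x y tT ax xy yb; have /andP[t0 tT'] := tT.
pose gam s := itg x y (v s) + itg x y (fun z => 2 * accel s z * v s z).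
have ev : evol T (fun s => itg x y (fun z => q s z + h s z)) gam.
  apply: evol_ext (evolD (q_evol xy) (h_evol xy)) => // s /andP[s0 _].
  by have [bq _ bh _] := bm s0; rewrite itgD//; exact/bmf_intg.
have L0 : 0 <= (1 + 2 * K) / 2 by rewrite divr_ge0// addr_ge0// mulr_ge0.
have gle s : 0 < s < T -> gam s <= (1 + 2 * K) / 2 * itg x y (fun z => q s z + h s z) + 0.
  move=> /andP[/ltW s0 /ltW sT]; have [bq bv bh _] := bm s0.
  have bA := bmfS ax yb (accel_bmf s0 ab).
  have iqh : intg x y (fun z => q s z + h s z) by apply: bmf_intg; exact: bmfD.
  have i2 : intg x y (fun z => 2 * accel s z * v s z).
    by apply: bmf_intg; apply: bmfM => //; apply: bmfM => //; exact: bmf_cst.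
  rewrite /gam -itgD//; last exact: bmf_intg.
  rewrite addr0 -itgZ//; apply: itg_le; [by apply: intgD => //; exact: bmf_intg|exact: intgZ|].
  move=> z /andP[xz zy]; have zab : a <= z <= b by rewrite (le_trans ax)// (le_trans zy).
  have hA : `|accel s z| <= K by apply: hK; [rewrite s0|exact: Mx].
  have hv := v_le z s0.
  rewrite -[X in X + _]mul1r -mulrDl (le_trans (ler_norm _))// normrM mulrAC -mulrA.
  apply: ler_pM => //; rewrite (le_trans (ler_normD _ _))// normr1 lerD2l normrM ger0_norm//.
  by rewrite ler_wpM2l.
have := gronwall L0 (lexx 0) ev gle tT; rewrite mul0r addr0 => /le_trans; apply.
have e0 : itg x y (fun z => q 0 z + h 0 z) <= 2 * C0 * (y - x).
  have [bq bv bh _] := bm (lexx 0).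
  rewrite -itg_cst//; apply: itg_le; [by apply: bmf_intg; exact: bmfD|exact: intg_cst|].
  move=> z _; have [h1 _ h3 _] := hC0 z.
  by have := ler_norm (q 0 z); have := ler_norm (h 0 z); lra.
rewrite -[leRHS]mulrA ler_pM ?expR_ge0//; last by rewrite ler_expR ler_wpM2l.
apply: itg_ge0 => z _; rewrite addr_ge0//; [exact: repr_q_ge0 (HX (lexx 0)) z|exact: repr_h_ge0 (HX (lexx 0)) z].
Qed.

(** By the bound on averages the primitive of q + h is [C]-Lipschitz, so its a.e. derivative is at
    most [C]. *)
Lemma energy_bounded : exists2 C, 0 <= C & forall t, 0 <= t <= T ->
  {ae @lebesgue_measure R, forall x, a <= x <= b -> q t x + h t x <= C}.
Proof.
have [C C0 hC] := energy_average_bounded; exists C => // t tT; have /andP[t0 _] := tT.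
have [bq _ bh _] := bm t0.
have i := bmf_intg (bmfD (bq a b) (bh a b)).
have p := primitive_prim 0 i.
have l : lip a b (fun x => 0 + itg a x (fun z => q t z + h t z)) C.
  move=> x y ax xy yb; rewrite (p x y ax xy yb) ger0_norm; first exact: hC.
  apply: itg_ge0 => z _; rewrite addr_ge0//; [exact: repr_q_ge0 (HX t0) z|exact: repr_h_ge0 (HX t0) z].
apply: ae_oo_cc; apply: ae_S (prim_derive i p) => x hx xab.
by apply: le_trans (ler_norm _) _; exact: lip_derive_le l xab (hx xab).
Qed.

(** The tested equations for r and for k q cancel, so the two primitives have equal increments;
    densities are unique almost everywhere. *)
Lemma r_conserved t : 0 <= t <= T ->
  aeq a b (fun x => r t x + k * q t x) (fun x => r 0 x + k * q 0 x).
Proof.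
move=> tT; have /andP[t0 tT'] := tT.
have ii s : 0 <= s -> intg a b (fun x => r s x + k * q s x).
  by move=> s0; have [bq _ _ br] := bm s0; apply: intgD; [|apply: intgZ]; exact: bmf_intg.
apply: (prim_unique (ii t t0) (ii 0 (lexx 0)) (primitive_prim 0 (ii t t0))) => x y ax xy yb.
rewrite (primitive_prim 0 (ii t t0) ax xy yb).
have ev : evol T (fun s => itg x y (fun z => r s z + k * q s z)) (fun=> 0).
  apply: evol_ext (evolD (r_evol xy) (evolZ k (q_evol xy))) => s /andP[s0 _].
    have [bq _ _ br] := bm s0.
    by rewrite itgD ?itgZ//; [exact/bmf_intg|exact/bmf_intg|exact/intgZ/bmf_intg].
  have [_ bv _ _] := bm (ltW s0).
  by rewrite itgZ; [rewrite mulNr addNr|exact/bmf_intg].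
have h0 : `|itg x y (fun z => r t z + k * q t z) - itg x y (fun z => r 0 z + k * q 0 z)| <= 0 * (t - 0).
  by apply: (evol_derive_bound ev) => // s _; rewrite normr0.
by move: h0; rewrite mul0r normr_le0 subr_eq0 => /eqP.
Qed.

(* r^2 = (rbar + k q)^2 is transported and bounded by a multiple of q, since
   rbar^2 <= q h. *)
Lemma q_lower_bound c0 : 0 < c0 ->
  {ae @lebesgue_measure R, forall x, a <= x <= b -> c0 <= (r 0 x + k * q 0 x) ^+ 2} ->
  exists2 d, 0 < d & forall t, 0 <= t <= T ->
    {ae @lebesgue_measure R, forall x, a <= x <= b -> d <= q t x}.
Proof.
move=> c00 hc; have [C C0 hC] := energy_bounded.
(* c0 <= (r + k q)^2 <= 2 r^2 + 2 k^2 q^2 <= 2 C (1 + k^2) q, by r^2 <= q h and q, h <= C; the added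
   1 makes [D] positive. *)
pose D := 2 * C * (1 + k ^+ 2) + 1.
have k0 : 0 <= k ^+ 2 by exact: sqr_ge0.
have D0 : 0 < D by rewrite ltr_wpDl// !mulr_ge0// addr_ge0.
exists (c0 / D); first exact: divr_gt0.
move=> t tT; have /andP[t0 tT'] := tT.
apply: ae_S3 hc (r_conserved tT) (hC t tT) => x h1 h2 h3 xab.
have {}h1 := h1 xab; have {}h2 := h2 xab; have {}h3 := h3 xab; rewrite -h2 in h1.
have q0 := repr_q_ge0 (HX t0) x; have hh0 := repr_h_ge0 (HX t0) x.
have qh := repr_qh (HX t0) x.
rewrite ler_pdivrMr//; apply: le_trans h1 _.
have e1 : (r t x + k * q t x) ^+ 2 <= 2 * r t x ^+ 2 + 2 * (k ^+ 2 * q t x ^+ 2).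
  by have := sqr_ge0 (r t x - k * q t x); nra.
have e2 : r t x ^+ 2 <= q t x * C.
  have : q t x * h t x <= q t x * C by rewrite ler_wpM2l//; lra.
  by have := sqr_ge0 (v t x); lra.
have e3 : q t x ^+ 2 <= q t x * C by rewrite expr2 ler_wpM2l//; lra.
have e4 := ler_wpM2l k0 e3.
rewrite /D; nra.
Qed.

Hypothesis Tpos : 0 < T.

Local Notation TS := [set t : R | 0 <= t <= T].

Lemma PQU_base : [/\ Reg TS a b 0 (fun t => lU (X t)),
  Reg TS a b 0 (fun t => Defs.Pfun chi (X t)) & Reg TS a b 0 (fun t => Qfun chi (X t))].
Proof.
have [C hC] := U_bounded; have [K hK] := PQ_time_bounded (`|a| + `|b|).
have Mx z : a <= z <= b -> `|z| <= `|a| + `|b|.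
  by move=> /andP[az zb]; rewrite ler_norml; have := ler_norm (- a); have := ler_norm b;
    have := normr_ge0 a; have := normr_ge0 b; rewrite normrN; lra.
split.
- exists C => t tT; have /andP[t0 _] := tT; have [_ bv _ _] := bm t0; split.
    by have [] := prim_bmf (bv a b) (@repr_U_prim _ _ _ _ _ _ (HX t0) a b).
  by move=> x _; exact: hC.
- exists K => t tT; have /andP[t0 _] := tT; have [[mP _] _ _ _] := PQ_prim hchi (HX t0) ab.
  by split=> // x /Mx xM; case: (hK t x tT xM).
- exists K => t tT; have /andP[t0 _] := tT; have [_ [mQ _] _ _] := PQ_prim hchi (HX t0) ab.
  by split=> // x /Mx xM; case: (hK t x tT xM).
Qed.

(** [energy_bounded] holds almost everywhere, whereas [Reg] bounds every point. All components are
    cut on the one set where q + h > C, which suffices since |v| and |r| are at most (q + h) / 2. *)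
Definition trunc (C : R) (f : R -> R -> R) t x : R := if q t x + h t x <= C then f t x else 0.

Definition state (f1 f2 f3 f4 : R -> R -> R) (i : 'I_4) : R -> R -> R :=
  match val i with 0%N => f1 | 1%N => f2 | 2%N => f3 | _ => f4 end.

(* q' = v, v' = h / 2 + k r + A q, h' = 2 A v, r' = - k v, where A = accel. *)
Definition system (i j : 'I_4) t x : R :=
  match val i, val j with
  | 0%N, 1%N => 1
  | 1%N, 0%N => accel t x | 1%N, 2%N => 2^-1 | 1%N, 3%N => k
  | 2%N, 1%N => 2 * accel t x
  | 3%N, 1%N => - k
  | _, _ => 0
  end.

Let lin_system f1 f2 f3 f4 (i : 'I_4) t x :
  lin system (fun _ _ _ => 0) (state f1 f2 f3 f4) i t x =
  state f2 (fun t z => 2^-1 * f3 t z + k * f4 t z + accel t z * f1 t z)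
    (fun t z => 2 * accel t z * f2 t z) (fun t z => - k * f2 t z) i t x.
Proof.
rewrite /lin !big_ord_recl big_ord0.
by case: i => [[|[|[|[|//]]]] hi]; rewrite /system /state /=; ring.
Qed.

Section Truncated.
Variable C : R.
Hypothesis C0 : 0 <= C.
Hypothesis hC : forall t, 0 <= t <= T ->
  {ae @lebesgue_measure R, forall x, a <= x <= b -> q t x + h t x <= C}.

Let trunc_aeq f t : 0 <= t <= T -> aeq a b (f t) (trunc C f t).
Proof. by move=> tT; apply: ae_S (hC tT) => x hx xab; rewrite /trunc hx. Qed.

Let W := state (trunc C q) (trunc C v) (trunc C h) (trunc C r).

Let trunc_bmf (f : R -> R -> R) t : 0 <= t -> measurable_fun setT (f t) ->
  (forall x, `|f t x| <= q t x + h t x) ->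
  measurable_fun (`[a, b] : set R) (trunc C f t) /\ forall x, a <= x <= b -> `|trunc C f t x| <= C.
Proof.
move=> t0 mf fle; have [mq _ mh _] := repr_measurable (HX t0); split.
  apply: measurable_funS (_ : measurable_fun setT _) => //.
  apply: measurable_fun_ifT => //.
  by apply: measurable_fun_ler => //; exact: measurable_funD.
move=> x _; rewrite /trunc; case: ifPn => // [|_]; last by rewrite normr0.
exact: le_trans.
Qed.

Let W_ub i : ub TS a b (W i).
Proof.
exists C => t /= tT; have /andP[t0 _] := tT.
have [mq mv mh mr] := repr_measurable (HX t0).
have qn x := repr_q_ge0 (HX t0) x; have hn x := repr_h_ge0 (HX t0) x.
case: i => [[|[|[|[|//]]]] hi]; apply: trunc_bmf => // x.
- by rewrite ger0_norm// lerDl.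
- by have := v_le x t0; have := qn x; have := hn x; lra.
- by rewrite ger0_norm// lerDr.
- by have := r_le x t0; have := qn x; have := hn x; lra.
Qed.

Let W_bmf i t : 0 <= t <= T -> bmf a b (W i t).
Proof. by move=> tT; exact: (ub_bmf (W_ub i) tT). Qed.

(** Truncation changes every component on a null set of [a, b] at each time, hence no integral over
    a subinterval. *)
Let W_wsol : wsol a b T W (lin system (fun _ _ _ => 0) W).
Proof.
have fin (f g f' g' : R -> R -> R) x y : a <= x -> x <= y -> y <= b ->
    (forall t, 0 <= t <= T -> bmf a b (f t) /\ bmf a b (f' t)) ->
    (forall t, 0 <= t <= T -> bmf a b (g t) /\ bmf a b (g' t)) ->
    (forall t, 0 <= t <= T -> aeq a b (f t) (f' t)) ->
    (forall t, 0 <= t <= T -> aeq a b (g t) (g' t)) ->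
    evol T (fun t => itg x y (f t)) (fun t => itg x y (g t)) ->
    evol T (fun t => itg x y (f' t)) (fun t => itg x y (g' t)).
  move=> ax xy yb bf bg ff gg; apply: evol_ext => t tT.
    have [b1 b2] := bf t tT; have [m1 _] := bmfS ax yb b1; have [m2 _] := bmfS ax yb b2.
    by apply: aeq_itg => //; apply: ae_S (ff t tT) => z hz /andP[xz zy]; rewrite hz// (le_trans ax)// (le_trans zy).
  have {}tT : 0 <= t <= T by case/andP: tT => ? ?; rewrite !ltW.
  have [b1 b2] := bg t tT; have [m1 _] := bmfS ax yb b1; have [m2 _] := bmfS ax yb b2.
  by apply: aeq_itg => //; apply: ae_S (gg t tT) => z hz /andP[xz zy]; rewrite hz// (le_trans ax)// (le_trans zy).
have bA t : 0 <= t <= T -> bmf a b (accel t) by case/andP => t0 _; exact: accel_bmf.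
have bc := bmf_cst a b.
have b0 t : 0 <= t <= T -> bmf a b (trunc C q t) := @W_bmf (@Ordinal 4 0 isT) t.
have b1 t : 0 <= t <= T -> bmf a b (trunc C v t) := @W_bmf (@Ordinal 4 1 isT) t.
have b2 t : 0 <= t <= T -> bmf a b (trunc C h t) := @W_bmf (@Ordinal 4 2 isT) t.
have b3 t : 0 <= t <= T -> bmf a b (trunc C r t) := @W_bmf (@Ordinal 4 3 isT) t.
move=> i x y ax xy yb.
apply: (@evol_ext _ _ (fun t => itg x y (W i t)) _ (fun t => itg x y (state (trunc C v)
  (fun t z => 2^-1 * trunc C h t z + k * trunc C r t z + accel t z * trunc C q t z)
    (fun t z => 2 * accel t z * trunc C v t z) (fun t z => - k * trunc C v t z) i t))) => //.
  by move=> t _; apply: eq_itg => z _; rewrite lin_system.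
have qT t : 0 <= t <= T -> [/\ bmf a b (q t), bmf a b (v t), bmf a b (h t) & bmf a b (r t)].
  by case/andP => t0 _; have [? ? ? ?] := bm t0.
case: i => [[|[|[|[|//]]]] hi]; rewrite /W /state/=.
- apply: fin (q_evol xy) => // t tT; first by split; [case: (qT t tT)|exact: b0].
  + by split; [case: (qT t tT)|exact: b1].
  + exact: trunc_aeq.
  + exact: trunc_aeq.
- apply: fin (v_evol xy) => // t tT; have [c1 c2 c3 c4] := qT t tT.
  + by split => //; exact: b1.
  + by split; (apply: bmfD; [apply: bmfD; apply: bmfM => //|apply: bmfM]); auto.
  + exact: trunc_aeq.
  + apply: ae_S3 (trunc_aeq q tT) (trunc_aeq h tT) (trunc_aeq r tT) => z e1 e2 e3 zab.
    by rewrite e1// e2// e3.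
- apply: fin (h_evol xy) => // t tT; have [c1 c2 c3 c4] := qT t tT.
  + by split => //; exact: b2.
  + by split; apply: bmfM => //; auto; apply: bmfM => //; auto.
  + exact: trunc_aeq.
  + by apply: ae_S (trunc_aeq v tT) => z e1 zab; rewrite e1.
- apply: fin (r_evol xy) => // t tT; have [c1 c2 c3 c4] := qT t tT.
  + by split => //; exact: b3.
  + by split; apply: bmfM => //; auto.
  + exact: trunc_aeq.
  + by apply: ae_S (trunc_aeq v tT) => z e1 zab; rewrite e1.
Qed.

Let cstR n (e : R) : Reg TS a b n (fun _ _ => e).
Proof. by apply: (@Reg_cst _ _ _ _ _ n (fun=> e) `|e|). Qed.

Let accel_Reg n : Reg TS a b n (fun t => lU (X t)) -> Reg TS a b n (fun t => Defs.Pfun chi (X t)) ->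
  Reg TS a b n accel.
Proof. by move=> rU rP; apply: RegB => //; apply: RegD => //; exact: RegX. Qed.

(** The three functions advance together: the derivative of P contains Q, and that of Q contains P
    and U through [accel]. *)
Let PQU_step n (W' : 'I_4 -> R -> R -> R) : (forall i, Reg TS a b n (W' i)) ->
  (forall i t, TS t -> aeq a b (W i t) (W' i t)) ->
  [/\ Reg TS a b n (fun t => lU (X t)), Reg TS a b n (fun t => Defs.Pfun chi (X t))
    & Reg TS a b n (fun t => Qfun chi (X t))] ->
  [/\ Reg TS a b n.+1 (fun t => lU (X t)), Reg TS a b n.+1 (fun t => Defs.Pfun chi (X t))
    & Reg TS a b n.+1 (fun t => Qfun chi (X t))].
Proof.
move=> rW eW [rU rP rQ].
have tr (f g : R -> R -> R) t : TS t -> aeq a b (trunc C f t) (g t) -> aeq a b (f t) (g t).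
  by move=> tT; apply: aeq_trans; exact: trunc_aeq.
have eq0 t (tT : TS t) := tr q _ t tT (eW (@Ordinal 4 0 isT) t tT).
have eq1 t (tT : TS t) := tr v _ t tT (eW (@Ordinal 4 1 isT) t tT).
have eq2 t (tT : TS t) := tr h _ t tT (eW (@Ordinal 4 2 isT) t tT).
have eq3 t (tT : TS t) := tr r _ t tT (eW (@Ordinal 4 3 isT) t tT).
have uU := Reg_ub rU; have uP := Reg_ub rP; have uQ := Reg_ub rQ.
split; (split; [assumption|]).
- exists (W' (@Ordinal 4 1 isT)) => // t tT; have /andP[t0 _] := tT; have [_ bv _ _] := bm t0.
  apply: (prim_aeq (bmf_intg (bv a b)) _ (eq1 t tT)); last exact: (@repr_U_prim _ _ _ _ _ _ (HX t0) a b).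
  by have [] := Reg_bmf (rW (@Ordinal 4 1 isT)) tT.
- exists (fun t x => Qfun chi (X t) x * W' (@Ordinal 4 0 isT) t x); first exact: RegM.
  move=> t tT; have /andP[t0 _] := tT; have [bq _ _ _] := bm t0.
  have [_ bQ pP _] := PQ_prim hchi (HX t0) ab.
  apply: (prim_aeq _ _ _ pP); first by apply/bmf_intg/bmfM.
    by have [] := bmfM bQ (Reg_bmf (rW (@Ordinal 4 0 isT)) tT).
  by apply: ae_S (eq0 t tT) => z e zab; rewrite e.
- pose G t x := - (2^-1 * W' (@Ordinal 4 2 isT) t x + k * W' (@Ordinal 4 3 isT) t x +
    accel t x * W' (@Ordinal 4 0 isT) t x).
  have rG : Reg TS a b n G.
    apply: (RegN ab); apply: RegD; first by apply: RegD; exact: RegZ.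
    by apply: RegM => //; exact: accel_Reg.
  exists G => // t tT; have /andP[t0 _] := tT; have [bq bv bh br] := bm t0.
  have [_ _ _ pQ] := PQ_prim hchi (HX t0) ab.
  have bA := accel_bmf t0 ab; have bc := bmf_cst a b.
  rewrite (lk_cst t0) in pQ; apply: (prim_aeq _ _ _ pQ).
  + by apply: bmf_intg; apply: bmfN; apply: bmfD; [apply: bmfD; exact: bmfM|exact: bmfM].
  + by have [] := Reg_bmf rG tT.
  + apply: ae_S3 (eq0 t tT) (eq2 t tT) (eq3 t tT) => z e1 e2 e3 zab.
    by rewrite /G -e1// -e2// -e3.
Qed.

Lemma state_regularity n :
  (forall i, exists2 w, Creg n a b w & aeq a b (W i 0) w) ->
  exists2 W', forall i, Reg TS a b n (W' i) & forall i t, TS t -> aeq a b (W i t) (W' i t).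
Proof.
move=> init.
(* U, P and Q are carried along with the state. In the induction step they are raised first, so that
   the coefficients have order m + 1 when [linear_regularity] is applied at that order. *)
suff claim m : (m <= n)%N -> [/\ Reg TS a b m (fun t => lU (X t)),
    Reg TS a b m (fun t => Defs.Pfun chi (X t)) & Reg TS a b m (fun t => Qfun chi (X t))] /\
    exists2 W', forall i, Reg TS a b m (W' i) & forall i t, TS t -> aeq a b (W i t) (W' i t).
  by case: (claim n (leqnn n)).
elim: m => [_|m IH mn].
  by split; [exact: PQU_base|exists W => [i|i t _]; [exact: W_ub|exact: ae_T]].
have [rPQU [W' rW eW]] := IH (ltnW mn).
have rPQU' := PQU_step rW eW rPQU; split => //; have [rU rP _] := rPQU'.
have rA := accel_Reg rU rP.
have [|i|i|i|i|W2 hW2] := @linear_regularity _ 4 a b T ab Tpos m.+1 system (fun _ _ _ => 0) W.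
- case=> [[|[|[|[|//]]]] hi] [[|[|[|[|//]]]] hj]; try exact: (cstR m.+1 _).
  + exact: rA.
  + exact: (RegZ ab 2 rA).
- exact: cstR.
- exact: W_ub.
- exact: W_wsol.
- have [w rw ew] := init i; exists w => //; exact: Reg_leq mn rw.
by exists W2 => [i|i t tT]; case: (hW2 i) => // _; apply.
Qed.

End Truncated.

End Interval.

(** At order 0 the representative is changed on a null set by a maximum with [d]; at positive order
    it is Lipschitz and the a.e. bound already holds everywhere. *)
Lemma Creg_ge n a b f d : a < b -> Creg n a b f ->
  {ae @lebesgue_measure R, forall x, a <= x <= b -> d <= f x} ->
  exists g, [/\ Creg n a b g, aeq a b f g & forall x, a <= x <= b -> d <= g x].
Proof.
move=> ab; case: n => [|n] Cf fd.
  exists (fun x => Num.max d (f x)); split.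
  - have [mf [C hC]] := Creg_bmf Cf; apply/Creg0; split; first exact: measurable_maxr.
    exists (`|d| + C) => x /hC fC; have := normr_ge0 d; have := normr_ge0 (f x).
    by case: (leP d (f x)) => _; lra.
  - by apply: ae_S fd => x h xab; rewrite max_r// h.
  - by move=> x _; rewrite le_max lexx.
have /CregS[g Cg pg] := Cf; have [K K0 lf] := prim_bmf_lip (Creg_bmf Cg) pg.
by exists f; split => //; [exact: ae_T|exact: ae_lip_ge lf fd].
Qed.

Theorem lagrangian_regularity n a b t c0 (q0 v0 h0 r0 : R -> R) : a < b -> 0 <= t -> 0 < c0 ->
  [/\ Creg n a b q0, Creg n a b v0, Creg n a b h0 & Creg n a b r0] ->
  [/\ aeq a b (y_xi (X 0)) q0, aeq a b (U_xi (X 0)) v0, aeq a b (lh (X 0)) h0 &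
    aeq a b (rbar (X 0)) r0] ->
  {ae @lebesgue_measure R, forall x, a <= x <= b -> c0 <= lr (X 0) x ^+ 2} ->
  exists (d : R) (q v h r : R -> R), [/\ 0 < d, forall x, a <= x <= b -> d <= q x,
    [/\ Creg n a b q, Creg n a b v, Creg n a b h & Creg n a b r],
    [/\ aeq a b (y_xi (X t)) q, aeq a b (U_xi (X t)) v, aeq a b (lh (X t)) h &
      aeq a b (rbar (X t)) r] &
    prim a b (ly (X t)) q /\ prim a b (lU (X t)) v].
Proof.
move=> ab t0 c00 [Cq Cv Ch Cr] [eq0 ev0 eh0 er0] hc0.
have [G _ _ _] := hX.
have /choice[F hF] : forall s, exists p : (R -> R) * (R -> R) * (R -> R) * (R -> R),
    0 <= s -> lagrangian_repr (X s) p.1.1.1 p.1.1.2 p.1.2 p.2.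
  move=> s; have [s0|s0] := leP 0 s; last by exists (cst 0, cst 0, cst 0, cst 0).
  by have [q [v [h [r H]]]] := calG_repr hchi (G s s0); exists (q, v, h, r).
pose q s := (F s).1.1.1; pose v s := (F s).1.1.2; pose h s := (F s).1.2; pose r s := (F s).2.
have HX s : 0 <= s -> lagrangian_repr (X s) (q s) (v s) (h s) (r s) by exact: hF.
(* The horizon exceeds [t], so that [0, T] is nondegenerate also for t = 0. *)
pose T := t + 1; have Tpos : 0 < T by rewrite ltr_wpDl.
have tT : 0 <= t <= T by rewrite t0 /T lerDl ler01.
have T0 := ltW Tpos; have [C C0 hC] := energy_bounded T0 HX ab.
have z0T : (0 : R) <= 0 <= T by rewrite lexx.
have tr (f : R -> R -> R) s : 0 <= s <= T -> aeq a b (f s) (trunc q h C f s).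
  by move=> sT; apply: ae_S (hC s sT) => x hx xab; rewrite /trunc hx.
have init (i : 'I_4) : exists2 w, Creg n a b w &
    aeq a b (state (trunc q h C q) (trunc q h C v) (trunc q h C h) (trunc q h C r) i 0) w.
  case: i => [[|[|[|[|//]]]] hi]; rewrite /state/=; [exists q0|exists v0|exists h0|exists r0] => //.
  - apply: aeq_trans (aeq_sym (tr q 0 z0T)) (aeq_trans _ eq0).
    by apply: ae_S (repr_y_xi (HX 0 (lexx 0))) => x.
  - apply: aeq_trans (aeq_sym (tr v 0 z0T)) (aeq_trans _ ev0).
    by apply: ae_S (repr_U_xi (HX 0 (lexx 0))) => x.
  - apply: aeq_trans (aeq_sym (tr h 0 z0T)) (aeq_trans _ eh0).
    by apply: ae_S (repr_lh (HX 0 (lexx 0))) => x.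
  - apply: aeq_trans (aeq_sym (tr r 0 z0T)) (aeq_trans _ er0).
    by apply: ae_S (repr_rbar (HX 0 (lexx 0))) => x.
have [W' rW eW] := state_regularity T0 HX ab Tpos C0 hC init.
have CW i : Creg n a b (W' i t) by exact: Reg_at (rW i).
have eq1 := aeq_trans (tr q t tT) (eW (@Ordinal 4 0 isT) t tT).
have ev1 := aeq_trans (tr v t tT) (eW (@Ordinal 4 1 isT) t tT).
have eh1 := aeq_trans (tr h t tT) (eW (@Ordinal 4 2 isT) t tT).
have er1 := aeq_trans (tr r t tT) (eW (@Ordinal 4 3 isT) t tT).
have [d d0 hd] : exists2 d, 0 < d & forall s, 0 <= s <= T ->
    {ae @lebesgue_measure R, forall x, a <= x <= b -> d <= q s x}.
  apply: (q_lower_bound T0 HX ab c00).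
  apply: ae_S3 hc0 (repr_y_xi (HX 0 (lexx 0))) (repr_rbar (HX 0 (lexx 0))) => x hx -> -> xab.
  by rewrite /rbar subrK hx.
have [q' [Cq' qq' qd]] : exists g, [/\ Creg n a b g, aeq a b (W' (@Ordinal 4 0 isT) t) g &
    forall x, a <= x <= b -> d <= g x].
  apply: Creg_ge => //; apply: ae_S2 (hd t tT) eq1 => x h1 h2 xab.
  by rewrite -h2// h1.
have [bq bv _ _] := repr_bmf (HX t t0).
have eqq' := aeq_trans eq1 qq'.
exists d, q', (W' (@Ordinal 4 1 isT) t), (W' (@Ordinal 4 2 isT) t), (W' (@Ordinal 4 3 isT) t).
split => //.
- split.
  + by apply: aeq_trans eqq'; apply: ae_S (repr_y_xi (HX t t0)) => x ->.
  + by apply: aeq_trans ev1; apply: ae_S (repr_U_xi (HX t t0)) => x ->.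
  + by apply: aeq_trans eh1; apply: ae_S (repr_lh (HX t t0)) => x ->.
  + by apply: aeq_trans er1; apply: ae_S (repr_rbar (HX t t0)) => x ->.
- split.
  + apply: (prim_aeq (bmf_intg (bq a b)) _ eqq'); last exact: (@repr_y_prim _ _ _ _ _ _ (HX t t0) a b).
    by have [] := Creg_bmf Cq'.
  + apply: (prim_aeq (bmf_intg (bv a b)) _ ev1); last exact: (@repr_U_prim _ _ _ _ _ _ (HX t t0) a b).
    by have [] := Creg_bmf (CW (@Ordinal 4 1 isT)).
Qed.

End Trajectory.

(** * Initial data and return to Eulerian coordinates *)

Section InitialData.
Context {R : realType}.
Implicit Types (x y xi : R).

(** The singular part is carried by a null set [N]. As [mu] vanishes on the null set A intersected
    with [N], so does the singular part, which therefore vanishes on all of [A]. *)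
Lemma ac_part_dominated (mu nu : set (measurableTypeR R) -> \bar R) (I : set R) :
  is_ac_part mu nu -> (forall A, (0 <= nu A)%E) ->
  (forall A : set (measurableTypeR R), measurable A -> A `<=` I -> (leb A = 0 -> mu A = 0)%E) ->
  forall A : set (measurableTypeR R), measurable A -> A `<=` I -> mu A = nu A.
Proof.
move=> [_ [mus [[N [mN N0 musN]] E]]] nu0 munull A mA AI.
suff musA : mus A = 0%E by rewrite E// musA adde0.
have E0 : mus (A `\` N) = 0%E.
  apply/eqP; rewrite eq_le measure_ge0 andbT -musN.
  by apply: le_measure; rewrite ?inE//; [exact: measurableD|exact: measurableC].
have -> : mus A = (mus (A `\` N) + mus (A `&` N))%E by exact: measureDI.
rewrite E0 add0e; apply/eqP; rewrite eq_le measure_ge0 andbT.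
have mAN : measurable (A `&` N) by exact: measurableI.
rewrite -(munull (A `&` N)) ?E ?leeDr//.
- by move=> x [/AI].
- apply/eqP; rewrite eq_le measure_ge0 andbT -N0.
  by apply: le_measure; rewrite ?inE.
Qed.

(** [p_regular] provides some absolutely continuous part, [calD] the one with density u_x^2 +
    rhobar^2. Where [mu] equals the former it charges no null set, hence it equals the latter. *)
Lemma ac_part_eq (mu nu nu' : set (measurableTypeR R) -> \bar R) (I : set R) :
  is_ac_part mu nu -> is_ac_part mu nu' -> (forall A, (0 <= nu A)%E) ->
  (forall A : set (measurableTypeR R), measurable A -> A `<=` I -> mu A = nu' A) ->
  forall A : set (measurableTypeR R), measurable A -> A `<=` I -> mu A = nu A.
Proof.
move=> ac [dom _] nu0 h; apply: (ac_part_dominated ac nu0) => A mA AI A0.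
rewrite h//; apply: (dom A) => //; exact/measure0_null_setP.
Qed.

Lemma aeq_eq (a b K : R) (f g : R -> R) : a < b -> continuous f -> lip a b g K ->
  aeq a b f g -> forall x, a <= x <= b -> f x = g x.
Proof.
move=> ab cf lg fg x xab; have /andP[ax xb] := xab.
have K0 : 0 <= `|K| by [].
have {}lg : lip a b g `|K| by apply: lipW lg _; exact: ler_norm.
apply/eqP; rewrite -subr_eq0 -normr_le0; apply/ler_addgt0Pl => e e0; rewrite addr0.
have /cvgrPdist_lt /(_ (e / 2)) := cf x; rewrite divr_gt0// => /(_ isT) /nbhs_ballP[d /= d0 hd].
pose m := Num.min d (e / (2 * (`|K| + 1))).
have m0 : 0 < m by rewrite lt_min d0 divr_gt0// mulr_gt0// ltr_wpDl.
have md : m <= d by rewrite ge_min lexx.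
have mK : `|K| * m <= e / 2.
  have : m * (2 * (`|K| + 1)) <= e.
    by rewrite -ler_pdivlMr ?mulr_gt0 ?ltr_wpDl// ge_min lexx orbT.
  by move: (ltW m0); nra.
have [a' [b' [ab' a'a bb' a'm b'm]]] : exists a' b', [/\ a' < b', a <= a', b' <= b, x - m < a' & b' < x + m].
  have [xb'|bx] := ltP x b.
    exists x, (Num.min b (x + m / 2)); split => //.
    - by rewrite lt_min xb' ltrDl divr_gt0.
    - by rewrite ge_min lexx.
    - lra.
    - by rewrite gt_min; apply/orP; right; lra.
  exists (Num.max a (x - m / 2)), x; split=> //.
  - by rewrite gt_max (lt_le_trans ab bx)/=; lra.
  - by rewrite le_max lexx.
  - by rewrite lt_max; apply/orP; right; lra.
  - lra.
have [z zab fgz] : exists2 z, a' <= z <= b' & f z = g z.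
  apply: ae_ex ab' _; apply: ae_S fg => z hz /andP[az zb]; apply: hz.
  by rewrite (le_trans a'a)// (le_trans zb).
have zx : `|x - z| < m by rewrite ltr_norml; lra.
have fz : `|f x - f z| < e / 2 by apply: hd; exact: lt_le_trans zx md.
have gz : `|g x - g z| <= e / 2.
  apply: le_trans mK; apply: le_trans (lip_sym lg _ xab) _; first by lra.
  by rewrite ler_wpM2l// ltW.
have -> : f x - g x = (f x - f z) - (g x - g z) by rewrite fgz; ring.
by rewrite (le_trans (ler_normB _ _))//; lra.
Qed.

Variables (chi : R -> R) (hchi : cutoff chi) (D0 : eulerian R).
Hypothesis hD0 : calD chi D0.

Local Notation mu := (emu D0).
Local Notation y := (ly (Lmap D0)).

Let M x : R := fine (mu `]-oo, x[%classic).
Let F x : R := M x + x.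

Let muE x : mu `]-oo, x[%classic = (M x)%:E.
Proof. by rewrite fineK// fin_num_measure. Qed.

Let M_ge0 x : 0 <= M x. Proof. by rewrite fine_ge0. Qed.

Let M_le x : M x <= fine (mu setT).
Proof.
rewrite fine_le ?fin_num_measure//; apply: le_measure; rewrite ?inE//.
Qed.

Let F_lt x x' : x < x' -> F x < F x'.
Proof.
move=> xx'; rewrite ler_ltD// fine_le ?fin_num_measure//; apply: le_measure; rewrite ?inE//.
by move=> z /=; rewrite !in_itv/= => h; exact: lt_trans h xx'.
Qed.

Let yE xi : y xi = sup [set x | F x < xi].
Proof.
rewrite /ly /Lmap/= addrC subrK; congr sup; apply/seteqP; split => x /=.
  by rewrite muE -EFinD lte_fin.
by rewrite muE -EFinD lte_fin.
Qed.

Let S_nonempty xi : [set x | F x < xi] !=set0.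
Proof.
exists (xi - fine (mu setT) - 1); rewrite /= /F; have := M_le (xi - fine (mu setT) - 1); lra.
Qed.

Let S_bounded xi : has_ubound [set x | F x < xi].
Proof. by exists xi => x /=; rewrite /F; have := M_ge0 x; lra. Qed.

Lemma y_homo xi xi' : xi <= xi' -> y xi <= y xi'.
Proof.
move=> h; rewrite !yE; apply: le_sup.
- by move=> x /= xxi; exists x; split => //=; exact: lt_le_trans xxi h.
- exact: S_nonempty.
- by split; [exact: S_nonempty|exact: S_bounded].
Qed.

(** [F] is strictly increasing even where it jumps, so the generalized inverse undoes it exactly.
    The other composition fails across jumps, which is why [Phi] is introduced later. *)
Let yF x : y (F x) = x.
Proof.
rewrite yE; apply/eqP; rewrite eq_le; apply/andP; split.
  apply: ge_sup; first exact: S_nonempty.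
  by move=> z /= h; rewrite leNgt; apply/negP => /F_lt; lra.
apply/ler_addgt0Pl => e e0; rewrite -lerBlDl; apply: ub_le_sup; first exact: S_bounded.
by apply: F_lt; lra.
Qed.

Let eu_continuous : continuous (eu D0).
Proof.
have [[c [cu _ _]] _ _] := hD0 => x.
rewrite (_ : eu D0 = fun x => (eu D0 x - c * chi x) + c * chi x); last first.
  by apply/funext => z; rewrite subrK.
apply: cvgD; first exact: cu.
by apply: cvgM; [exact: cvg_cst|exact: cutoff_continuous].
Qed.

Let eu_weak : is_weak_derivative setT (eu D0) (wderiv (eu D0)).
Proof.
have [[c [cu _ [w uw _]]] _ _] := hD0; apply: wderivP; eexists.
rewrite (_ : eu D0 = fun x => (eu D0 x - c * chi x) + c * chi x); last first.
  by apply/funext => z; rewrite subrK.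
apply: is_weak_derivative_lin uw _.
apply: (@prim_is_weak_derivative _ chi (derive1 chi)).
- exact: cutoff_continuous.
- by apply: continuous_measurable_fun; exact: cutoff_derive_continuous.
- by move=> a b; exact/continuous_bmf/cutoff_derive_continuous.
- by move=> a b; apply: derive_prim; [exact: cutoff_derive|exact: cutoff_derive_continuous].
Qed.

Let erho_measurable : measurable_fun setT (erho D0).
Proof.
have [_ [k Lk] _] := hD0; have mk := L2_measurable Lk.
rewrite (_ : erho D0 = fun x => (erho D0 x - k) + k); first exact: measurable_funD.
by apply/funext => z; rewrite subrK.
Qed.

Variables (p : nat) (x0 x1 : R).
Hypotheses (p1 : (1 <= p)%N) (x01 : x0 < x1) (hreg : p_regular p [set` `]x0, x1[] D0).

(** As p >= 1, the iterated-primitive representative of u is Lipschitz, so it coincides with the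
    continuous [eu D0] on all of [x0, x1], end points included. *)
Lemma eulerian_repr : exists g s, [/\ Creg p.-1 x0 x1 g, Creg p.-1 x0 x1 s,
  prim x0 x1 (eu D0) g, aeq x0 x1 (wderiv (eu D0)) g & aeq x0 x1 (erho D0) s].
Proof.
have [Wu Ws _] := hreg.
have [s Cs rs] := Winfty_Creg hchi x01 Ws.
have [f Cf uf] := Winfty_Creg hchi x01 Wu.
have : Creg p.-1.+1 x0 x1 f by rewrite prednK.
move=> /CregS[g Cg pg]; have [K _ lf] := prim_bmf_lip (Creg_bmf Cg) pg.
have E := aeq_eq x01 eu_continuous lf (ae_oo_cc uf).
have pu : prim x0 x1 (eu D0) g.
  move=> x z ax xz zb; rewrite !E ?pg//; first by rewrite ax (le_trans xz).
  by rewrite zb (le_trans ax).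
have [iw pw] := weak_derivative_continuous x0 x1 hchi eu_weak eu_continuous erefl.
exists g, s; split => //; last exact: ae_oo_cc.
exact: prim_unique iw (bmf_intg (Creg_bmf Cg)) pw pu.
Qed.

Section Representatives.
Variables (g s : R -> R).
Hypotheses (Cg : Creg p.-1 x0 x1 g) (Cs : Creg p.-1 x0 x1 s).
Hypotheses (wg : aeq x0 x1 (wderiv (eu D0)) g) (rs : aeq x0 x1 (erho D0) s).

Let k := L2const_cst (erho D0).
Let w x : R := 1 + (g x ^+ 2 + (s x - k) ^+ 2).

Let Cw : Creg p.-1 x0 x1 w.
Proof.
have ck (c : R) : Creg p.-1 x0 x1 (fun=> c) by apply: (@Reg_cst _ _ _ _ _ _ (fun=> c) `|c|).
apply: RegD; first exact: ck.
apply: RegD; apply: (RegX x01) => //; exact: (RegB x01 Cs (ck k)).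
Qed.

Let w_ge1 x : 1 <= w x.
Proof. by rewrite lerDl addr_ge0// sqr_ge0. Qed.

Let mu_itv x : x0 < x -> x < x1 -> mu `[x, x1[%classic = (itg x x1 (fun z => w z - 1))%:E.
Proof.
move=> x0x xx1; have [_ _ ac] := hD0; have [_ _ [nu acnu munu]] := hreg.
have [_ [mw _ _] _] := eu_weak.
have f0 A : (0 <= \int[leb]_(x in A) (wderiv (eu D0) x ^+ 2 + erhobar D0 x ^+ 2)%:E)%E.
  by apply: integral_ge0 => z _; rewrite lee_fin addr_ge0// sqr_ge0.
have -> := ac_part_eq ac acnu f0 munu (A := `[x, x1[%classic) (measurable_itv _); last first.
  by move=> z /=; rewrite !in_itv/= => /andP[xz ->]; rewrite (lt_le_trans x0x).
have mf : measurable_fun setT (fun x => wderiv (eu D0) x ^+ 2 + erhobar D0 x ^+ 2).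
  by apply: measurable_funD; apply: measurable_funX => //; exact: measurable_funB.
rewrite integral_itv_bndo_bndc; last by apply/measurable_EFinP; exact: measurable_funS mf.
have bw : bmf x x1 (fun z => w z - 1).
  apply: bmfD; last exact: bmf_cst.
  exact: bmfS (ltW x0x) (lexx _) (Creg_bmf Cw).
rewrite /itg /Rintegral fineK; last first.
  by apply: integrable_fin_num => //; exact: bmf_intg.
apply: ae_eq_integral => //.
- by apply/measurable_EFinP; exact: measurable_funS mf.
- by apply/measurable_EFinP; case: bw.
apply: ae_S2 wg rs => z h1 h2; rewrite /= in_itv/= => /andP[xz zx1].
have z01 : x0 <= z <= x1 by rewrite zx1 (le_trans (ltW x0x)).
congr EFin; rewrite h1// /erhobar h2// /w /k; ring.
Qed.

(* mu may have an atom at x0, where F then jumps; Phi agrees with F on ]x0, x1] and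
   is continuous on [x0, x1]. *)
Let Phi x : R := F x1 - itg x x1 w.

Let Phi_prim : prim x0 x1 Phi w.
Proof.
move=> x z ax xz zb; have iw := bmf_intg (bmfS ax (lexx _) (Creg_bmf Cw)).
by rewrite /Phi (itg_cat xz zb iw); ring.
Qed.

Let Phi_expand := prim_expand (Creg_bmf Cw) Phi_prim (fun x _ => w_ge1 x).

Let PhiE x : x0 < x -> x <= x1 -> Phi x = F x.
Proof.
move=> x0x; rewrite le_eqVlt => /predU1P[->|xx1]; first by rewrite /Phi itgxx subr0.
have iw : intg x x1 w := bmf_intg (bmfS (ltW x0x) (lexx _) (Creg_bmf Cw)).
have e : M x1 = M x + itg x x1 (fun z => w z - 1).
  apply: EFin_inj; rewrite EFinD -mu_itv// -!muE -measureU//.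
  - by congr (mu _); rewrite -itv_bndbnd_setU//= bnd_simp ltW.
  - apply/seteqP; split=> // z []; rewrite /= !in_itv/= => zx /andP[xz _].
    by move: (lt_le_trans zx xz); rewrite ltxx.
rewrite /Phi /F e itgB//; last exact: intg_cst.
by rewrite itg_cst ?ltW//; ring.
Qed.

(** Only x = x0 is delicate. From above, y (Phi x0) <= y (F z) = z for every z slightly larger than
    x0; from below, F x0 <= Phi x0, because Phi x0 is the limit of the larger values F z. *)
Let yPhi x : x0 <= x <= x1 -> y (Phi x) = x.
Proof.
move=> /andP[]; rewrite le_eqVlt => /predU1P[<- _|x0x xx1]; last by rewrite PhiE.
have [K K0 lP] := prim_bmf_lip (Creg_bmf Cw) Phi_prim.
apply/eqP; rewrite eq_le; apply/andP; split.
  apply/ler_addgt0Pl => e e0.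
  pose z := Num.min x1 (x0 + e); have zx0 : x0 < z by rewrite lt_min x01 ltrDl.
  have zx1 : z <= x1 by rewrite ge_min lexx.
  have zpe : z <= e + x0 by rewrite ge_min addrC lexx orbT.
  apply: le_trans zpe; rewrite -[X in _ <= X](yF z) -PhiE//; apply: y_homo.
  rewrite -subr_ge0; apply: le_trans (Phi_expand (lexx _) (ltW zx0) zx1).
  by rewrite mul1r subr_ge0 ltW.
rewrite -[X in X <= _](yF x0); apply: y_homo; apply/ler_addgt0Pl => e e0.
pose z := Num.min x1 (x0 + e / (K + 1)).
have K1 : 0 < K + 1 by rewrite ltr_wpDl.
have zx0 : x0 < z by rewrite lt_min x01 ltrDl divr_gt0.
have zx1 : z <= x1 by rewrite ge_min lexx.
have zpe : (z - x0) * (K + 1) <= e.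
  by rewrite -ler_pdivlMr// lerBlDl ge_min lexx orbT.
have := lP x0 z (lexx _) (ltW zx0) zx1; have := F_lt zx0; rewrite -(PhiE zx0 zx1).
move=> h1 h2; have h3 := le_trans (ler_norm _) h2.
have : 0 <= z - x0 by rewrite subr_ge0 ltW.
lra.
Qed.

Let Phi_lt x z : x0 <= x -> x < z -> z <= x1 -> Phi x < Phi z.
Proof.
move=> ax xz zb; rewrite -subr_gt0; apply: lt_le_trans (Phi_expand ax (ltW xz) zb).
by rewrite mul1r subr_gt0.
Qed.

Let Phi_surj eta : Phi x0 <= eta <= Phi x1 -> x0 <= y eta <= x1 /\ Phi (y eta) = eta.
Proof.
move=> /andP[h1 h2]; have [K K0 lP] := prim_bmf_lip (Creg_bmf Cw) Phi_prim.
have h01 := Phi_lt (lexx _) x01 (lexx _).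
have [|x] := @IVT R Phi x0 x1 eta (ltW x01) (lip_continuous lP).
  by rewrite min_l ?max_r ?h1 ?h2// ltW.
by rewrite in_itv/= => xab <-; rewrite yPhi.
Qed.

(** A larger xi with y xi <= x0 could be cut down into [Phi x0, Phi x1], where y inverts [Phi]; this
    would give y = x0 at a point other than Phi x0. *)
Let xi0E : sup [set xi | y xi <= x0] = Phi x0.
Proof.
have y0 : y (Phi x0) = x0 by rewrite yPhi// lexx ltW.
have ub : ubound [set xi | y xi <= x0] (Phi x0).
  move=> xi /= h; rewrite leNgt; apply/negP => h'.
  pose xi' := Num.min xi (Phi x1).
  have h2 : Phi x0 < xi' by rewrite lt_min h' Phi_lt.
  have [/andP[a1 a2] E] : x0 <= y xi' <= x1 /\ Phi (y xi') = xi'.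
    by apply: Phi_surj; rewrite (ltW h2) ge_min lexx orbT.
  have : y xi' <= x0 by apply: le_trans h; apply: y_homo; rewrite ge_min lexx.
  move=> h3; have e : y xi' = x0 by apply/eqP; rewrite eq_le h3.
  by move: h2; rewrite -E e ltxx.
apply/eqP; rewrite eq_le; apply/andP; split.
  by apply: ge_sup ub; exists (Phi x0); rewrite /= y0.
by apply: ub_le_sup; [exists (Phi x0)|rewrite /= y0].
Qed.

Let xi1E : inf [set xi | x1 <= y xi] = Phi x1.
Proof.
have y1 : y (Phi x1) = x1 by rewrite yPhi// lexx ltW.
have lb : lbound [set xi | x1 <= y xi] (Phi x1).
  move=> xi /= h; rewrite leNgt; apply/negP => h'.
  pose xi' := Num.max xi (Phi x0).
  have h2 : xi' < Phi x1 by rewrite gt_max h' Phi_lt.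
  have [/andP[a1 a2] E] : x0 <= y xi' <= x1 /\ Phi (y xi') = xi'.
    by apply: Phi_surj; rewrite (ltW h2) le_max lexx orbT.
  have : x1 <= y xi' by apply: le_trans h _; apply: y_homo; rewrite le_max lexx.
  move=> h3; have e : y xi' = x1 by apply/eqP; rewrite eq_le a2.
  by move: h2; rewrite -E e ltxx.
apply/eqP; rewrite eq_le; apply/andP; split.
  by apply: ge_inf; [exists (Phi x1)|rewrite /= y1].
by apply: lb_le_inf lb; exists (Phi x1); rewrite /= y1.
Qed.

Let y_Creg : Creg p.-1 (Phi x0) (Phi x1) (fun xi => (w (y xi))^-1) /\
  prim (Phi x0) (Phi x1) y (fun xi => (w (y xi))^-1).
Proof. by apply: (Creg_inverse x01 ltr01 Cw Phi_prim) => // x _; exact: w_ge1. Qed.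

Variables (X : lagrangian R) (c0 : R).
Hypotheses (GX : calG chi X) (eX : Defs.eqE X (Lmap D0)) (c00 : 0 < c0) (pug : prim x0 x1 (eu D0) g)
  (hrho : {ae @lebesgue_measure R, forall x, x0 < x < x1 -> c0 <= erho D0 x ^+ 2}).

Let lyX : ly X = y.
Proof. by have [h _ _ _] := eX; rewrite /ly h. Qed.

Let a := Phi x0.
Let b := Phi x1.
Let q0 xi : R := (w (y xi))^-1.

Lemma initial_data_repr : [/\ a < b, sup [set xi | ly X xi <= x0] = a,
  inf [set xi | x1 <= ly X xi] = b, ly X a = x0 /\ ly X b = x1 &
  exists (v0 h0 r0 : R -> R) (c1 : R), [/\ 0 < c1,
  [/\ Creg p.-1 a b q0, Creg p.-1 a b v0, Creg p.-1 a b h0 & Creg p.-1 a b r0],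
  [/\ aeq a b (y_xi X) q0, aeq a b (U_xi X) v0, aeq a b (lh X) h0 & aeq a b (rbar X) r0] &
  {ae @lebesgue_measure R, forall x, a <= x <= b -> c1 <= lr X x ^+ 2}]].
Proof.
have ab : a < b by exact: Phi_lt.
have x00 : x0 <= x0 <= x1 by rewrite lexx ltW.
have x11 : x0 <= x1 <= x1 by rewrite lexx ltW.
rewrite !lyX xi0E xi1E !yPhi//; split => //.
have [Cq pq] := y_Creg; rewrite -/a -/b -/q0 in Cq pq.
have [Kw Kw0 hKw] := Reg_unif Cw.
have wK x : x0 <= x <= x1 -> w x <= Kw.
  by move=> /(hKw tt _ I); apply: le_trans; exact: ler_norm.
have Kw1 : 0 < Kw by apply: lt_le_trans (wK x0 x00); apply: lt_le_trans (w_ge1 x0).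
have yab xi : a <= xi <= b -> x0 <= y xi <= x1 by move=> /Phi_surj[].
have q0e xi : a <= xi <= b -> Kw^-1 <= q0 xi.
  move=> /yab /wK h; rewrite /q0 lef_pV2 ?posrE//; exact: lt_le_trans (w_ge1 _).
have Kv0 : 0 < Kw^-1 by rewrite invr_gt0.
have yexp := prim_expand (Creg_bmf Cq) pq q0e.
have my : measurable_fun (`[a, b] : set R) y by have [] := prim_bmf (Creg_bmf Cq) pq.
have Cq' : Creg p.-1.-1 a b q0 by apply: Reg_leq Cq; exact: leq_pred.
have Cgy : Creg p.-1 a b (fun xi => g (y xi)) by exact: Creg_comp ab x01 Kv0 Cq' pq q0e yab Cg.
have Csy : Creg p.-1 a b (fun xi => s (y xi)) by exact: Creg_comp ab x01 Kv0 Cq' pq q0e yab Cs.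
have ck (c : R) : Creg p.-1 a b (fun=> c) by apply: (@Reg_cst _ _ _ _ _ _ (fun=> c) `|c|).
have [q [v [h [r HX]]]] := calG_repr hchi GX.
have [bq bv _ _] := repr_bmf HX.
have pyX : prim a b (ly X) q0 by rewrite lyX.
have yq : aeq a b (y_xi X) q0.
  have iq0 := bmf_intg (Creg_bmf Cq).
  by apply: ae_S2 (repr_y_xi HX) (prim_unique (bmf_intg (bq a b)) iq0
    (@repr_y_prim _ _ _ _ _ _ HX a b) pyX) => x <-.
have Uv : aeq a b (U_xi X) (fun xi => g (y xi) * q0 xi).
  have [bgy pU] := prim_comp ab x01 Kv0 (Creg_bmf Cq) pq yexp yab (Creg_bmf Cg) pug.
  have UX : lU X = fun xi => eu D0 (y xi).
    have [_ -> _ _] := eX; apply/funext => xi; rewrite /Lmap/= /ly/=; congr (eu D0 _).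
    by rewrite addrC subrK.
  rewrite -UX in pU.
  have i1 : intg a b (fun xi => g (y xi) * q0 xi) by apply/bmf_intg/bmfM => //; exact: Creg_bmf Cq.
  by apply: ae_S2 (repr_U_xi HX) (prim_unique (bmf_intg (bv a b)) i1 (@repr_U_prim _ _ _ _ _ _ HX a b) pU) => x <-.
have wy : y_xi X = wderiv (fun xi => sup [set x | (emu D0 `]-oo, x[%classic + x%:E < xi%:E)%E]).
  rewrite /y_xi lyX; congr wderiv; apply/funext => xi; rewrite /ly/=.
  by rewrite addrC subrK.
have yy xi : sup [set x | (emu D0 `]-oo, x[%classic + x%:E < xi%:E)%E] = y xi.
  by rewrite /ly/= addrC subrK.
have hE : aeq a b (lh X) (fun xi => 1 - q0 xi).
  have [_ _ hh _] := eX; apply: ae_S2 hh yq => xi -> e xab.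
  by rewrite /Lmap/= -wy e.
(* rho_0 equals [s] only almost everywhere. Since y has slope at least 1 / Kw on [a, b], the
   exceptional set is pulled back to a null set. *)
have rE : aeq a b (lr X) (fun xi => s (y xi) * q0 xi).
  have [_ _ _ hr] := eX.
  apply: ae_S3 hr yq (preimage_null ab Kv0 my yexp rs) => xi -> e1 e2 xab.
  by rewrite /Lmap/= -wy yy e1// e2//; exact: yab.
(* r = rho_0(y) y_xi with y_xi >= 1 / Kw and rho_0^2 >= c0, whence the constant c0 / Kw^2. *)
exists (fun xi => g (y xi) * q0 xi), (fun xi => 1 - q0 xi),
  (fun xi => s (y xi) * q0 xi - lk X * q0 xi), (c0 * Kw^-1 ^+ 2).
split.
- by rewrite mulr_gt0// exprn_gt0.
- split => //; first exact: RegM.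
    exact: (RegB ab (ck 1) Cq).
  by apply: (RegB ab); [exact: RegM|exact: (RegZ ab)].
- split => //; apply: ae_S2 rE yq => xi e1 e2 xab.
  by rewrite /rbar e1// e2.
- have rr := ae_oo_cc hrho.
  apply: ae_S3 rE (preimage_null ab Kv0 my yexp rs) (preimage_null ab Kv0 my yexp rr) => xi e1 e2 e3 xab.
  rewrite e1// exprMn -(e2 xab (yab xi xab)).
  apply: ler_pM; rewrite ?sqr_ge0//; [exact: ltW|exact: e3 xab (yab xi xab)|].
  rewrite lerXn2r// ?nnegrE ?q0e//; first exact: ltW.
  by apply: le_trans (q0e xi xab); exact: ltW.
Qed.

End Representatives.

Theorem initial_data (X : lagrangian R) (c0 : R) : calG chi X -> Defs.eqE X (Lmap D0) -> 0 < c0 ->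
  {ae @lebesgue_measure R, forall x, x0 < x < x1 -> c0 <= erho D0 x ^+ 2} ->
  let a := sup [set xi | ly X xi <= x0] in let b := inf [set xi | x1 <= ly X xi] in
  [/\ a < b, ly X a = x0, ly X b = x1 &
  exists (q0 v0 h0 r0 : R -> R) (c1 : R), [/\ 0 < c1,
  [/\ Creg p.-1 a b q0, Creg p.-1 a b v0, Creg p.-1 a b h0 & Creg p.-1 a b r0],
  [/\ aeq a b (y_xi X) q0, aeq a b (U_xi X) v0, aeq a b (lh X) h0 & aeq a b (rbar X) r0] &
  {ae @lebesgue_measure R, forall x, a <= x <= b -> c1 <= lr X x ^+ 2}]].
Proof.
move=> GX eX c00 hrho a b; rewrite /a /b.
have [g [s [Cg Cs pug wg rs]]] := eulerian_repr.
have [ab -> -> [h1 h2] [v0 [h0 [r0 [c1 H]]]]] := initial_data_repr Cg Cs wg rs GX eX c00 pug hrho.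
by split => //; eexists; exists v0, h0, r0, c1; exact: H.
Qed.

End InitialData.

(** * Return to Eulerian coordinates where y_xi is bounded below *)

Section EulerianRegularity.
Context {R : realType}.
Variables (chi : R -> R) (X : lagrangian R) (D : eulerian R).
Hypotheses (hchi : cutoff chi) (hM : Mgraph chi X D).
Variables (p : nat) (a b d : R) (q v h r : R -> R).
Hypotheses (p1 : (1 <= p)%N) (ab : a < b) (d0 : 0 < d).
Hypothesis qd : forall x, a <= x <= b -> d <= q x.
Hypotheses (Cq : Creg p.-1 a b q) (Cv : Creg p.-1 a b v) (Cr : Creg p.-1 a b r).
Hypothesis rr : aeq a b (rbar X) r.
Hypotheses (yq : prim a b (ly X) q) (Uv : prim a b (lU X) v).

Local Notation c := (ly X a).
Local Notation e := (ly X b).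

Let y_expand := prim_expand (Creg_bmf Cq) yq qd.

Let y_cont : continuous (ly X).
Proof.
have [[GX _ _] _ _ _ _] := hM; have [q' [v' [h' [r' HX]]]] := calG_repr hchi GX.
exact: repr_y_continuous HX.
Qed.

Let y_le x x' : x <= x' -> ly X x <= ly X x'.
Proof.
have [[GX _ _] _ _ _ _] := hM; have [q' [v' [h' [r' HX]]]] := calG_repr hchi GX.
move=> xx'; rewrite -subr_ge0 (repr_y_prim HX (lexx x) xx' (lexx x')).
apply: itg_ge0 => z _; exact: repr_q_ge0 HX z.
Qed.

Let y_lt x x' : a <= x -> x < x' -> x' <= b -> ly X x < ly X x'.
Proof.
move=> ax xx' xb; rewrite -subr_gt0; apply: lt_le_trans (y_expand ax (ltW xx') xb).
by rewrite mulr_gt0// subr_gt0.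
Qed.

Let ce : c < e. Proof. exact: y_lt. Qed.

Lemma inverse_exists : exists z : R -> R, forall x, c <= x <= e -> a <= z x <= b /\ ly X (z x) = x.
Proof.
have /choice[z hz] : forall x, exists xi, c <= x <= e -> a <= xi <= b /\ ly X xi = x.
  move=> x; have [xce|_] := boolP (c <= x <= e); last by exists 0.
  have [|xi] := @IVT R (ly X) a b x (ltW ab) (continuous_subspaceT y_cont).
    by rewrite min_l ?max_r// ltW.
  by rewrite in_itv/= => ? ?; exists xi.
by exists z.
Qed.

Section Inverse.
Variable z : R -> R.
Hypothesis zP : forall x, c <= x <= e -> a <= z x <= b /\ ly X (z x) = x.

Let z' x : R := (q (z x))^-1.

Let z_Creg : Creg p.-1 c e z' /\ prim c e z z'.
Proof. exact: (Creg_inverse ab d0 Cq yq qd zP). Qed.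

Let qK : exists2 K, 0 < K & forall x, c <= x <= e -> K <= z' x.
Proof.
have [K K0 hK] := Reg_unif Cq.
have K1 : 0 < K + 1 by rewrite ltr_wpDl.
exists (K + 1)^-1; first by rewrite invr_gt0.
move=> x /zP[zab _]; have qp := qd zab.
rewrite /z' lef_pV2 ?posrE//; last exact: lt_le_trans qp.
by have := ler_norm (q (z x)); have := hK tt (z x) I zab; lra.
Qed.

Let z_le x x' : c <= x -> x < x' -> x' <= e -> z x < z x'.
Proof.
move=> cx xx' x'e.
have [zx Ex] : a <= z x <= b /\ ly X (z x) = x by apply: zP; rewrite cx (le_trans (ltW xx')).
have [zx' Ex'] : a <= z x' <= b /\ ly X (z x') = x' by apply: zP; rewrite x'e (le_trans cx)// ltW.
rewrite ltNge; apply/negP => /y_le; rewrite Ex Ex' leNgt xx'//.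
Qed.

Lemma regular_eu : Winfty p `]c, e[ (eu D).
Proof.
have [_ [[cc [cu _ _]] _ _] uU _ _] := hM.
have ceu : continuous (eu D).
  move=> x; rewrite (_ : eu D = fun x => (eu D x - cc * chi x) + cc * chi x); last first.
    by apply/funext => w; rewrite subrK.
  apply: cvgD; first exact: cu.
  by apply: cvgM; [exact: cvg_cst|exact: cutoff_continuous].
have [Cz pz] := z_Creg; have [K K0 hK] := qK.
have zexp := prim_expand (Creg_bmf Cz) pz hK.
have zab x : c <= x <= e -> a <= z x <= b by case/zP.
have [_ pU] := prim_comp ce ab K0 (Creg_bmf Cz) pz zexp zab (Creg_bmf Cv) Uv.
have Cz' : Creg p.-1.-1 c e z' by apply: Reg_leq Cz; exact: leq_pred.
have Cvz := Creg_comp ce ab K0 Cz' pz hK zab Cv.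
have CU : Creg p c e (fun x => lU X (z x)).
  rewrite -(prednK p1); apply/CregS; eexists; last exact: pU.
  exact: RegM.
apply: (Creg_Winfty ce _ CU).
  by apply: measurable_funS (continuous_measurable_fun ceu).
apply: ae_T => x /andP[cx xe]; have [|_ E] := zP (x := x); first by rewrite !ltW.
by rewrite -uU E.
Qed.

(** Testing the push-forward identity on ]x, x'[ shows that rho - k and r(z) z_x are densities of
    one and the same function, the integral of [r] from [a] to z x; they therefore agree almost
    everywhere. *)
Lemma regular_erho : Winfty p.-1 `]c, e[ (erho D).
Proof.
have [[GX _ _] _ _ _ [L2r push]] := hM.
have [q1 [v1 [h1 [r1 HX]]]] := calG_repr hchi GX.
have [_ _ _ mrb] := repr_measurable0 HX.
have mrk := L2_measurable L2r.
have [Cz pz] := z_Creg; have [K K0 hK] := qK.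
have zexp := prim_expand (Creg_bmf Cz) pz hK.
have zab x : c <= x <= e -> a <= z x <= b by case/zP.
have Cz' : Creg p.-1.-1 c e z' by apply: Reg_leq Cz; exact: leq_pred.
have Crz := Creg_comp ce ab K0 Cz' pz hK zab Cr.
have pr := primitive_prim 0 (bmf_intg (Creg_bmf Cr)).
have [brz prz] := prim_comp ce ab K0 (Creg_bmf Cz) pz zexp zab (Creg_bmf Cr) pr.
have [k1 k10 hk1] := L2_norm_fin L2r.
have [irho _] := L2_norm_itg mrk k10 (ltW ce) hk1.
have irz : intg c e (fun x => r (z x) * z' x) by apply/bmf_intg/bmfM => //; exact: Creg_bmf Cz.
have [mr _] := Creg_bmf Cr.
have prho : prim c e (fun x => 0 + itg a (z x) r) (fun x => erho D x - lk X).
  move=> x x' cx; rewrite le_eqVlt => /predU1P[->|xx'] x'e.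
    by rewrite subrr itgxx.
  have [zx Ex] : a <= z x <= b /\ ly X (z x) = x by apply: zP; rewrite cx (le_trans (ltW xx')).
  have [zx' Ex'] : a <= z x' <= b /\ ly X (z x') = x' by apply: zP; rewrite x'e (le_trans cx)// ltW.
  have /andP[az _] := zx; have /andP[_ zb] := zx'.
  have zz := z_le cx xx' x'e.
  rewrite (pr (z x) (z x') az (ltW zz) zb).
  (* The preimage is taken in the whole line: monotonicity of y everywhere gives one inclusion,
     strict monotonicity on [a, b] the other. *)
  have pre : ly X @^-1` `]x, x'[%classic = `]z x, z x'[%classic.
    apply/seteqP; split => xi /=; rewrite !in_itv/= => /andP[h2 h3]; apply/andP; split.
    - by rewrite ltNge; apply/negP => /y_le; rewrite Ex leNgt h2.
    - by rewrite ltNge; apply/negP => /y_le; rewrite Ex' leNgt h3.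
    - rewrite -[X in X < _]Ex; apply: y_lt => //; exact: le_trans (ltW h3) zb.
    - rewrite -[X in _ < X]Ex'; apply: y_lt => //; exact: le_trans az (ltW h2).
  have bx : bounded_set (`]x, x'[%classic : set R).
    exists (`|x| + `|x'|); split; first exact: num_real.
    move=> B hB xi /=; rewrite in_itv/= => /andP[h2 h3]; apply: le_trans (ltW hB).
    by rewrite ler_norml; have := ler_norm x'; have := ler_norm (- x); rewrite normrN;
      have := normr_ge0 x; have := normr_ge0 x'; lra.
  have := push `]x, x'[%classic (measurable_itv _) bx; rewrite pre.
  have e1 : itg (z x) (z x') r = \int[leb]_(xi in `]z x, z x'[) rbar X xi.
    rewrite Rintegral_oo_cc; last exact: measurable_funS mrb.
    apply: aeq_itg; [by apply: measurable_funS mr => //; exact: subset_itvcc|exact: measurable_funS mrb|].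
    apply: ae_S rr => xi hxi /andP[h2 h3]; rewrite hxi// (le_trans az h2).
    exact: le_trans h3 zb.
  have e2 : itg x x' (fun x => erho D x - lk X) = \int[leb]_(xi in `]x, x'[) (erho D xi - lk X).
    by rewrite Rintegral_oo_cc//; exact: measurable_funS mrk.
  by rewrite e1 e2 /Rintegral => ->.
have E := prim_unique irho irz prho prz.
have ck : Creg p.-1 c e (fun=> lk X) by apply: (@Reg_cst _ _ _ _ _ _ (fun=> lk X) `|lk X|).
have Crho : Creg p.-1 c e (fun x => r (z x) * z' x + lk X) by apply: RegD => //; exact: RegM.
apply: (Creg_Winfty ce _ Crho).
  apply: measurable_funS (_ : measurable_fun setT _) => //.
  rewrite (_ : erho D = fun x => (erho D x - lk X) + lk X); first exact: measurable_funD.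
  by apply/funext => w; rewrite subrK.
apply: ae_S E => x hx /andP[cx xe]; rewrite -hx ?subrK//; by rewrite !ltW.
Qed.

(** The preimage of [A] under y lies in [a, b], where y expands by the factor [d]; it is therefore
    null, and so is its measure for h dxi. *)
Lemma emu_null (A : set (measurableTypeR R)) : measurable A -> A `<=` `]c, e[ ->
  (leb A = 0 -> emu D A = 0)%E.
Proof.
move=> mA Ace A0; have [[GX _ _] _ _ push _] := hM.
rewrite push//.
have my : measurable_fun setT (ly X) by exact: continuous_measurable_fun.
have mpre : measurable (ly X @^-1` A) by rewrite -[X in measurable X]setTI; exact: my.
have [q1 [v1 [h1 [r1 HX]]]] := calG_repr hchi GX.
have [_ _ mlh _] := repr_measurable0 HX.
have aeA : {ae @lebesgue_measure R, forall x, ~ A x} by exists A; split => // x /= /contrapT.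
have my' : measurable_fun (`[a, b] : set R) (ly X) by exact: measurable_funS my.
have [N [mN N0 hN]] := preimage_null ab d0 my' y_expand aeA.
have sub : ly X @^-1` A `<=` N.
  move=> xi Axi; apply: hN => /= h2; apply: h2 (Axi).
  have := Ace _ Axi; rewrite /= in_itv/= => /andP[h2 h3].
  by apply/andP; split; rewrite leNgt; apply/negP => /ltW/y_le; rewrite leNgt ?h2 ?h3.
have pre0 : leb (ly X @^-1` A) = 0%E.
  apply/eqP; rewrite eq_le measure_ge0 andbT -N0; apply: le_measure; rewrite ?inE//.
apply: null_set_integral => //.
by apply/measurable_EFinP; exact: measurable_funS mlh.
Qed.

End Inverse.

Theorem eulerian_regularity : p_regular p `]c, e[ D.
Proof.
have [z zP] := inverse_exists.
have [_ [_ _ ac] _ _ _] := hM; split; [exact: regular_eu zP|exact: regular_erho zP|].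
eexists; first exact: ac.
apply: ac_part_dominated => //; last exact: emu_null.
by move=> A; apply: integral_ge0 => x _; rewrite lee_fin addr_ge0// sqr_ge0.
Qed.

End EulerianRegularity.

Theorem theorem6p1 (R : realType) (chi : R -> R) (hchi : cutoff chi)
    (p : nat) (hp : (1 <= p)%N)
    (D0 : eulerian R) (hD0 : calD chi D0)
    (x0 x1 : R) (hx : x0 < x1)
    (hreg : p_regular p [set` `]x0, x1[] D0)
    (c : R) (hc : 0 < c)
    (hrho : {ae @lebesgue_measure R, forall x, x0 < x < x1 -> c <= erho D0 x ^+ 2})
    (X : R -> lagrangian R) (hX : S_trajectory chi (Lmap D0) X)
    (D : R -> eulerian R) (hD : forall t, 0 <= t -> Mgraph chi (X t) (D t)) :
  let xi0 := sup [set xi | ly (X 0) xi <= x0] in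
  let xi1 := inf [set xi | x1 <= ly (X 0) xi] in
  [/\ ly (X 0) xi0 = x0, ly (X 0) xi1 = x1 &
      forall t, 0 <= t ->
        p_regular p [set` `]ly (X t) xi0, ly (X t) xi1[] (D t)].
Proof.
move=> xi0 xi1; have [hX0 eX] := hX; have [G _ _ _] := hX0.
have [ab h0 h1 [q0 [v0 [r0 [s0 [c1 [c10 C0 E0 hr]]]]]]] :=
  initial_data hchi hD0 hp hx hreg (G 0 (lexx 0)) eX hc hrho.
split => // t t0.
(* The Lagrangian state has order p - 1 only; the order p of u comes from integrating U_xi along an
   inverse of y that is itself of order p. *)
have [d [q [v [h [r [d0 qd [Cq Cv _ Cr] [_ _ _ rr] [yq Uv]]]]]]] :=
  lagrangian_regularity hchi hX0 ab t0 c10 C0 E0 hr.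
by have := eulerian_regularity hchi (hD t t0) hp ab d0 qd Cq Cv Cr rr yq Uv; exact.
Qed.
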